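(* Let $\alpha<\beta$, $\Omega:=(\alpha,\beta)$, $p\in(0,1)$, $b\in C(\overline\Omega)$, $0\le c\in L^\infty(\Omega)$, and $Lu:=-u''+b(x)u'+c(x)u$. Let $m\in L^2(\Omega)$ be a function that changes sign in $\Omega$. For $x\in\overline\Omega$ let $$\overline B_\alpha(x):=e^{\int_\alpha^x b(r)\,dr},\qquad \underline B_\alpha(x):=e^{-\int_\alpha^x b(r)\,dr},$$ and let $$K_b:=\int_\alpha^\beta\overline B_\alpha(x)\,\|\underline B_\alpha\|_{L^2(\alpha,x)}\,dx,\qquad \widetilde m:=\frac{m}{K_b\,\|m^+\|_{L^2(\alpha,\beta)}}-c .$$ Suppose there exist $\alpha\le x_0<x_1\le\beta$ such that $0\not\equiv\widetilde m\ge0$ in $I:=(x_0,x_1)$ and $$(1-p)\max\left\{\int_{x_0}^\beta\overline B_\alpha(x)\,\|\widetilde m^-\underline B_\alpha\|_{L^1(x,\beta)}\,dx,\;\int_\alpha^{x_1}\overline B_\alpha(x)\,\|\widetilde m^-\underline B_\alpha\|_{L^1(\alpha,x)}\,dx\right\}<\frac{1}{\lambda_1(\widetilde m,I)},$$ where $\lambda_1(\widetilde m,I)$ is the positive principal eigenvalue of the operator $u\mapsto -u''+bu'$ with weight $\widetilde m$ in $I$. Then there exists a solution $u\in W^{2,2}(\Omega)$ of $$Lu=m u^p\text{ in }\Omega,\qquad u>0\text{ in }\Omega,\qquad u=0\text{ on }\partial\Omega.$$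
   Context: For a function $h$, $h^+=\max(h,0)$ and $h^-=\max(-h,0)$; ''$m$ changes sign in $\Omega$'' means that neither $m^+$ nor $m^-$ vanishes a.e. in $\Omega$. A solution of the problem is a function $u\in W^{2,2}(\Omega)\cap W^{1,2}_0(\Omega)$ with $u(x)>0$ for all $x\in\Omega$ satisfying the equation for a.e. $x\in\Omega$. The positive principal eigenvalue $\lambda_1(\widetilde m,I)$ of $-u''+bu'$ is the unique $\lambda>0$ for which there is $\varphi\in W^{2,2}(I)\cap W^{1,2}_0(I)$ with $\varphi>0$ in $I$ and $-\varphi''+b\varphi'=\lambda\widetilde m\varphi$ a.e. in $I$. *)

(* Defs.v *)
From HB Require Import structures.
From mathcomp Require Import all_boot all_order all_algebra.
From mathcomp Require Import all_classical all_reals all_analysis.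
Set Implicit Arguments.
Unset Strict Implicit.
Unset Printing Implicit Defensive.
Import Order.TTheory GRing.Theory Num.Theory.
Import numFieldNormedType.Exports.
Local Open Scope classical_set_scope.
Local Open Scope ring_scope.

Section Lebesgue_spaces.
Context {R : realType}.
Notation mu := (@lebesgue_measure R).

Definition ae_in (s t : R) (P : R -> Prop) : Prop :=
  {ae mu, forall x, x \in `]s, t[ -> P x}.

(* L^q(s, t): only the values on ]s, t[ matter. *)
Definition Lspace_itv (q : \bar R) (s t : R) (f : R -> R) : Prop :=
  f \_ `]s, t[ \in Lfun mu q.

Definition Lnorm_itv (q : \bar R) (s t : R) (f : R -> R) : \bar R :=
  ('N[mu]_q [EFin \o (f \_ `]s, t[)])%E.

Definition changes_sign (s t : R) (f : R -> R) : Prop :=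
  ~ ae_in s t (fun x => f^\+ x = 0) /\ ~ ae_in s t (fun x => f^\- x = 0).

End Lebesgue_spaces.

Section Sobolev_spaces.
Context {R : realType}.
Notation mu := (@lebesgue_measure R).

(* C^1_c(s, t), extended by 0 to the whole line. *)
Definition test_function (s t : R) (phi : R -> R) : Prop :=
  [/\ forall x, derivable phi x 1,
      continuous phi^`()%classic,
      compact (closure [set x | phi x != 0]) &
      closure [set x | phi x != 0] `<=` `]s, t[].

Definition weak_derivative (s t : R) (u v : R -> R) : Prop :=
  forall phi, test_function s t phi ->
    \int[mu]_(x in `]s, t[) (u x * phi^`()%classic x) =
    - \int[mu]_(x in `]s, t[) (v x * phi x).

(* u is in W^{1,2}(s, t), with weak derivative u1. *)
Definition W12 (s t : R) (u u1 : R -> R) : Prop :=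
  [/\ Lspace_itv 2%:E s t u, Lspace_itv 2%:E s t u1 &
      weak_derivative s t u u1].

(* u is in W^{2,2}(s, t), with first and second weak derivatives u1, u2. *)
Definition W22 (s t : R) (u u1 u2 : R -> R) : Prop :=
  W12 s t u u1 /\ W12 s t u1 u2.

(* The closure of C^1_c(s, t) in W^{1,2}(s, t). *)
Definition W12_0 (s t : R) (u : R -> R) : Prop :=
  exists2 u1, W12 s t u u1 &
    forall e : R, 0 < e -> exists phi, [/\ test_function s t phi,
      (Lnorm_itv 2%:E s t (u \- phi)%R < e%:E)%E &
      (Lnorm_itv 2%:E s t (u1 \- phi^`()%classic)%R < e%:E)%E].

(* u is a positive element of W^{2,2}(s, t) `&` W^{1,2}_0(s, t), with weak
   derivatives u1, u2. Positivity at every point refers to the continuous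
   representative, so u is required to be that representative, up to the
   endpoints of the interval. *)
Definition positive_W22_0 (s t : R) (u u1 u2 : R -> R) : Prop :=
  [/\ W22 s t u u1 u2, W12_0 s t u, {within `[s, t], continuous u} &
      forall x, x \in `]s, t[ -> 0 < u x].

End Sobolev_spaces.

Section Problem.
Context {R : realType}.
Notation mu := (@lebesgue_measure R).

(* L u = - u'' + b u' + c u, where u1 and u2 stand for u' and u''. *)
Definition Lop (b c u u1 u2 : R -> R) (x : R) : R :=
  - u2 x + b x * u1 x + c x * u x.

Definition is_solution (alpha beta p : R) (b c m u : R -> R) : Prop :=
  exists u1 u2, positive_W22_0 alpha beta u u1 u2 /\
    ae_in alpha beta (fun x => Lop b c u u1 u2 x = m x * u x `^ p).

Definition is_principal_eigenvalue (b w : R -> R) (s t lambda : R) : Prop :=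
  0 < lambda /\ exists phi phi1 phi2, positive_W22_0 s t phi phi1 phi2 /\
    ae_in s t (fun x => - phi2 x + b x * phi1 x = lambda * w x * phi x).

(* The positive principal eigenvalue of - u'' + b u' with weight w on ]s, t[.
   The default value 0 is only reached when there is no such eigenvalue. *)
Definition lambda1 (b w : R -> R) (s t : R) : R :=
  xget 0 [set lambda | is_principal_eigenvalue b w s t lambda].

Definition Bup (alpha : R) (b : R -> R) (x : R) : R :=
  expR (\int[mu]_(r in `[alpha, x]) b r).

Definition Blow (alpha : R) (b : R -> R) (x : R) : R :=
  expR (- \int[mu]_(r in `[alpha, x]) b r).

Definition Kb (alpha beta : R) (b : R -> R) : R :=
  \int[mu]_(x in `[alpha, beta])
    (Bup alpha b x * fine (Lnorm_itv 2%:E alpha x (Blow alpha b))).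

Definition mtilde (alpha beta : R) (b c m : R -> R) (x : R) : R :=
  m x / (Kb alpha beta b * fine (Lnorm_itv 2%:E alpha beta m^\+)) - c x.

End Problem.

(* Main.v *)
(* With A = exp(int b), the operator - u'' + b u' is - A (u' / A)', so the
   problem is a fixed-point equation for the solution operator of a Dirichlet
   problem with integrable data. After scaling u, the weight m becomes
   m' = m / (Kb ||m^+||_2), for which lambda1 >= 1, and m' - c is mtilde.
   There are three lower barriers with values in [0, 1]: on I a
   multiple of the principal eigenfunction, normalised by
   max^(1-p) = 1 / lambda1; on [alpha, xs] and [xs, beta], where xs is the
   maximum point of the eigenfunction, the powers z^(1/(1-p)) of solutions of
   linear initial value problems driven by (1-p) mtilde^-. The integral bounds
   guarantee that these powers lie below the eigenfunction at xs.
   Truncating the nonlinearity at the barriers and taking the maximum of the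
   truncated right-hand sides gives a bounded Caratheodory problem, solved by
   shooting for a delayed equation followed by compactness; the comparison
   principle puts its solution above every barrier, where the truncation is
   inactive. *)
Require Import Defs.
From mathcomp Require Import all_boot all_order all_algebra.
From mathcomp Require Import all_classical all_reals all_analysis.
From mathcomp Require Import measurable_realfun ess_sup_inf ring lra.
Set Implicit Arguments.
Unset Strict Implicit.
Unset Printing Implicit Defensive.
Import Order.TTheory GRing.Theory Num.Theory.
Import numFieldNormedType.Exports.
Local Open Scope classical_set_scope.
Local Open Scope ring_scope.

(** Since [m] changes sign and [p < 1], the right-hand side is neither monotone in [u] nor Lipschitz
    at 0, and [u = 0] satisfies the equation: all depends on lower barriers that are positive
    inside. For [0 <= u <= 1] one has [c * u <= c * u ^ p], so that below 1 the single weight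
    [m' - c] governs both terms. The scale [Kb ||m^+||_2] is the one for which two integrations of
    the eigenvalue equation and Cauchy-Schwarz yield [lambda1 >= 1], and this keeps the
    eigenfunction barrier below 1. The substitution z = v^(1-p) makes the equation of the outer
    barriers linear up to a term of good sign, whence the factor 1 - p; in the variable z the
    eigenfunction has height [1 / lambda1] at [xs], which is the bound of the hypothesis. The
    barriers are not glued into one function: they are compared with the solution one at a time, the
    eigenfunction providing the boundary value at [xs] for the two others. As [m] is merely in L^2,
    comparison works on integrated equations, with [u] and the continuous quasi-derivative [u' / A]
    as the unknowns. *)

#[local] Instance ae_lebesgue_filter {R : realType} :
  Filter (nbhs (almost_everywhere (@lebesgue_measure R))).
Proof. exact: (ae_filter_ringOfSetsType lebesgue_measure). Qed.

(** * Integrals over compact intervals *)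

Section interval_integrals.
Context {R : realType}.
Notation mu := (@lebesgue_measure R).
Implicit Types (f g : R -> R) (a b c d x y : R).

Definition L1 a b f : Prop := mu.-integrable `[a, b] (EFin \o f).

(** Not the oriented integral: for [b <= a] the value is 0, so additivity and the fundamental
    theorem are stated for ordered points. *)
Definition Int f a b : R := \int[mu]_(x in `[a, b]) f x.

Lemma ae_in_sub a b c d (P : R -> Prop) : a <= c -> d <= b ->
  ae_in a b P -> ae_in c d P.
Proof.
move=> ac db; rewrite /ae_in; apply: filterS => x Px; rewrite in_itv/= => /andP[cx xd].
by apply: Px; rewrite in_itv/= (le_lt_trans ac cx) (lt_le_trans xd db).
Qed.

Lemma ae_in_imp a b (P Q : R -> Prop) : (forall x, a < x < b -> P x -> Q x) ->
  ae_in a b P -> ae_in a b Q.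
Proof. by move=> PQ; rewrite /ae_in; apply: filterS => x Px xab; apply: PQ => //; exact: Px. Qed.

Lemma ae_in_and a b (P Q : R -> Prop) : ae_in a b P -> ae_in a b Q ->
  ae_in a b (fun x => P x /\ Q x).
Proof. by rewrite /ae_in; apply: filterS2 => x Px Qx xab; split; [exact: Px|exact: Qx]. Qed.

Lemma ae_in_all a b (P : R -> Prop) : (forall x, a < x < b -> P x) -> ae_in a b P.
Proof. by move=> h; apply: aeW => x; rewrite in_itv/=; exact: h. Qed.

Lemma ae_in_cc a b (P : R -> Prop) : ae_in a b P ->
  {ae mu, forall x, `[a, b]%classic x -> P x}.
Proof.
move=> h.
have na y : {ae mu, forall x, x <> y}.
  exists [set y]; split => //; first exact: lebesgue_measure_set1.
  by move=> x /= /contrapT.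
near=> x => /=; rewrite in_itv/= => /andP[ax xb].
have xa : x <> a by near: x; exact: na.
have xb' : x <> b by near: x; exact: na.
have hx : x \in `]a, b[ -> P x by near: x; exact: h.
apply: hx; rewrite in_itv/=.
by rewrite !lt_neqAle ax xb !andbT eq_sym; apply/andP; split; exact/eqP.
Unshelve. all: by end_near. Qed.

Lemma L1_meas a b f : L1 a b f -> measurable_fun `[a, b] f.
Proof. by move=> /integrableP[/measurable_EFinP]. Qed.

Lemma L1_sub a b c d f : a <= c -> d <= b -> L1 a b f -> L1 c d f.
Proof.
by move=> ac db; apply: integrableS => //; apply: subset_itvScc; rewrite bnd_simp.
Qed.

Lemma L1_cont a b f : continuous f -> L1 a b f.
Proof.
move=> cf; apply: continuous_compact_integrable; first exact: segment_compact.
exact: continuous_subspaceT.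
Qed.

Lemma L1_le a b f g : measurable_fun `[a, b] f -> L1 a b g ->
  ae_in a b (fun x => `|f x| <= g x) -> L1 a b f.
Proof.
move=> mf Lg /ae_in_cc fg; apply/integrableP; split; first exact/measurable_EFinP.
have /integrableP[mg] := Lg; apply: le_lt_trans.
apply: ae_ge0_le_integral => //.
- exact/measurableT_comp/measurable_EFinP.
- exact: measurableT_comp.
- by apply: filterS fg => x h /h fgx; rewrite lee_fin (le_trans fgx)// ler_norm.
Qed.

Lemma L1D a b f g : L1 a b f -> L1 a b g -> L1 a b (fun x => f x + g x).
Proof. by move=> Lf Lg; apply: (integrableD _ Lf Lg). Qed.

Lemma L1B a b f g : L1 a b f -> L1 a b g -> L1 a b (fun x => f x - g x).
Proof. by move=> Lf Lg; apply: (integrableB _ Lf Lg). Qed.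

Lemma L1Z a b f k : L1 a b f -> L1 a b (fun x => k * f x).
Proof. by move=> Lf; apply: (integrableZl _ _ Lf). Qed.

Lemma L1N a b f : L1 a b f -> L1 a b (fun x => - f x).
Proof. by move=> Lf; have := L1Z (-1) Lf; under eq_fun do rewrite mulN1r. Qed.

Lemma L1_norm a b f : L1 a b f -> L1 a b (fun x => `|f x|).
Proof. by move=> Lf; have := integrable_abse Lf. Qed.

Lemma L1_eq a b f g : (forall x, a <= x <= b -> f x = g x) -> L1 a b f -> L1 a b g.
Proof.
move=> fg; apply: eq_integrable => // x; rewrite inE/= in_itv/= => /fg h.
by rewrite /= h.
Qed.

Lemma eq_Int a b f g : (forall x, a <= x <= b -> f x = g x) -> Int f a b = Int g a b.
Proof. by move=> fg; apply: eq_Rintegral => x; rewrite inE/= in_itv/=; exact: fg. Qed.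

Lemma eq_Int_ae a b f g : L1 a b f -> measurable_fun `[a, b] g ->
  ae_in a b (fun x => f x = g x) -> Int f a b = Int g a b.
Proof.
move=> Lf mg /ae_in_cc fg; congr fine; apply: ae_eq_integral => //.
- by apply/measurable_EFinP; exact: L1_meas Lf.
- exact/measurable_EFinP.
- by apply: filterS fg => x h /h ->.
Qed.

(** The function [max f g] dominates [f] everywhere and agrees with [g] almost everywhere, which
    splits the claim into a pointwise inequality and an a.e. equality. *)
Lemma le_Int_ae a b f g : L1 a b f -> L1 a b g ->
  ae_in a b (fun x => f x <= g x) -> Int f a b <= Int g a b.
Proof.
move=> Lf Lg fg.
pose h x := Num.max (f x) (g x).
have mh : measurable_fun `[a, b] h by apply: measurable_maxr; exact: L1_meas.
have Lh : L1 a b h.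
  apply: (L1_le (g := fun x => `|f x| + `|g x|)) => //.
    by apply: L1D; exact: L1_norm.
  apply: ae_in_all => x _; rewrite /h.
  by case: (leP (f x) (g x)) => _; rewrite ?lerDl ?lerDr normr_ge0.
apply: (@le_trans _ _ (Int h a b)).
  by apply: le_Rintegral => // x _; rewrite /h le_max lexx.
by rewrite (@eq_Int_ae _ _ h g)//; [exact: L1_meas|apply: ae_in_imp fg => x _ /max_idPr].
Qed.

Lemma Int_ge0 a b f : L1 a b f -> ae_in a b (fun x => 0 <= f x) -> 0 <= Int f a b.
Proof.
move=> Lf f0; have L0 : L1 a b (fun=> 0) by apply: L1_cont => x; exact: cvg_cst.
have := le_Int_ae L0 Lf f0; apply: le_trans.
by rewrite /Int Rintegral_cst// mul0r.
Qed.

Lemma Int_nil a b f : b <= a -> Int f a b = 0.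
Proof.
rewrite le_eqVlt => /predU1P[->|ba].
  by rewrite /Int set_itv1 Rintegral_set1.
by rewrite /Int set_itv_ge ?Rintegral_set0// bnd_simp -ltNge.
Qed.

Lemma Int_cst a b k : a <= b -> Int (fun=> k) a b = k * (b - a).
Proof.
move=> ab; rewrite /Int Rintegral_cst//=; congr (_ * _).
rewrite lebesgue_measure_itv/= lte_fin.
have [_|] := ltP a b; first by rewrite -EFinB.
by move=> ba; have /eqP -> : a == b by [rewrite eq_le ab]; rewrite subrr.
Qed.

Lemma IntZ a b f k : L1 a b f -> Int (fun x => k * f x) a b = k * Int f a b.
Proof. by move=> Lf; exact: RintegralZl. Qed.

Lemma IntN a b f : L1 a b f -> Int (fun x => - f x) a b = - Int f a b.
Proof.
by move=> Lf; rewrite -mulN1r -IntZ//; apply: eq_Int => x _; rewrite mulN1r.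
Qed.

Lemma IntD a b f g : L1 a b f -> L1 a b g ->
  Int (fun x => f x + g x) a b = Int f a b + Int g a b.
Proof. by move=> Lf Lg; exact: RintegralD. Qed.

Lemma IntB a b f g : L1 a b f -> L1 a b g ->
  Int (fun x => f x - g x) a b = Int f a b - Int g a b.
Proof. by move=> Lf Lg; exact: RintegralB. Qed.

Lemma ler_norm_Int a b f : L1 a b f -> `|Int f a b| <= Int (fun x => `|f x|) a b.
Proof. by move=> Lf; exact: le_normr_Rintegral. Qed.

Lemma Int_cat a b c f : a <= c -> c <= b -> L1 a b f ->
  Int f a b = Int f a c + Int f c b.
Proof.
move=> ac cb Lf; rewrite /Int -(@Rintegral_itv_obnd_cbnd _ c (BRight b)); last first.
  by apply: integrableS Lf => //; apply: subset_itvr; rewrite bnd_simp.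
rewrite -(@Rintegral_itvB _ f (BLeft a) (BRight b) c)// ?bnd_simp//.
by rewrite addrC subrK.
Qed.

Lemma ler_norm_Int_cst a b f k : a <= b -> L1 a b f ->
  ae_in a b (fun x => `|f x| <= k) -> `|Int f a b| <= k * (b - a).
Proof.
move=> ab Lf fk; apply: (le_trans (ler_norm_Int Lf)); rewrite -Int_cst//.
by apply: le_Int_ae => //; [exact: L1_norm|apply: L1_cont => x; exact: cvg_cst].
Qed.

Lemma Int_sub_le a b c d f : a <= c -> c <= d -> d <= b -> L1 a b f ->
  ae_in a b (fun x => 0 <= f x) -> Int f c d <= Int f a b.
Proof.
move=> ac cd db Lf f0.
rewrite (@Int_cat a b c)// ?(le_trans cd)// (@Int_cat c b d)//; last first.
  exact: L1_sub Lf.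
have : 0 <= Int f a c.
  by apply: Int_ge0; [apply: L1_sub Lf => //; exact: le_trans cd db
                     |apply: ae_in_sub f0 => //; exact: le_trans cd db].
have : 0 <= Int f d b.
  by apply: Int_ge0; [apply: L1_sub Lf => //; exact: le_trans ac cd
                     |apply: ae_in_sub f0 => //; exact: le_trans ac cd].
lra.
Qed.

(** Composition with this retraction onto [a, b] extends functions from the interval to the line, so
    that continuity can be stated globally. *)
Definition clamp a b x : R := Num.max a (Num.min x b).

Lemma clamp_in a b x : a <= b -> a <= clamp a b x <= b.
Proof. by move=> ab; rewrite /clamp le_max lexx /= ge_max ab ge_min lexx orbT. Qed.

Lemma clamp_id a b x : a <= x <= b -> clamp a b x = x.
Proof.
by move=> /andP[ax xb]; rewrite /clamp (min_idPl _)//; exact/max_idPr.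
Qed.

Lemma clamp_continuous a b : continuous (clamp a b).
Proof.
move=> x; apply: (@continuous_max _ _ (fun=> a) (fun x => Num.min x b) x).
  exact: cvg_cst.
apply: (@continuous_min _ _ (fun x => x) (fun=> b) x); first exact: cvg_id.
exact: cvg_cst.
Qed.

Lemma continuous_clamp a b f : a <= b ->
  {within `[a, b], continuous f} -> continuous (f \o clamp a b).
Proof.
move=> ab /subspace_continuousP cf x.
have cx : `[a, b]%classic (clamp a b x) by rewrite /= in_itv/= clamp_in.
apply/cvgrPdist_lt => e e0.
have /cvgrPdist_lt/(_ e e0) := cf _ cx.
rewrite near_withinE => H.
near=> y.
have h : `[a, b]%classic (clamp a b y) ->
    `|f (clamp a b x) - f (clamp a b y)| < e.
  by near: y; exact: (clamp_continuous (a := a) (b := b) (x := x) H).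
by apply: h; rewrite /= in_itv/= clamp_in.
Unshelve. all: by end_near. Qed.

Lemma continuous_Int_clamp a b f : a <= b -> L1 a b f ->
  continuous (fun x => Int f a (clamp a b x)).
Proof.
move=> ab Lf; apply: (@continuous_clamp a b (fun x => Int f a x)) => //.
exact: parameterized_integral_continuous.
Qed.

Lemma continuous_Int f a : continuous f -> continuous (Int f a).
Proof.
move=> cf x; pose b := Num.max a x + 1.
have ab : a <= b by rewrite /b; case: (leP a x); lra.
have xb : x < b by rewrite /b; case: (leP a x); lra.
have E y : y < b -> Int f a y = Int f a (clamp a b y).
  move=> yb; have [ya|ay] := leP y a.
    by rewrite !Int_nil// /clamp ge_max lexx /= (min_idPl _)// ltW.
  by rewrite clamp_id// (ltW ay) ltW.
have cI := continuous_Int_clamp ab (@L1_cont a b f cf) (x := x).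
rewrite /continuous_at E//; apply: cvg_trans cI.
apply: near_eq_cvg; near=> y; rewrite -E//.
by near: y; exact: lt_nbhsl.
Unshelve. all: by end_near. Qed.

(** The inequality [a < x] is strict because [Int f a] is constantly 0 to the left of [a], so that a
    two-sided derivative may fail to exist at [a]. *)
Lemma is_derive_Int f a x : continuous f -> a < x ->
  is_derive x 1 (Int f a) (f x).
Proof.
move=> cf ax.
have xx1 : x < x + 1 by rewrite ltrDl.
have [|h1 h2] := @continuous_FTC1_closed R f a x (x + 1) xx1 (@L1_cont a (x + 1) f cf) ax; first exact: cf.
by apply: DeriveDef => //; rewrite -derive1E.
Qed.

(* At an interior positive maximum of w its quasi-derivative W vanishes; as W
   then increases up to the next zero of w, that zero cannot be reached. *)
Lemma quasi_convex_le0 a b (A W w : R -> R) :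
  continuous A -> continuous W -> (forall x, 0 < A x) ->
  (forall x, a <= x <= b -> w x = w a + Int (fun y => A y * W y) a x) ->
  w a <= 0 -> w b <= 0 ->
  (forall x y, a <= x -> x <= y -> y <= b ->
     (forall t, x <= t <= y -> 0 < w t) -> W x <= W y) ->
  forall x, a <= x <= b -> w x <= 0.
Proof.
move=> cA cW A0 wE wa wb mono z zab; rewrite leNgt; apply/negP => wz.
have az : a < z.
  by move: zab => /andP[]; rewrite le_eqVlt => /predU1P[az|//]; move: wz; rewrite -az ltNge wa.
have zb : z < b.
  by move: zab => /andP[_]; rewrite le_eqVlt => /predU1P[e|//]; move: wz; rewrite e ltNge wb.
have ab : a < b by exact: lt_trans zb.
have cAW : continuous (fun y => A y * W y) by move=> y; apply: cvgM; [exact: cA|exact: cW].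
pose v x := w a + Int (fun y => A y * W y) a x.
have cv : continuous v.
  by move=> x; apply: cvgD; [exact: cvg_cst|exact: continuous_Int].
have vw x : a <= x <= b -> v x = w x by move=> /wE ->.
have [|c + cmax] := @EVT_max R v a b (ltW ab); first exact: continuous_subspaceT.
rewrite in_itv/= => cab.
have vc : 0 < v c.
  by apply: (lt_le_trans wz); rewrite -vw//; apply: cmax; rewrite in_itv.
have ac : a < c.
  move: cab => /andP[]; rewrite le_eqVlt => /predU1P[ac|//]; move: vc.
  by rewrite -ac vw ?lexx ?ltW// ltNge wa.
have cb : c < b.
  move: cab => /andP[_]; rewrite le_eqVlt => /predU1P[e|//]; move: vc.
  by rewrite e vw ?lexx ?andbT ?ltW// ltNge wb.
have dv x : a < x -> is_derive x 1 v (A x * W x).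
  move=> ax; have dI := is_derive_Int cAW ax.
  rewrite (_ : v = cst (w a) + Int (fun y => A y * W y) a)//.
  by rewrite -[A x * W x]add0r; apply: is_deriveD.
have Wc : W c = 0.
  have h := @derive1_at_max R v a b c (ltW ab).
  have : is_derive c 1 v 0.
    apply: h; last 2 first.
    - by rewrite in_itv/= ac cb.
    - move=> t tab; apply: cmax; move: tab; rewrite !in_itv/= => /andP[? ?].
      by rewrite !ltW.
    by move=> t; rewrite in_itv/= => /andP[/dv[]].
  have [_ e1] := dv c ac; move=> [_]; rewrite e1 => /eqP.
  by rewrite mulf_eq0 gt_eqF//= => /eqP.
(* Its infimum [d] is the first point after the maximum where [v] has ceased to be positive;
   [v d <= 0] by continuity, while [W >= W c = 0] up to [d] gives [v d >= v c > 0]. *)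
pose E := [set x | c <= x <= b /\ v x <= 0].
have Eb : E b by split; [rewrite (ltW cb) lexx|rewrite vw// (ltW ab) lexx].
have hiE : has_inf E by split; [exists b|exists c => x [/andP[]]].
pose d := inf E.
have cd : c <= d by apply: lb_le_inf; [exists b|move=> x [/andP[]]].
have db : d <= b by apply: ge_inf => //; exact: hiE.2.
have vd : v d <= 0.
  rewrite leNgt; apply/negP => vd0.
  have /nbhs_ballP[e /= e0 He] : \forall y \near d, 0 < v y.
    by have /cvgr_gt := cv d; exact.
  have := inf_adherent e0 hiE => -[y [/andP[cy yb] vy] yd].
  have dy : d <= y by apply: ge_inf; [exact: hiE.2|split=> //; rewrite cy yb].
  have /He/= : ball d e y by rewrite /ball/= ler0_norm; rewrite ?subr_le0// opprB ltrBlDl.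
  by rewrite ltNge vy.
have pos t : c <= t < d -> 0 < v t.
  move=> /andP[ct td]; rewrite ltNge; apply/negP => vt.
  have : d <= t by apply: ge_inf; [exact: hiE.2|split=> //; rewrite ct (le_trans (ltW td))].
  by rewrite leNgt td.
have W0 t : c <= t < d -> 0 <= W t.
  move=> /andP[ct td]; rewrite -Wc; apply: mono => //; rewrite ?(ltW ac)//.
    by rewrite (le_trans (ltW td)).
  move=> s /andP[cs st]; rewrite -vw; first by apply: pos; rewrite cs (le_lt_trans st).
  by rewrite (le_trans (ltW ac) cs) (le_trans st)// (le_trans (ltW td)).
have : v c <= v d.
  rewrite /v lerD2l (@Int_cat a d c)// ?(ltW ac)//; last exact: L1_cont.
  rewrite lerDl; apply: Int_ge0; first exact: L1_cont.
  apply: ae_in_all => x /andP[cx xd]; rewrite mulr_ge0 ?(ltW (A0 _))//.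
  by apply: W0; rewrite (ltW cx) xd.
by rewrite leNgt (le_lt_trans vd vc).
Qed.

End interval_integrals.

(** * The linear Dirichlet problem *)

Section dirichlet_operator.
Context {R : realType}.
Notation mu := (@lebesgue_measure R).
Variables (a b : R) (A : R -> R).
Hypotheses (ab : a < b) (cA : continuous A) (A0 : forall x, 0 < A x).
Implicit Types (g k : R -> R) (s t x y : R).

(* u = ivp s g solves - (u' / A)' = g with u a = 0 and (u' / A) a = s, and its
   flux is u' / A; for s = slope g one also has u b = 0. *)
Definition prim g y : R := Int g a (clamp a b y).

Definition flux s g y : R := s - prim g y.

Definition ivp s g x : R := Int (fun y => A y * flux s g y) a x.

Definition slope g : R := Int (fun y => A y * prim g y) a b / Int A a b.

Definition dirichlet g x : R := ivp (slope g) g x.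

Lemma prim_continuous g : L1 a b g -> continuous (prim g).
Proof. by move=> Lg; apply: continuous_Int_clamp => //; exact: ltW. Qed.

Lemma flux_continuous s g : L1 a b g -> continuous (flux s g).
Proof. by move=> Lg x; apply: cvgB; [exact: cvg_cst|exact: prim_continuous]. Qed.

Lemma ivp_integrand_continuous s g : L1 a b g ->
  continuous (fun y => A y * flux s g y).
Proof. by move=> Lg x; apply: cvgM; [exact: cA|exact: flux_continuous]. Qed.

Lemma ivp_continuous s g : L1 a b g -> continuous (ivp s g).
Proof. by move=> Lg; apply: continuous_Int; exact: ivp_integrand_continuous. Qed.

Lemma IntA_gt0 : 0 < Int A a b.
Proof.
have [|c _ cmin] := @EVT_min R A a b (ltW ab); first exact: continuous_subspaceT.
apply: (@lt_le_trans _ _ (A c * (b - a))); first by rewrite mulr_gt0 ?subr_gt0.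
rewrite -(Int_cst _ (ltW ab)); apply: le_Int_ae.
- by apply: L1_cont => x; exact: cvg_cst.
- exact: L1_cont.
- by apply: ae_in_all => x /andP[? ?]; apply: cmin; rewrite in_itv/= !ltW.
Qed.

Lemma A_bound : exists2 K, 0 < K & forall x, a <= x <= b -> A x <= K.
Proof.
have [|c _ cmax] := @EVT_max R A a b (ltW ab); first exact: continuous_subspaceT.
by exists (A c) => // x xab; apply: cmax; rewrite in_itv.
Qed.

Lemma ivp_end s g : L1 a b g ->
  ivp s g b = s * Int A a b - Int (fun y => A y * prim g y) a b.
Proof.
move=> Lg; rewrite /ivp /flux.
rewrite (@eq_Int _ _ _ _ (fun y => s * A y - A y * prim g y)); last first.
  by move=> x _; ring.
have cAp : continuous (fun y => A y * prim g y).
  by move=> x; apply: cvgM; [exact: cA|exact: prim_continuous].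
by rewrite IntB ?IntZ//; [exact: L1_cont|apply: L1Z; exact: L1_cont|exact: L1_cont].
Qed.

Lemma dirichlet_end g : L1 a b g -> dirichlet g b = 0.
Proof.
by move=> Lg; rewrite /dirichlet ivp_end// /slope divfK ?subrr// gt_eqF// IntA_gt0.
Qed.

Lemma ivp_dirichlet s g : L1 a b g -> ivp s g b = 0 -> s = slope g.
Proof.
move=> Lg; rewrite ivp_end// => /eqP; rewrite subr_eq0 => /eqP h.
by rewrite /slope -h mulfK// gt_eqF// IntA_gt0.
Qed.

Lemma prim_diff g k y : L1 a b g -> L1 a b k ->
  `|prim g y - prim k y| <= Int (fun x => `|g x - k x|) a b.
Proof.
move=> Lg Lk; have /andP[h1 h2] := clamp_in y (ltW ab).
rewrite /prim -IntB; [|exact: L1_sub Lg|exact: L1_sub Lk].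
apply: (le_trans (ler_norm_Int _)).
  by apply: L1B; [exact: L1_sub Lg|exact: L1_sub Lk].
apply: Int_sub_le => //; first by apply: L1_norm; exact: L1B.
by apply: ae_in_all => x _; rewrite normr_ge0.
Qed.

Lemma prim_le g y : L1 a b g -> `|prim g y| <= Int (fun x => `|g x|) a b.
Proof.
move=> Lg; have /andP[h1 h2] := clamp_in y (ltW ab).
apply: (le_trans (ler_norm_Int _)); first exact: L1_sub Lg.
apply: Int_sub_le => //; first exact: L1_norm.
by apply: ae_in_all => x _; rewrite normr_ge0.
Qed.

(** [slope g] is the mean of [prim g] for the weight [A], so two slopes differ by no more than the
    primitives do. *)
Lemma slope_diff g k : L1 a b g -> L1 a b k ->
  `|slope g - slope k| <= Int (fun x => `|g x - k x|) a b.
Proof.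
move=> Lg Lk; rewrite /slope -mulrBl normrM (gtr0_norm (x := (_)^-1)); last first.
  by rewrite invr_gt0 IntA_gt0.
rewrite ler_pdivrMr ?IntA_gt0//.
have c1 f : L1 a b f -> continuous (fun y => A y * prim f y).
  by move=> Lf x; apply: cvgM; [exact: cA|exact: prim_continuous].
rewrite -IntB; [|exact/L1_cont/c1..].
apply: (le_trans (ler_norm_Int _)); first by apply: L1B; exact/L1_cont/c1.
rewrite -IntZ; last exact: L1_cont.
apply: le_Int_ae.
- by apply/L1_norm/L1B; exact/L1_cont/c1.
- by apply: L1Z; exact: L1_cont.
- apply: ae_in_all => x _; rewrite -mulrBr normrM (gtr0_norm (A0 x)) mulrC.
  by rewrite ler_wpM2r ?(ltW (A0 x))//; exact: prim_diff.
Qed.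

Lemma slope_le g : L1 a b g -> `|slope g| <= Int (fun x => `|g x|) a b.
Proof.
move=> Lg; have L0 : L1 a b (fun=> 0) by apply: L1_cont => x; exact: cvg_cst.
have := slope_diff Lg L0.
rewrite (_ : slope (fun=> 0) = 0) ?subr0; last first.
  rewrite /slope (@eq_Int _ _ _ _ (fun=> 0)) ?Int_cst ?ltW// ?mul0r// => x _.
  have /andP[h _] := clamp_in x (ltW ab).
  by rewrite /prim Int_cst// mul0r mulr0.
by under eq_Int do rewrite subr0.
Qed.

Lemma ivp_diff K s t g k x : (forall x, a <= x <= b -> A x <= K) ->
  L1 a b g -> L1 a b k -> a <= x <= b ->
  `|ivp s g x - ivp t k x| <=
    K * (b - a) * (`|s - t| + Int (fun y => `|g y - k y|) a b).
Proof.
move=> AK Lg Lk /andP[ax xb].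
have L f r : L1 a b f -> L1 a x (fun y => A y * flux r f y).
  by move=> Lf; apply: L1_cont; exact: ivp_integrand_continuous.
rewrite /ivp -IntB; [|exact: L..].
set J := `|s - t| + _.
have J0 : 0 <= J.
  apply: addr_ge0 => //; apply: Int_ge0; first by apply: L1_norm; exact: L1B.
  by apply: ae_in_all => y _; rewrite normr_ge0.
have K0 : 0 <= K by apply: (le_trans (ltW (A0 a))); apply: AK; rewrite lexx ltW.
apply: (@le_trans _ _ (K * J * (x - a))).
  apply: ler_norm_Int_cst => //; first by apply: L1B; exact: L.
  apply: ae_in_all => y /andP[ay yx].
  rewrite -mulrBr normrM ler_pM// ?(gtr0_norm (A0 y)).
    by apply: AK; rewrite (ltW ay) (le_trans (ltW yx)).
  rewrite /flux (_ : _ - _ = (s - t) - (prim g y - prim k y)); last by ring.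
  by rewrite (le_trans (ler_normB _ _))// lerD2l; exact: prim_diff.
by rewrite mulrAC ler_wpM2r// ler_wpM2l// lerD2r.
Qed.

(** The L^1 distance counts twice: once through the slopes and once through the primitives. *)
Lemma dirichlet_diff K g k x : (forall x, a <= x <= b -> A x <= K) ->
  L1 a b g -> L1 a b k -> a <= x <= b ->
  `|dirichlet g x - dirichlet k x| <=
    K * (b - a) * (Int (fun y => `|g y - k y|) a b *+ 2).
Proof.
move=> AK Lg Lk xab; apply: (le_trans (ivp_diff _ _ AK Lg Lk xab)).
have K0 : 0 <= K by apply: (le_trans (ltW (A0 a))); apply: AK; rewrite lexx ltW.
by rewrite ler_wpM2l ?mulr_ge0 ?subr_ge0 ?(ltW ab)// mulr2n lerD2r slope_diff.
Qed.

Lemma ivp_lipschitz K s g x y : (forall x, a <= x <= b -> A x <= K) ->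
  L1 a b g -> a <= x -> x <= y -> y <= b ->
  `|ivp s g y - ivp s g x| <= K * (`|s| + Int (fun y => `|g y|) a b) * (y - x).
Proof.
move=> AK Lg ax xy yb.
have L c d : L1 c d (fun y => A y * flux s g y).
  by apply: L1_cont; exact: ivp_integrand_continuous.
rewrite /ivp (@Int_cat _ a y x)// addrC addKr.
apply: ler_norm_Int_cst => //.
apply: ae_in_all => z /andP[xz zy].
rewrite normrM ler_pM// ?(gtr0_norm (A0 z)).
  by apply: AK; rewrite (le_trans ax (ltW xz)) (le_trans (ltW zy)).
by rewrite (le_trans (ler_normB _ _))// lerD2l; exact: prim_le.
Qed.

Lemma Int_dominated_cvg (g_ : nat -> R -> R) g k :
  (forall n, measurable_fun `[a, b] (g_ n)) -> measurable_fun `[a, b] g ->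
  (forall y, a <= y <= b -> g_ n y @[n --> \oo] --> g y) ->
  L1 a b k -> (forall n y, a <= y <= b -> `|g_ n y| <= k y) ->
  Int (fun y => `|g_ n y - g y|) a b @[n --> \oo] --> (0 : R).
Proof.
move=> mg_ mg cg Lk gk.
have [||||||_ h _] := @dominated_convergence _ _ R mu `[a, b]%classic _
  (fun n => EFin \o g_ n) (EFin \o g) (EFin \o k).
- by [].
- by move=> n; apply/measurable_EFinP; exact: mg_.
- exact/measurable_EFinP.
- apply: aeW => x /=; rewrite in_itv/= => xab.
  by apply: cvg_EFin; [exact: nearW|exact: cg].
- exact: Lk.
- by apply: aeW => x n /=; rewrite in_itv/= => xab; rewrite lee_fin gk.
exact: (fine_cvg h).
Qed.

End dirichlet_operator.

(** * Existence for bounded Caratheodory right-hand sides *)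

Section lipschitz_compactness.
Context {R : realType}.
Implicit Types (x y e : R).

Lemma near_all_seq (T : topologicalType) (I : eqType) (s : seq I) (f : T)
    (P : I -> T -> Prop) :
  (forall i, \forall g \near f, P i g) ->
  \forall g \near f, forall i, i \in s -> P i g.
Proof.
move=> h; elim: s => [|i s IH]; first by apply: nearW.
near=> g => j; rewrite inE => /predU1P[->|].
  by near: g; exact: h.
by move: j; near: g; exact: IH.
Unshelve. all: by end_near. Qed.

Lemma cvg_dist_le (f g : nat -> R) (l : R) : (forall n, `|f n - l| <= g n) ->
  g n @[n --> \oo] --> (0 : R) -> f n @[n --> \oo] --> l.
Proof.
move=> fg g0; apply/subr_cvg0/norm_cvg0P.
apply: (squeeze_cvgr (f := fun=> 0) _ (cvg_cst _) g0).
by apply: nearW => n; rewrite normr_ge0 fg.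
Qed.

(** Arzela-Ascoli by way of Tychonoff. As all [u_ n] vanish at [a], they lie in a product of
    segments, hence have a pointwise cluster point; testing it at two points shows that it is
    Lipschitz, and testing it on a finite grid gives uniform closeness. The conclusion speaks of
    arbitrarily late indices rather than of a subsequence because a cluster point in a product over
    all reals yields only that. *)
Lemma lipschitz_cluster (u_ : nat -> R -> R) (a b L : R) : a <= b -> 0 < L ->
  (forall n x y, `|u_ n x - u_ n y| <= L * `|x - y|) ->
  (forall n, u_ n a = 0) ->
  exists2 u : R -> R, (forall x y, `|u x - u y| <= L * `|x - y|) &
    forall e n0, 0 < e -> exists2 n, (n0 <= n)%N &
      forall x, a <= x <= b -> `|u_ n x - u x| <= e.
Proof.
move=> ab L0 lip ua.
pose K x : set R := `[- (L * `|x - a|), L * `|x - a|]%classic.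
have cK := @tychonoff R (fun=> R) K (fun x => @segment_compact R _ _).
pose F : set_system (forall _ : R, R) := u_ n @[n --> \oo].
have FK : F [set f | forall i, K i (f i)].
  exists 0%N => // n _ x; rewrite /K/= in_itv/= -ler_norml.
  by have := lip n x a; rewrite ua subr0.
have [u [_ clu]] := cK F _ FK.
have clus (s : seq R) e n0 : 0 < e -> exists2 n, (n0 <= n)%N &
    forall x, x \in s -> `|u_ n x - u x| < e.
  move=> e0.
  have nb : \forall g \near (u : {ptws R -> R}), forall x, x \in s ->
      `|u x - (g : R -> R) x| < e.
    apply: near_all_seq => x.
    have cx : (g : {ptws R -> R}) x @[g --> (u : {ptws R -> R})] --> u x.
      exact: (@proj_continuous R (fun=> R) x u).
    by move/cvgrPdist_lt : cx; apply.
  have Fn : F [set f | exists2 n, (n0 <= n)%N & f = u_ n].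
    by exists n0 => // n /= n0n; exists n.
  have [f [[n n0n ->] h]] := clu _ _ Fn nb.
  by exists n => // x xs; rewrite distrC; exact: h.
have lipu x y : `|u x - u y| <= L * `|x - y|.
  apply/ler_addgt0Pr => e e0.
  have e20 : 0 < e / 2 by rewrite divr_gt0.
  have [n _ h] := clus [:: x; y] (e / 2) 0%N e20.
  have hx : `|u_ n x - u x| < e / 2 by apply: h; rewrite inE eqxx.
  have hy : `|u_ n y - u y| < e / 2 by apply: h; rewrite !inE eqxx orbT.
  rewrite (_ : u x - u y = (u_ n x - u_ n y) - ((u_ n x - u x) - (u_ n y - u y))); last by ring.
  rewrite (le_trans (ler_normB _ _))// lerD// (le_trans (ler_normB _ _))//.
  by rewrite [leRHS]splitr lerD// ltW.
exists u => // e n0 e0.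
(* On a grid of mesh [d], passing to the nearest grid point on the left costs at most [e / 4] for
   [u_ n] and for [u], which leaves [e / 2] for the grid point itself. *)
pose d := e / (4 * L).
have d0 : 0 < d by rewrite divr_gt0// mulr_gt0.
pose M := (Num.truncn ((b - a) / d)).+1.
have e20 : 0 < e / 2 by rewrite divr_gt0.
have [n n0n h] := clus [seq a + i%:R * d | i <- iota 0 M] (e / 2) n0 e20.
exists n => // x /andP[ax xb].
pose i := Num.truncn ((x - a) / d).
have xd0 : 0 <= (x - a) / d by rewrite divr_ge0 ?subr_ge0// ltW.
have /andP[i1 i2] : i%:R <= (x - a) / d < i.+1%:R by exact: truncn_itv.
pose z := a + i%:R * d.
have zx : `|x - z| <= d.
  rewrite /z opprD addrA ger0_norm; last first.
    by rewrite subr_ge0 -ler_pdivlMr.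
  rewrite lerBlDr -{1}(mul1r d) -mulrDl -ler_pdivrMr//.
  by rewrite nat1r ltW.
have hz : `|u_ n z - u z| < e / 2.
  apply: h; apply/mapP; exists i => //; rewrite mem_iota /= add0n /M ltnS.
  by apply: le_truncn; rewrite ler_pM2r ?invr_gt0// lerD2r.
have Ld : L * d = e / 4.
  by rewrite /d; field; rewrite gt_eqF.
rewrite (_ : _ - _ = (u_ n x - u_ n z) + ((u_ n z - u z) + (u z - u x))); last by ring.
have h1 : `|u_ n x - u_ n z| <= e / 4.
  by rewrite -Ld (le_trans (lip _ _ _))// ler_pM2l.
have h2 : `|u z - u x| <= e / 4.
  by rewrite distrC -Ld (le_trans (lipu _ _))// ler_pM2l.
rewrite (le_trans (ler_normD _ _))//.
have := ler_normD (u_ n z - u z) (u z - u x).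
lra.
Qed.

End lipschitz_compactness.

Section existence.
Context {R : realType}.
Notation mu := (@lebesgue_measure R).
Variables (a b : R) (A : R -> R) (F : R -> R -> R) (k : R -> R).
Hypotheses (ab : a < b) (cA : continuous A) (A0 : forall x, 0 < A x).
Hypothesis mF : forall w, measurable_fun `[a, b] w ->
  measurable_fun `[a, b] (fun y => F y (w y)).
Hypothesis cF : forall y, a <= y <= b -> continuous (F y).
Hypothesis Lk : L1 a b k.
Hypothesis Fk : forall y t, a <= y <= b -> `|F y t| <= k y.
Implicit Types (s h x y : R).

Let C := Int k a b.

Let k0 y : a <= y <= b -> 0 <= k y.
Proof. by move=> yab; apply: le_trans (Fk 0 yab). Qed.

Let C0 : 0 <= C.
Proof.
by apply: Int_ge0 => //; apply: ae_in_all => x /andP[? ?]; rewrite k0// !ltW.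
Qed.

Let LF w : measurable_fun `[a, b] w -> L1 a b (fun y => F y (w y)).
Proof.
move=> mw; apply: L1_le Lk _; first exact: mF.
by apply: ae_in_all => x /andP[? ?]; rewrite Fk// !ltW.
Qed.

Let IntF w : measurable_fun `[a, b] w -> Int (fun y => `|F y (w y)|) a b <= C.
Proof.
move=> mw; apply: le_Int_ae => //; first exact/L1_norm/LF.
by apply: ae_in_all => x /andP[? ?]; rewrite Fk// !ltW.
Qed.

(** On a step of length [h] the right-hand side then involves only values from earlier steps, which
    takes the place of a Lipschitz condition on [F y]. *)
Let delay h y : R := Num.max a (y - h).

Let delay_in h y : 0 < h -> a <= y <= b -> a <= delay h y <= b.
Proof.
move=> h0 /andP[ay yb]; rewrite /delay le_max lexx /= ge_max (ltW ab) /=.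
by rewrite lerBlDr (le_trans yb)// lerDl ltW.
Qed.

Let measurable_delay h (w : R -> R) : continuous w -> measurable_fun `[a, b] (w \o delay h).
Proof.
move=> cw; apply: measurable_funTS; apply: continuous_measurable_fun => x.
apply: continuous_comp; last exact: cw.
apply: continuous_max; first exact: cvg_cst.
by apply: cvgB; [exact: cvg_id|exact: cvg_cst].
Qed.

(* Picard iterates of the initial value problem whose right-hand side looks
   back by h: they become stationary after finitely many steps. *)
Fixpoint picard h s n : R -> R :=
  if n is n'.+1 then ivp a b A s (fun y => F y (picard h s n' (delay h y)))
  else fun=> 0.

Let picard_continuous h s n : continuous (picard h s n).
Proof.
elim: n => [|n IH] /=; first by move=> x; exact: cvg_cst.
by apply: ivp_continuous => //; apply: (LF (w := _ \o _)); exact: measurable_delay.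
Qed.

Let LP h s n : L1 a b (fun y => F y (picard h s n (delay h y))).
Proof.
apply: (LF (w := picard h s n \o delay h)); apply: measurable_delay.
exact: picard_continuous.
Qed.

(** Induction on [n]: the delay sends [a, a + (n+1) h] into [a, a + n h], where the two previous
    iterates already agree. *)
Let picard_stable h s n x : 0 < h -> a <= x <= b -> x <= a + n%:R * h ->
  picard h s n.+1 x = picard h s n x.
Proof.
move=> h0; elim: n x => [|n IH] x /andP[ax xb] xn.
  move: xn; rewrite mul0r addr0 => xa.
  by rewrite /= /ivp Int_nil.
rewrite [LHS]/= [RHS]/=; apply: eq_Int => y /andP[ay yx].
congr (_ * (_ - _)); rewrite /prim clamp_id ?ay ?(le_trans yx)//.
apply: eq_Int => z /andP[az zy]; congr (F z _).
apply: IH.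
  by apply: delay_in => //; rewrite az (le_trans zy (le_trans yx xb)).
rewrite /delay ge_max lerDl mulr_ge0 ?(ltW h0)//=.
move: xn; rewrite -natr1 mulrDl mul1r; lra.
Qed.

(** Continuous dependence on the initial flux, needed for the intermediate value theorem in the
    shooting argument; since [F y] is merely continuous, it comes from dominated convergence with
    bound [k]. *)
Let picard_cvg h (s_ : nat -> R) s n x : 0 < h -> a <= x <= b ->
  s_ j @[j --> \oo] --> s ->
  picard h (s_ j) n x @[j --> \oo] --> picard h s n x.
Proof.
move=> h0 + ss; elim: n x => [|n IH] x xab /=; first exact: cvg_cst.
have [K K0 AK] := A_bound ab cA A0.
have cI := @Int_dominated_cvg R a b
  (fun j y => F y (picard h (s_ j) n (delay h y)))
  (fun y => F y (picard h s n (delay h y))) k.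
have {}cI : Int (fun y => `|F y (picard h (s_ j) n (delay h y)) -
    F y (picard h s n (delay h y))|) a b @[j --> \oo] --> (0 : R).
  apply: cI => //.
  - by move=> j; apply: L1_meas; exact: LP.
  - by apply: L1_meas; exact: LP.
  - move=> y yab; apply: continuous_cvg; first exact: cF.
    by apply: IH; exact: delay_in.
  - by move=> j y yab; exact: Fk.
apply: (@cvg_dist_le _ _ (fun j => K * (b - a) * (`|s_ j - s| +
  Int (fun y => `|F y (picard h (s_ j) n (delay h y)) -
    F y (picard h s n (delay h y))|) a b))).
  by move=> j; apply: ivp_diff.
rewrite -[X in _ --> X](mulr0 (K * (b - a))); apply: cvgMr.
rewrite -[X in _ --> X](addr0 0); apply: cvgD => //.
by apply/norm_cvg0P/subr_cvg0.
Qed.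

Lemma delayed_dirichlet h : 0 < h -> exists2 w : R -> R, continuous w &
  forall x, a <= x <= b -> w x = dirichlet a b A (fun y => F y (w (delay h y))) x.
Proof.
move=> h0.
(* So many steps of length [h] cover [a, b], hence iterate [n] is stationary there and solves the
   delayed problem. *)
pose n := (Num.truncn ((b - a) / h)).+1.
have nh x : a <= x <= b -> x <= a + n%:R * h.
  move=> /andP[ax xb]; rewrite -lerBlDl -ler_pdivrMr// ltW//.
  apply: (le_lt_trans (y := (b - a) / h)).
    by rewrite ler_pM2r ?invr_gt0// lerD2r.
  have /andP[_ ] // : (Num.truncn ((b - a) / h))%:R <= (b - a) / h < n%:R.
  by apply: truncn_itv; rewrite divr_ge0 ?subr_ge0// ltW.
have fixed s x : a <= x <= b ->
    picard h s n x = ivp a b A s (fun y => F y (picard h s n (delay h y))) x.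
  by move=> xab; rewrite -(@picard_stable h s n x)// nh.
pose w s := picard h s n.
have cw : continuous (w ^~ b).
  move=> s; apply/(@cvg_nbhsP _ R^o) => s_ ss; apply: picard_cvg => //.
  by rewrite lexx ltW.
have Fw s : L1 a b (fun y => F y (w s (delay h y))) by exact: LP.
have primC s y : `|prim a b (fun y => F y (w s (delay h y))) y| <= C.
  apply: (le_trans (prim_le _ _ _)) => //.
  by apply: (IntF (w := w s \o delay h)); apply: measurable_delay; exact: picard_continuous.
have bab : a <= b <= b by rewrite lexx ltW.
(* The primitive of the right-hand side is bounded by [C], so an initial flux [C] keeps the flux
   nonnegative and [- C] keeps it nonpositive; the end value therefore changes sign between the
   two. *)
have wC : 0 <= w C b.
  rewrite /w fixed//; apply: Int_ge0; first by apply: L1_cont; exact: ivp_integrand_continuous.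
  apply: ae_in_all => y _; rewrite mulr_ge0 ?(ltW (A0 y))// subr_ge0.
  by rewrite (le_trans (ler_norm _))// primC.
have wNC : w (- C) b <= 0.
  rewrite /w fixed// -oppr_ge0 -IntN; last by apply: L1_cont; exact: ivp_integrand_continuous.
  apply: Int_ge0; first by apply: L1N; apply: L1_cont; exact: ivp_integrand_continuous.
  apply: ae_in_all => y _; rewrite -mulrN mulr_ge0 ?(ltW (A0 y))//.
  rewrite /flux opprD !opprK -lerBlDl sub0r lerNl.
  by rewrite (le_trans (ler_norm _))// normrN primC.
have [|||s sC ws] := @IVT R (w ^~ b) (- C) C 0.
- by rewrite ge0_cp.
- exact: continuous_subspaceT.
- by rewrite ge_min wNC /= le_max wC orbT.
exists (w s); first exact: picard_continuous.
move=> x xab; rewrite /w fixed// /dirichlet.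
have e : ivp a b A s (fun y => F y (w s (delay h y))) b = 0 by rewrite -fixed.
by have {1}-> := ivp_dirichlet ab cA A0 (Fw s) e.
Qed.

(** Delays [1 / (n + 1)] tend to 0 while the Lipschitz constant of the delayed solutions depends
    only on [K] and [C]; a uniform limit of a subsequence solves the undelayed equation by dominated
    convergence. *)
Lemma dirichlet_fixpoint : exists2 u : R -> R, continuous u &
  forall x, a <= x <= b -> u x = dirichlet a b A (fun y => F y (u y)) x.
Proof.
have [K K0 AK] := A_bound ab cA A0.
pose h_ n : R := n.+1%:R^-1.
have h0 n : 0 < h_ n by rewrite invr_gt0.
have /choice[w_ wP] : forall n, exists w : R -> R, continuous w /\
  forall x, a <= x <= b -> w x = dirichlet a b A (fun y => F y (w (delay (h_ n) y))) x.
  by move=> n; have [w ? ?] := delayed_dirichlet (h0 n); exists w.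
have Lw n : L1 a b (fun y => F y (w_ n (delay (h_ n) y))).
  apply: (LF (w := w_ n \o delay (h_ n))); apply: measurable_delay.
  by have [] := wP n.
have Iw n : Int (fun y => `|F y (w_ n (delay (h_ n) y))|) a b <= C.
  apply: (IntF (w := w_ n \o delay (h_ n))); apply: measurable_delay.
  by have [] := wP n.
pose u_ n x := w_ n (clamp a b x).
(* One [C] bounds the slope and the other the primitive; the [+ 1] makes [L] positive even if [C] is
   0. *)
pose L := K * (C + C) + 1.
have L0 : 0 < L by rewrite /L ltr_wpDl// mulr_ge0 ?addr_ge0// ltW.
have slopeC n : `|slope a b A (fun y => F y (w_ n (delay (h_ n) y)))| <= C.
  exact: (le_trans (slope_le ab cA A0 (Lw n)) (Iw n)).
have lip_w n x y : a <= x -> x <= y -> y <= b -> `|w_ n x - w_ n y| <= L * `|x - y|.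
  move=> ax xy yb.
  rewrite distrC (distrC x) (ger0_norm (x := y - x)) ?subr_ge0//.
  rewrite !(wP n).2 ?ax ?(le_trans ax)// ?yb ?(le_trans xy)//.
  apply: (le_trans (ivp_lipschitz ab cA A0 _ AK (Lw n) ax xy yb)).
  rewrite ler_wpM2r ?subr_ge0// /L ler_wpDr// ler_wpM2l ?(ltW K0)// lerD//.
have clamp_lip x y : `|clamp a b x - clamp a b y| <= `|x - y|.
  have h1 := ler_norm (x - y); have := ler_norm (y - x); rewrite distrC => h2.
  rewrite /clamp ler_norml.
  have h3 := ltW ab.
  case: (leP x b) => ?; case: (leP y b) => ?; rewrite ?(max_idPr (ltW ab)).
  - by case: (leP a x) => ?; case: (leP a y) => ?; lra.
  - by case: (leP a x) => ?; lra.
  - by case: (leP a y) => ?; lra.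
  - by lra.
have lip n x y : `|u_ n x - u_ n y| <= L * `|x - y|.
  have /andP[ax xb] := clamp_in x (ltW ab); have /andP[ay yb] := clamp_in y (ltW ab).
  apply: (@le_trans _ _ (L * `|clamp a b x - clamp a b y|)); last by rewrite ler_pM2l.
  have [xy|/ltW xy] := leP (clamp a b x) (clamp a b y); first exact: lip_w.
  by rewrite distrC (distrC (clamp a b x)); exact: lip_w.
have ua n : u_ n a = 0.
  by rewrite /u_ clamp_id ?lexx ?ltW// (wP n).2 ?lexx ?ltW// /dirichlet /ivp Int_nil.
have [u lipu cluster] := lipschitz_cluster (ltW ab) L0 lip ua.
have /choice[n_ n_P] : forall j : nat, exists n, (j <= n)%N /\
    forall x, a <= x <= b -> `|u_ n x - u x| <= j.+1%:R^-1.
  by move=> j; have [|n] := cluster j.+1%:R^-1 j; [rewrite invr_gt0|exists n].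
have cu : continuous u.
  move=> x; apply/cvgrPdist_lt => e e0; near=> y.
  apply: (le_lt_trans (lipu _ _)); rewrite mulrC -ltr_pdivlMr//.
  by near: y; apply: cvgr_dist_lt; [exact: cvg_id|rewrite divr_gt0].
exists u => // x xab.
have cvg_u y : a <= y <= b -> u_ (n_ j) y @[j --> \oo] --> u y.
  move=> yab; apply: (@cvg_dist_le _ _ (fun j => j.+1%:R^-1)); last exact: cvg_harmonic.
  by move=> j; exact: (n_P j).2.
(* The delayed argument is within [1 / (j + 1)] of [y], which costs [L / (j + 1)]; the distance from
   [u] costs another [1 / (j + 1)]. *)
have cvg_du y : a <= y <= b -> w_ (n_ j) (delay (h_ (n_ j)) y) @[j --> \oo] --> u y.
  move=> yab.
  apply: (@cvg_dist_le _ _ (fun j => (L + 1) * j.+1%:R^-1)); last first.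
    by rewrite -[X in _ --> X](mulr0 (L + 1)); apply: cvgMr; exact: cvg_harmonic.
  move=> j; have dy := delay_in (h0 (n_ j)) yab.
  have -> : w_ (n_ j) (delay (h_ (n_ j)) y) = u_ (n_ j) (delay (h_ (n_ j)) y).
    by rewrite /u_ clamp_id.
  have hj : `|delay (h_ (n_ j)) y - y| <= j.+1%:R^-1.
    apply: (@le_trans _ _ (h_ (n_ j))).
      have := h0 (n_ j); rewrite /delay; move: yab => /andP[ay _].
      by case: (leP a (y - h_ (n_ j))) => hh ?; rewrite ler_norml; lra.
    by rewrite /h_ lef_pV2 ?posrE// ler_nat ltnS; exact: (n_P j).1.
  rewrite -[X in X - _](subrK (u_ (n_ j) y)) -addrA mulrDl mul1r.
  rewrite (le_trans (ler_normD _ _))// lerD//; last exact: (n_P j).2.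
  by rewrite (le_trans (lip _ _ _))// ler_pM2l.
have : dirichlet a b A (fun y => F y (w_ (n_ j) (delay (h_ (n_ j)) y))) x
    @[j --> \oo] --> dirichlet a b A (fun y => F y (u y)) x.
  have mu' : measurable_fun `[a, b] u.
    by apply: measurable_funTS; exact: continuous_measurable_fun.
  apply: (@cvg_dist_le _ _ (fun j => K * (b - a) * (Int (fun y =>
    `|F y (w_ (n_ j) (delay (h_ (n_ j)) y)) - F y (u y)|) a b *+ 2))).
    by move=> j; apply: dirichlet_diff => //; exact: LF.
  rewrite -[X in _ --> X](mulr0 (K * (b - a))); apply: cvgMr.
  rewrite -[X in _ --> X](mul0rn _ 2); apply: cvgMn.
  apply: (@Int_dominated_cvg R a b _ _ k) => //.
  - by move=> j; apply: L1_meas; exact: Lw.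
  - exact: mF.
  - by move=> y yab; apply: continuous_cvg; [exact: cF|exact: cvg_du].
  - by move=> j y yab; exact: Fk.
under eq_fun => j do rewrite -(wP (n_ j)).2//.
move=> h; have := cvg_u x xab.
under eq_fun => j do rewrite /u_ clamp_id//.
by move=> h2; apply: (cvg_unique _ h2 h).
Unshelve. all: by end_near. Qed.
End existence.

(** * Weak derivatives and Sobolev spaces in dimension one *)

Section lebesgue_norms.
Context {R : realType}.
Notation mu := (@lebesgue_measure R).
Implicit Types (f g : R -> R) (s t : R).

Definition L2 s t f : Prop :=
  measurable_fun `[s, t] f /\ L1 s t (fun x => f x ^+ 2).

Lemma measurable_cc s t f : measurable_fun `]s, t[ f <-> measurable_fun `[s, t] f.
Proof.
split; first exact: measurable_fun_itv_cc.
by apply: measurable_funS => //; exact: subset_itv_oo_cc.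
Qed.

Lemma measurable_patch_oo s t f :
  measurable_fun setT (f \_ `]s, t[) <-> measurable_fun `[s, t] f.
Proof.
rewrite -measurable_cc; rewrite -(measurable_restrictT f)//.
Qed.

Lemma L1_patch s t f :
  mu.-integrable setT (EFin \o (f \_ `]s, t[)) <-> L1 s t f.
Proof.
rewrite -restrict_EFin -integrable_restrict// setTI /L1; split; last first.
  by apply: integrableS => //; exact: subset_itv_oo_cc.
move=> /integrableP[/measurable_EFinP/measurable_cc mf h].
apply/integrableP; split; first exact/measurable_EFinP.
rewrite integral_itv_bndoo//; apply: measurableT_comp => //.
by apply/measurable_EFinP/measurable_cc.
Qed.

Lemma Int_patch s t f : measurable_fun `[s, t] f ->
  \int[mu]_x (f \_ `]s, t[) x = Int f s t.
Proof.
move=> mf; rewrite -Rintegral_mkcond /Int /Rintegral; congr fine.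
rewrite [RHS]integral_itv_bndoo//; exact/measurable_EFinP/measurable_cc.
Qed.

Lemma Int_oo s t f : measurable_fun `[s, t] f ->
  \int[mu]_(x in `]s, t[) f x = Int f s t.
Proof. by move=> mf; rewrite Rintegral_mkcond Int_patch. Qed.

Lemma L1_fin s t f : L1 s t f ->
  (\int[mu]_x ((f \_ `]s, t[) x)%:E = (Int f s t)%:E)%E.
Proof.
move=> Lf; rewrite -(Int_patch (L1_meas Lf)) /Rintegral fineK//.
by apply: integrable_fin_num => //; exact/L1_patch.
Qed.

Lemma patch_sqr s t f x :
  `|(f \_ `]s, t[) x| `^ 2 = ((fun y => f y ^+ 2) \_ `]s, t[) x.
Proof.
rewrite powR_mulrn// real_normK ?num_real//.
by rewrite /patch; case: ifP => //; rewrite expr0n.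
Qed.

Lemma Lnorm2E s t f : L2 s t f ->
  Lnorm_itv 2%:E s t f = (Num.sqrt (Int (fun x => f x ^+ 2) s t))%:E.
Proof.
move=> [mf L2f]; rewrite /Lnorm_itv unlock.
under eq_integral do rewrite /= patch_sqr.
rewrite L1_fin// poweR_EFin powR12_sqrt//.
by apply: Int_ge0 => //; apply: ae_in_all => x _; exact: sqr_ge0.
Qed.

Lemma Lnorm1E s t f : L1 s t f ->
  Lnorm_itv 1%:E s t f = (Int (fun x => `|f x|) s t)%:E.
Proof.
move=> Lf; rewrite /Lnorm_itv Lnorm1 -L1_fin; last exact: L1_norm.
apply: eq_integral => x _; rewrite /= /patch.
by case: ifP => //; rewrite normr0.
Qed.

Lemma Lspace2P s t f : Lspace_itv 2%:E s t f <-> L2 s t f.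
Proof.
split.
  move=> /[dup] /Lfun2_integrable_sqr h; rewrite /Lspace_itv inE => /andP[].
  rewrite inE/= => /measurable_patch_oo mf _; split => //; apply/L1_patch.
  apply: eq_integrable h => // x _ /=; rewrite /patch; case: ifP => //.
  by rewrite expr0n.
move=> L; have [mf _] := L.
rewrite /Lspace_itv inE; apply/andP; split; rewrite inE/=.
  exact/measurable_patch_oo.
by have := Lnorm2E L; rewrite /finite_norm /Lnorm_itv => ->; rewrite ltry.
Qed.

Lemma L2_L1 s t f : L2 s t f -> L1 s t f.
Proof.
move=> [mf Lf]; apply: (L1_le (g := fun x => 1 + f x ^+ 2)) => //.
  by apply: L1D => //; apply: L1_cont => x; exact: cvg_cst.
apply: ae_in_all => x _; rewrite -[f x ^+ 2]real_normK ?num_real//.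
have := sqr_ge0 (`|f x| - 1); nra.
Qed.

Lemma L2_mul s t f g : L2 s t f -> L2 s t g -> L1 s t (fun x => f x * g x).
Proof.
move=> [mf Lf] [mg Lg].
apply: (L1_le (g := fun x => f x ^+ 2 + g x ^+ 2)); last 2 first.
- exact: L1D.
- apply: ae_in_all => x _; rewrite normrM.
  rewrite -[f x ^+ 2]real_normK ?num_real// -[g x ^+ 2]real_normK ?num_real//.
  have := sqr_ge0 (`|f x| - `|g x|).
  have := normr_ge0 (f x); have := normr_ge0 (g x); nra.
- exact: measurable_funM.
Qed.

Lemma cauchy_schwarz s t f g : L2 s t f -> L2 s t g ->
  Int (fun x => `|f x * g x|) s t <=
  Num.sqrt (Int (fun x => f x ^+ 2) s t) * Num.sqrt (Int (fun x => g x ^+ 2) s t).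
Proof.
move=> Lf Lg; have [[mf _] [mg _]] := (Lf, Lg).
rewrite -lee_fin EFinM -(Lnorm2E Lf) -(Lnorm2E Lg) -Lnorm1E; last exact: L2_mul.
have := @hoelder _ _ _ mu (f \_ `]s, t[) (g \_ `]s, t[) 2 2.
rewrite /Lnorm_itv (_ : (f \_ `]s, t[ \* g \_ `]s, t[) = (fun x => f x * g x) \_ `]s, t[).
  apply => //; try exact/measurable_patch_oo.
  by lra.
apply/funext => x; rewrite /= /patch; case: ifP => //.
by rewrite mulr0.
Qed.

Lemma LspaceyP s t f : Lspace_itv +oo%E s t f ->
  measurable_fun `[s, t] f /\ exists C, 0 <= C /\ ae_in s t (fun x => `|f x| <= C).
Proof.
rewrite /Lspace_itv inE => /andP[]; rewrite !inE/= => /measurable_patch_oo mf.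
rewrite /finite_norm unlock.
(* The norm of exponent [+oo] is defined as an essential supremum only when the whole space has
   positive measure. *)
have -> : (0 < mu [set: R])%E.
  apply: (@lt_le_trans _ _ (mu `[0, 1]%classic)).
    by rewrite lebesgue_measure_itv/= lte_fin ltr01 oppr0 adde0 lte_fin.
  by apply: le_measure; rewrite ?inE.
set f0 := abse \o _ => fy; split => //.
exists (Num.max 0 (fine (ess_sup mu f0))); rewrite le_max lexx; split => //.
have := ess_sup_ge mu f0; rewrite /ae_in; apply: filterS => x h xst.
rewrite le_max; apply/orP; right; rewrite -lee_fin fineK.
  by move: h; rewrite /f0/= /patch ifT// inE.
rewrite fin_real// fy andbT; apply: lt_le_trans h.
by rewrite /f0/= ltNyr.
Qed.

Lemma L2D s t f g : L2 s t f -> L2 s t g -> L2 s t (fun x => f x + g x).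
Proof.
move=> Lf Lg; have [[mf Lf2] [mg Lg2]] := (Lf, Lg); split; first exact: measurable_funD.
have := L1D (L1D Lf2 (L1Z 2 (L2_mul Lf Lg))) Lg2.
by apply: L1_eq => x _; ring.
Qed.

Lemma L2Z s t f k : L2 s t f -> L2 s t (fun x => k * f x).
Proof.
move=> [mf Lf]; split; first by apply: measurable_funM.
by have := L1Z (k ^+ 2) Lf; apply: L1_eq => x _; rewrite exprMn.
Qed.

Lemma L2B s t f g : L2 s t f -> L2 s t g -> L2 s t (fun x => f x - g x).
Proof.
by move=> Lf Lg; have := L2D Lf (L2Z (-1) Lg); under eq_fun do rewrite mulN1r.
Qed.

Lemma L2_bounded s t f g C : measurable_fun `[s, t] f -> L2 s t g ->
  ae_in s t (fun x => `|f x| <= C * `|g x|) -> L2 s t f.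
Proof.
move=> mf [mg Lg] fg; split => //.
apply: (L1_le (g := fun x => C ^+ 2 * g x ^+ 2)).
- exact: measurable_funX.
- exact: L1Z.
- apply: ae_in_imp fg => x _ h; rewrite normrX -[g x ^+ 2]real_normK ?num_real//.
  by rewrite -exprMn ler_pXn2r ?nnegrE// (le_trans _ h).
Qed.

Lemma L2_cont s t f : continuous f -> L2 s t f.
Proof.
move=> cf; split; first by apply: measurable_funTS; exact: continuous_measurable_fun.
by apply: L1_cont => x; exact: (cvgM (cf x) (cf x)).
Qed.

End lebesgue_norms.

Section weak_derivatives.
Context {R : realType}.
Notation mu := (@lebesgue_measure R).
Implicit Types (f g u v phi : R -> R) (s t x y : R).

Lemma FTC2 f F s t : s <= t -> continuous f -> continuous F ->
  (forall x, s < x < t -> is_derive x 1 F (f x)) -> Int f s t = F t - F s.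
Proof.
rewrite le_eqVlt => /predU1P[-> _ _ _|st cf cF dF]; first by rewrite Int_nil// subrr.
have := @continuous_FTC2 R f F s t st.
rewrite /Int /Rintegral => -> //.
- exact: continuous_subspaceT.
- split.
  + by move=> x; rewrite in_itv/= => /dF[].
  + by apply: cvg_at_right_filter; exact: cF.
  + by apply: cvg_at_left_filter; exact: cF.
- by move=> x; rewrite in_itv/= => /dF[_ <-]; rewrite derive1E.
Qed.

Lemma is_derive_test s t phi x : test_function s t phi ->
  is_derive x 1 phi (phi^`()%classic x).
Proof. by case=> d _ _ _; apply: DeriveDef => //; rewrite derive1E. Qed.

Lemma test_continuous s t phi : test_function s t phi -> continuous phi.
Proof.
by move=> [d _ _ _] x; apply: differentiable_continuous; exact/derivable1_diffP.
Qed.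

Lemma test_outside s t phi x : test_function s t phi -> ~~ (s < x < t) -> phi x = 0.
Proof.
move=> [_ _ _ supp] xst; apply/eqP; apply: contraNT xst => phix.
have /supp/= : closure [set x | phi x != 0] x by exact: subset_closure.
by rewrite in_itv.
Qed.

Lemma test_Int s t phi x : s <= x -> test_function s t phi ->
  Int phi^`()%classic s x = phi x.
Proof.
move=> sx tphi; rewrite -[RHS]subr0 -(test_outside (x := s) tphi) ?ltxx//.
apply: (@FTC2 _ phi) => //.
- by case: tphi.
- exact: test_continuous tphi.
- by move=> y _; exact: is_derive_test tphi.
Qed.

(** The source of all test functions below: to the right of [q] the primitive equals the total
    integral, which is 0, so its support is caught in [p, q]. *)
Lemma Int_test s t p q g : s < p -> q < t -> continuous g ->
  (forall x, ~~ (p <= x <= q) -> g x = 0) -> Int g s t = 0 ->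
  test_function s t (Int g s) /\ (Int g s)^`()%classic = g.
Proof.
move=> sp qt cg g0 gst.
have zl x : x <= p -> Int g s x = 0.
  move=> xp; have [/Int_nil//|sx] := leP x s.
  (* The right endpoint is dropped because for [x = p] nothing is known about [g] at [x]. *)
  rewrite /Int -(Rintegral_itv_bndo_bndc (a := BLeft s)); last first.
    apply: (integrableS _ _ _ (@L1_cont _ s x _ cg)) => //.
    exact: subset_itv_co_cc.
  rewrite (@eq_Rintegral _ _ _ _ _ (fun=> 0)) ?Rintegral_cst ?mul0r// => y.
  rewrite inE/= in_itv/= => /andP[_ yx]; apply: g0.
  by rewrite leNgt (lt_le_trans yx xp).
have zr x : q < x -> Int g s x = 0.
  move=> qx; have [sx|/ltW/Int_nil//] := leP s x.
  have z y z : q < y -> y <= z -> Int g y z = 0.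
    move=> qy yz; rewrite (@eq_Int _ _ _ _ (fun=> 0)) ?Int_cst ?mul0r//.
    move=> w /andP[yw _]; apply: g0.
    by rewrite (leNgt w) (lt_le_trans qy yw) andbF.
  have [xt|/ltW tx] := leP x t.
    rewrite -[RHS]gst [RHS](@Int_cat _ s t x)//; last exact: L1_cont.
    by rewrite (z x t) ?addr0.
  have [st|/ltW ts] := leP s t.
    rewrite (@Int_cat _ s x t)//; last exact: L1_cont.
    by rewrite gst add0r z.
  by rewrite z// (lt_le_trans qt ts).
have d x : is_derive x 1 (Int g s) (g x).
  have [px|xp] := leP p x; first by apply: is_derive_Int => //; exact: lt_le_trans px.
  rewrite g0; last by rewrite leNgt xp.
  have e : \forall y \near x, (fun=> 0) y = Int g s y.
    by near=> y; rewrite zl// ltW//; near: y; exact: lt_nbhsl.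
  exact: (near_eq_is_derive e (is_derive_cst _ _ _)).
have dE : (Int g s)^`()%classic = g.
  by apply/funext => x; rewrite derive1E; case: (d x).
have sub : closure [set x | Int g s x != 0] `<=` `[p, q].
  have cpq : closed `[p, q]%classic by exact: itv_closed.
  rewrite (closure_id `[p, q]%classic).1//.
  apply: closureS => x /= h; rewrite in_itv/=; apply/andP; split; rewrite leNgt.
    by apply: contra h => xp; rewrite zl// ltW.
  by apply: contra h => qx; rewrite zr.
split => //; split.
- by move=> x; case: (d x).
- by rewrite dE.
- apply: (subclosed_compact _ (@segment_compact R p q)) => //.
  exact: closed_closure.
- move=> x /sub/=; rewrite !in_itv/= => /andP[px xq].
  by rewrite (lt_le_trans sp px) (le_lt_trans xq qt).
Unshelve. all: by end_near. Qed.

Lemma weak_derivativeE s t u v phi : measurable_fun `[s, t] u ->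
  measurable_fun `[s, t] v -> weak_derivative s t u v -> test_function s t phi ->
  Int (fun x => u x * phi^`()%classic x) s t = - Int (fun x => v x * phi x) s t.
Proof.
move=> mu_ mv w tphi; have mphi f : continuous f -> measurable_fun `[s, t] f.
  by move=> cf; apply: measurable_funTS; exact: continuous_measurable_fun.
have cphi := test_continuous tphi.
have [_ cphi1 _ _] := tphi.
have := w _ tphi; rewrite !Int_oo//; apply: measurable_funM => //; exact: mphi.
Qed.

Lemma weak_derivativeP s t u v : measurable_fun `[s, t] u ->
  measurable_fun `[s, t] v ->
  (forall phi, test_function s t phi ->
    Int (fun x => u x * phi^`()%classic x) s t = - Int (fun x => v x * phi x) s t) ->
  weak_derivative s t u v.
Proof.
move=> mu_ mv w phi tphi; have mphi f : continuous f -> measurable_fun `[s, t] f.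
  by move=> cf; apply: measurable_funTS; exact: continuous_measurable_fun.
have cphi := test_continuous tphi.
have [_ cphi1 _ _] := tphi.
rewrite !Int_oo//; first exact: w.
all: by apply: measurable_funM => //; exact: mphi.
Qed.

Lemma continuous_bounded s t f : s <= t -> continuous f ->
  exists2 M, 0 <= M & forall x, s <= x <= t -> `|f x| <= M.
Proof.
move=> st cf; have cn : continuous (fun x => `|f x|).
  by move=> x; apply: cvg_norm; exact: cf.
have [|c _ h] := @EVT_max R (fun x => `|f x|) s t st; first exact: continuous_subspaceT.
by exists `|f c| => // x xst; apply: h; rewrite in_itv.
Qed.

Lemma L1_mul_cont s t f h : s <= t -> L1 s t f -> continuous h ->
  L1 s t (fun x => f x * h x).
Proof.
move=> st Lf ch; have [P P0 hP] := continuous_bounded st ch.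
apply: (L1_le (g := fun x => P * `|f x|)).
- apply: measurable_funM; first exact: L1_meas.
  by apply: measurable_funTS; exact: continuous_measurable_fun.
- by apply: L1Z; exact: L1_norm.
- by apply: ae_in_all => x /andP[? ?]; rewrite normrM mulrC ler_wpM2r// hP// !ltW.
Qed.

(* Both sides depend continuously on v in L^1, and the continuous v are dense. *)
Lemma primitive_integration_by_parts s t v c H h : s <= t -> L1 s t v ->
  continuous H -> continuous h -> (forall x, s < x < t -> is_derive x 1 H (h x)) ->
  (c + Int v s t) * H t - c * H s =
  Int (fun x => (c + Int v s x) * h x) s t + Int (fun x => v x * H x) s t.
Proof.
rewrite le_eqVlt => /predU1P[->|st Lv cH ch dH].
  by rewrite !Int_nil// !addr0 subrr.
have cV f : L1 s t f -> continuous (fun x => Int f s (clamp s t x)).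
  by move=> Lf; apply: continuous_Int_clamp => //; exact: ltW.
have [M M0 HM] := continuous_bounded (ltW st) cH.
have [N N0 hN] := continuous_bounded (ltW st) ch.
have mst : (mu `[s, t]%classic < +oo)%E.
  by rewrite lebesgue_measure_itv/= lte_fin st -EFinB ltry.
have [|||g_ [cg _ g_cvg]] := @approximation_continuous_integrable R `[s, t]%classic v.
- by [].
- exact: mst.
- exact: Lv.
have {}g_cvg : Int (fun x => `|v x - g_ n x|) s t @[n --> \oo] --> (0 : R).
  exact: (fine_cvg g_cvg).
have Lp f k : L1 s t f -> continuous k -> L1 s t (fun x => f x * k x).
  by move=> Lf ck; apply: L1_mul_cont => //; exact: ltW.
(* The claim becomes [D v = c * H t - c * H s], with a right-hand side free of [v]: it holds for
   continuous functions by the fundamental theorem, and [D] is Lipschitz for the L^1 distance. *)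
pose D f := Int (fun x => (c + Int f s (clamp s t x)) * h x) s t +
  Int (fun x => f x * H x) s t - Int f s t * H t.
have Lc f : L1 s t f -> L1 s t (fun x => (c + Int f s (clamp s t x)) * h x).
  move=> Lf; apply: L1_cont => x; apply: cvgM; last exact: ch.
  by apply: cvgD; [exact: cvg_cst|exact: cV].
have Dcont f : continuous f -> D f = c * H t - c * H s.
  move=> cf; rewrite /D -IntD; [|exact/Lc/L1_cont|exact/Lp/cH/L1_cont].
  have cIf := continuous_Int (a := s) cf.
  rewrite (@eq_Int _ _ _ _ (fun x => (c + Int f s x) * h x + f x * H x)); last first.
    by move=> x xst; rewrite clamp_id.
  rewrite (_ : c * H t - c * H s =
    (c + Int f s t) * H t - (c + Int f s s) * H s - Int f s t * H t); last first.
    by rewrite (Int_nil _ (lexx s)) addr0; ring.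
  congr (_ - _); apply: (@FTC2 _ (fun x => (c + Int f s x) * H x)).
  - exact: ltW.
  - move=> x; apply: cvgD; apply: cvgM; [|exact: ch|exact: cf|exact: cH].
    by apply: cvgD; [exact: cvg_cst|exact: cIf].
  - move=> x; apply: cvgM; [|exact: cH].
    by apply: cvgD; [exact: cvg_cst|exact: cIf].
  - move=> x xst; have /andP[sx _] := xst; have dI := is_derive_Int cf sx.
    have dc : is_derive x 1 (fun y => c + Int f s y) (f x).
      by rewrite -[f x]add0r; exact: is_deriveD.
    have := is_deriveM dc (dH x xst).
    by rewrite /GRing.scale /= (mulrC (H x)).
have Dlip f g : L1 s t f -> L1 s t g ->
    `|D f - D g| <= (N * (t - s) + M + M) * Int (fun x => `|f x - g x|) s t.
  move=> Lf Lg; set e := Int _ s t.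
  have e0 : 0 <= e.
    by apply: Int_ge0; [exact/L1_norm/L1B|apply: ae_in_all => x _].
  have r6 (x1 x2 x3 y1 y2 y3 : R) : x1 + x2 - x3 - (y1 + y2 - y3) =
    (x1 - y1) + (x2 - y2) - (x3 - y3) by ring.
  rewrite /D r6 -mulrBl -(IntB (Lc _ Lf) (Lc _ Lg)) -(IntB (Lp _ _ Lf cH) (Lp _ _ Lg cH)).
  rewrite -(IntB Lf Lg).
  rewrite (le_trans (ler_normB _ _))// mulrDl lerD//; last first.
    rewrite normrM mulrC; apply: ler_pM => //.
      by apply: HM; rewrite lexx ltW.
    by apply: ler_norm_Int; exact: L1B.
  rewrite (le_trans (ler_normD _ _))// mulrDl lerD//.
    rewrite mulrAC; apply: ler_norm_Int_cst; [exact: ltW|by apply: L1B; exact: Lc|].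
    apply: ae_in_all => x /andP[sx xt].
    rewrite -mulrBl opprD addrACA subrr add0r normrM mulrC ler_pM//.
      by apply: hN; rewrite !ltW.
    have := @prim_diff R s t st f g x Lf Lg; exact.
  rewrite (le_trans (ler_norm_Int _))//; first by apply: L1B; exact/Lp/cH.
  rewrite -IntZ; last exact/L1_norm/L1B.
  apply: le_Int_ae.
  - by apply: L1_norm; apply: L1B; exact/Lp/cH.
  - by apply: L1Z; exact/L1_norm/L1B.
  - apply: ae_in_all => x /andP[? ?]; rewrite -mulrBl normrM mulrC ler_wpM2r//.
    by apply: HM; rewrite !ltW.
have Dv : D v = c * H t - c * H s.
  have cvD : D (g_ n) @[n --> \oo] --> D v.
    apply: (@cvg_dist_le _ _ (fun n => (N * (t - s) + M + M) * Int (fun x => `|v x - g_ n x|) s t)).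
      by move=> n; rewrite distrC; apply: Dlip => //; exact: L1_cont.
    rewrite -[X in _ --> X](mulr0 (N * (t - s) + M + M)); exact: cvgMr.
  move: cvD; rewrite (_ : (fun n => D (g_ n)) = fun=> c * H t - c * H s) => [cvD|].
    by apply: (cvg_unique _ cvD (cvg_cst _)).
  by apply/funext => n; rewrite Dcont.
have E : Int (fun x => (c + Int v s (clamp s t x)) * h x) s t =
    Int (fun x => (c + Int v s x) * h x) s t.
  by apply: eq_Int => x xst; rewrite clamp_id.
move: Dv; rewrite /D E => /eqP; rewrite subr_eq => /eqP ->.
by rewrite mulrDl addrAC.
Qed.

Lemma primitive_weak_derivative s t u v c : s < t -> L1 s t v ->
  (forall x, s <= x <= t -> u x = c + Int v s x) -> weak_derivative s t u v.
Proof.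
move=> st Lv uE.
have mu_ : measurable_fun `[s, t] u.
  apply: (eq_measurable_fun (fun x => c + Int v s (clamp s t x))).
    by move=> x; rewrite inE/= in_itv/= => xst; rewrite uE ?clamp_id.
  apply: measurable_funTS; apply: continuous_measurable_fun => x.
  apply: cvgD; [exact: cvg_cst|].
  by apply: continuous_Int_clamp => //; exact: ltW.
apply: weak_derivativeP => //; first exact: L1_meas.
move=> phi tphi; have cphi := test_continuous tphi.
have [_ cphi1 _ _] := tphi.
have := primitive_integration_by_parts c (ltW st) Lv cphi cphi1
  (fun x _ => is_derive_test x tphi).
rewrite !(test_outside tphi) ?ltxx ?andbF// !mulr0 subr0.
move/esym/eqP; rewrite addr_eq0 => /eqP <-.
by apply: eq_Int => x xst; rewrite uE.
Qed.

End weak_derivatives.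

(** * The du Bois-Reymond lemma, by Lebesgue points *)

Section du_bois_reymond.
Context {R : realType}.
Notation mu := (@lebesgue_measure R).
Implicit Types (f g u v w phi : R -> R) (s t x y d e : R).

(** The ball has measure [2 * d], so an average below [e / 2] is an integral below [e * d]; for
    small [d] the ball lies inside the interval and the restriction of [w] is invisible. *)
Lemma lebesgue_pt_Int s t w x e : L1 s t w -> s < x < t ->
  lebesgue_pt (w \_ `]s, t[) x -> 0 < e ->
  \forall d \near 0^'+, Int (fun y => `|w y - w x|) (x - d) (x + d) <= e * d.
Proof.
move=> Lw /andP[sx xt] lx e0.
have e20 : 0 < e / 2 by rewrite divr_gt0.
have ne : nbhs (0%E : \bar R) [set y | (y < (e / 2)%:E)%E].
  exact: (@nbhs_open_ereal_lt R 0 (fun=> e / 2)).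
have hd := lx _ ne.
near=> d.
have d0 : 0 < d by near: d; exact: nbhs_right_gt.
have dx : d < x - s by near: d; apply: nbhs_right_lt; rewrite subr_gt0.
have dt : d < t - x by near: d; apply: nbhs_right_lt; rewrite subr_gt0.
have h : (davg (w \_ `]s, t[) x d < (e / 2)%:E)%E by near: d; exact: hd.
have Lx : L1 (x - d) (x + d) (fun y => `|w y - w x|).
  apply: L1_norm; apply: L1B; first by apply: L1_sub Lw; lra.
  by apply: L1_cont => y; exact: cvg_cst.
have E : (\int[mu]_(y in ball x d) `|((center ((w \_ `]s, t[) x) \o (w \_ `]s, t[)) y)%:E| =
    (Int (fun y => `|w y - w x|) (x - d) (x + d))%:E)%E.
  rewrite -(L1_fin Lx) ball_itv integral_mkcond; apply: eq_integral => y _.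
  rewrite /patch; case: ifP => //; rewrite inE/= in_itv/= => /andP[y1 y2].
  rewrite [y \in _]mem_set/=; last by rewrite in_itv/=; apply/andP; split; lra.
  by rewrite [x \in _]mem_set//= in_itv/= sx xt.
move: h; rewrite /davg /iavg E (lebesgue_measure_ball _ (ltW d0)).
rewrite inver mulrn_eq0/= gt_eqF// -EFinM lte_fin mulrC.
rewrite ltr_pdivrMr ?mulrn_wgt0// => /ltW/le_trans; apply.
by rewrite (_ : e / 2 * (d *+ 2) = e * d)//; rewrite mulr2n; field.
Unshelve. all: by end_near. Qed.

Lemma ae_in_exists s t (P : R -> Prop) : s < t -> ae_in s t P ->
  exists2 x, s < x < t & P x.
Proof.
move=> st [N [mN N0 PN]]; apply: contrapT => h.
have sub : `]s, t[%classic `<=` N.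
  move=> x xst; apply: PN => /= hx; apply: h; exists x; last exact: hx.
  by move: xst; rewrite /= in_itv.
have : (mu `]s, t[%classic <= mu N)%E by apply: le_measure; rewrite ?inE.
rewrite N0 lebesgue_measure_itv/= lte_fin st -EFinB lee_fin.
by rewrite leNgt subr_gt0 st.
Qed.

Definition tent x d y : R := Num.max 0 (d - `|y - x|).

Lemma tent_continuous x d : continuous (tent x d).
Proof.
move=> y; apply: (@continuous_max _ _ (fun=> 0) (fun y => d - `|y - x|) y).
  exact: cvg_cst.
apply: cvgB; first exact: cvg_cst.
by apply: cvg_norm; apply: cvgB; [exact: cvg_id|exact: cvg_cst].
Qed.

Lemma tent_out x d y : ~~ (x - d < y < x + d) -> tent x d y = 0.
Proof.
by rewrite -ltr_distlC distrC -leNgt => h; apply/max_idPl; rewrite subr_le0.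
Qed.

Lemma Int_supp s t x y f : s <= x -> x <= y -> y <= t -> L1 s t f ->
  (forall z, ~~ (x < z < y) -> f z = 0) -> Int f s t = Int f x y.
Proof.
move=> sx xy yt Lf f0.
rewrite (@Int_cat _ s t x)// ?(le_trans xy)// (@Int_cat _ x t y)//; last first.
  exact: L1_sub Lf.
rewrite (@eq_Int _ s x _ (fun=> 0)); last first.
  by move=> z /andP[_ zx]; rewrite f0// negb_and -leNgt zx.
rewrite (@eq_Int _ y t _ (fun=> 0)); last first.
  by move=> z /andP[yz _]; rewrite f0// negb_and -!leNgt yz orbT.
by rewrite !Int_cst// !mul0r add0r addr0.
Qed.

Lemma tent_bounds x d y : 0 <= d -> 0 <= tent x d y <= d.
Proof.
move=> d0; rewrite /tent le_max lexx /= ge_max d0 /=.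
by rewrite lerBlDr lerDl.
Qed.

Lemma Int_tent_ge s t x d : 0 < d -> s <= x - d -> x + d <= t ->
  d * d / 2 <= Int (tent x d) s t.
Proof.
move=> d0 sx xt.
have d20 : 0 < d / 2 by rewrite divr_gt0.
have -> : d * d / 2 = d / 2 * ((x + d / 2) - (x - d / 2)) by field.
rewrite -Int_cst; last by lra.
apply: (@le_trans _ _ (Int (tent x d) (x - d / 2) (x + d / 2))).
  apply: le_Int_ae.
  - by apply: L1_cont => y; exact: cvg_cst.
  - by apply: L1_cont; exact: tent_continuous.
  - apply: ae_in_all => y /andP[y1 y2]; rewrite le_max; apply/orP; right.
    have : `|y - x| <= d / 2 by rewrite ler_norml; lra.
    lra.
apply: Int_sub_le; [lra|lra|lra| |].
- by apply: L1_cont; exact: tent_continuous.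
- by apply: ae_in_all => y _; have /andP[] := tent_bounds x y (ltW d0).
Qed.

(** The tent is at most [d] high and its integral is at least [d * d / 2]; the error [d * (e * d)]
    is thus at most [2 * e] times that integral. *)
Lemma Int_tent_avg s t w x d e : L1 s t w -> 0 < d -> s <= x - d -> x + d <= t ->
  Int (fun y => `|w y - w x|) (x - d) (x + d) <= e * d ->
  `|Int (fun y => w y * tent x d y) s t - w x * Int (tent x d) s t|
    <= e * 2 * Int (tent x d) s t.
Proof.
move=> Lw d0 sx xt h.
have ct := @tent_continuous x d.
have Lt : L1 s t (tent x d) by exact: L1_cont.
have mt : measurable_fun `[s, t] (tent x d) by exact: L1_meas Lt.
have Lwt : L1 s t (fun y => w y * tent x d y).
  apply: (L1_le (g := fun y => d * `|w y|)).
  - by apply: measurable_funM => //; exact: L1_meas Lw.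
  - by apply: L1Z; exact: L1_norm.
  - apply: ae_in_all => y _; rewrite normrM mulrC ler_wpM2r//.
    by have /andP[t0 td] := tent_bounds x y (ltW d0); rewrite ger0_norm.
rewrite -IntZ// -IntB//; last exact: L1Z.
have Lc : L1 s t (fun y => w y * tent x d y - w x * tent x d y).
  by apply: L1B => //; exact: L1Z.
apply: (le_trans (ler_norm_Int Lc)).
have Lwx : L1 (x - d) (x + d) (fun y => `|w y - w x|).
  apply: L1_norm; apply: L1B; first exact: L1_sub Lw.
  by apply: L1_cont => y; exact: cvg_cst.
have e0 : 0 <= e * d.
  by apply: le_trans h; apply: Int_ge0 => //; apply: ae_in_all => y _.
have -> : Int (fun y => `|w y * tent x d y - w x * tent x d y|) s t =
    Int (fun y => `|w y * tent x d y - w x * tent x d y|) (x - d) (x + d).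
  apply: Int_supp => //; [by lra|exact: L1_norm|].
  by move=> y yx; rewrite tent_out// !mulr0 subrr normr0.
apply: (@le_trans _ _ (d * (e * d))).
  apply: (le_trans _ (ler_wpM2l (ltW d0) h)); rewrite -IntZ//.
  apply: le_Int_ae.
  - by apply: L1_norm; exact: L1_sub Lc.
  - exact: L1Z.
  - apply: ae_in_all => y _; rewrite -mulrBl normrM mulrC ler_wpM2r//.
    by have /andP[t0 td] := tent_bounds x y (ltW d0); rewrite ger0_norm.
have := Int_tent_ge d0 sx xt.
have ep : 0 <= e by rewrite -(pmulr_lge0 _ d0).
nra.
Qed.

(** Two tents around two Lebesgue points, each weighted by the integral of the other, form a
    function of mean zero, hence the derivative of a test function. So the tent averages of [w] at
    both points coincide, and shrinking the tents gives equal values. *)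
Lemma weak_derivative0_cst s t w : s < t -> L1 s t w ->
  (forall phi, test_function s t phi ->
    Int (fun x => w x * phi^`()%classic x) s t = 0) ->
  exists c, ae_in s t (fun x => w x = c).
Proof.
move=> st Lw w0.
have lpt : ae_in s t (lebesgue_pt (w \_ `]s, t[)).
  have Lo : mu.-integrable `]s, t[ (EFin \o w).
    by apply: integrableS Lw => //; exact: subset_itv_oo_cc.
  have mo : measurable `]s, t[%classic by [].
  have := lebesgue_differentiation (integrable_locally mo Lo).
  by rewrite /ae_in; apply: filterS => x h _.
have cst x y : s < x -> x < y -> y < t -> lebesgue_pt (w \_ `]s, t[) x ->
    lebesgue_pt (w \_ `]s, t[) y -> w x = w y.
  move=> sx xy yt lx ly; apply/eqP; rewrite -subr_eq0 -normr_le0.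
  apply/ler_addgt0Pr => e e0; rewrite add0r.
  (* Each of the two tent averages is off by at most [2 * (e / 4)], which adds up to [e]. *)
  have e40 : 0 < e / 4 by rewrite divr_gt0.
  near ((0 : R)^'+) => d.
  have d0 : 0 < d by near: d; exact: nbhs_right_gt.
  have dx : d < x - s by near: d; apply: nbhs_right_lt; rewrite subr_gt0.
  have dt : d < t - y by near: d; apply: nbhs_right_lt; rewrite subr_gt0.
  have hx : Int (fun z => `|w z - w x|) (x - d) (x + d) <= (e / 4) * d.
    by near: d; apply: (lebesgue_pt_Int Lw) => //; rewrite sx (lt_trans xy).
  have hy : Int (fun z => `|w z - w y|) (y - d) (y + d) <= (e / 4) * d.
    by near: d; apply: (lebesgue_pt_Int Lw) => //; rewrite yt (lt_trans sx).
  have [x1 x2] : s <= x - d /\ x + d <= t by lra.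
  have [y1 y2] : s <= y - d /\ y + d <= t by lra.
  have := Int_tent_avg Lw d0 x1 x2 hx; set Wx := Int _ s t => hWx.
  have := Int_tent_avg Lw d0 y1 y2 hy; set Wy := Int _ s t => hWy.
  have := Int_tent_ge d0 x1 x2; have := Int_tent_ge d0 y1 y2.
  move: hWx hWy; set kx := Int (tent x d) s t; set ky := Int (tent y d) s t.
  move=> hWx hWy ky0 kx0.
  have dd : 0 < d * d / 2 by rewrite divr_gt0// mulr_gt0.
  have {}ky0 := lt_le_trans dd ky0; have {}kx0 := lt_le_trans dd kx0.
  have Wxy : ky * Wx = kx * Wy.
    pose g z := ky * tent x d z - kx * tent y d z.
    have cg : continuous g.
      move=> z; apply: cvgB; apply: cvgMr; exact: tent_continuous.
    have Lt z : L1 s t (tent z d) by apply: L1_cont; exact: tent_continuous.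
    have ig : Int g s t = 0.
      by rewrite IntB ?IntZ//; [rewrite mulrC subrr|exact: L1Z|exact: L1Z].
    have [||||| tg gE] := @Int_test R s t (x - d) (y + d) g.
    - by lra.
    - by lra.
    - exact: cg.
    - move=> z zxy; rewrite /g !tent_out ?mulr0 ?subr0//.
        by apply: contra zxy => /andP[? ?]; lra.
      by apply: contra zxy => /andP[? ?]; lra.
    - exact: ig.
    have := w0 _ tg; rewrite gE.
    rewrite (@eq_Int _ _ _ _ (fun z => ky * (w z * tent x d z) - kx * (w z * tent y d z))); last first.
      by move=> z _; rewrite /g; ring.
    have Lwt z : L1 s t (fun y => w y * tent z d y).
      apply: (L1_le (g := fun y => d * `|w y|)).
      - apply: measurable_funM; first exact: L1_meas Lw.
        exact: L1_meas (Lt z).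
      - by apply: L1Z; exact: L1_norm.
      - apply: ae_in_all => r _; rewrite normrM mulrC ler_wpM2r//.
        by have /andP[t0 td] := tent_bounds z r (ltW d0); rewrite ger0_norm.
    rewrite IntB ?IntZ//; [|exact: L1Z|exact: L1Z].
    by move/eqP; rewrite subr_eq0 => /eqP.
  rewrite -(ler_pM2r (mulr_gt0 kx0 ky0)) -{1}(gtr0_norm kx0) -{1}(gtr0_norm ky0).
  rewrite -!normrM.
  rewrite (_ : (w x - w y) * (kx * ky) =
    kx * (Wy - w y * ky) - ky * (Wx - w x * kx)); last first.
    by rewrite !mulrBr -Wxy; ring.
  rewrite (le_trans (ler_normB _ _))// !normrM (gtr0_norm kx0) (gtr0_norm ky0).
  have h1 := ler_wpM2l (ltW kx0) hWy; have h2 := ler_wpM2l (ltW ky0) hWx.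
  lra.
have [x /andP[sx xt] lx] := ae_in_exists st lpt.
exists (w x); apply: ae_in_imp lpt => y /andP[sy yt] ly.
by have [xy|yx|->//] := ltgtP x y; [apply/esym; exact: cst|exact: cst].
Unshelve. all: by end_near. Qed.

End du_bois_reymond.

(** * Continuous representatives, boundary values and density of test functions *)

Section sobolev.
Context {R : realType}.
Notation mu := (@lebesgue_measure R).
Implicit Types (f g u v w phi : R -> R) (s t x y d e : R).

Lemma measurable_cont s t f : continuous f -> measurable_fun `[s, t] f.
Proof. by move=> cf; apply: measurable_funTS; exact: continuous_measurable_fun. Qed.

(** Subtracting the primitive of [v] leaves a function with weak derivative 0. *)
Lemma weak_derivative_ae s t u v : s < t -> L1 s t u -> L1 s t v ->
  weak_derivative s t u v -> exists c, ae_in s t (fun x => u x = c + Int v s x).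
Proof.
move=> st Lu Lv uv.
pose V x := Int v s (clamp s t x).
have cV : continuous V by apply: continuous_Int_clamp => //; exact: ltW.
have Vw : weak_derivative s t V v.
  by apply: (@primitive_weak_derivative _ _ _ _ _ 0) => // x xst; rewrite add0r /V clamp_id.
have [|phi tphi|c wc] := @weak_derivative0_cst _ s t (fun x => u x - V x) st.
- by apply: L1B => //; exact: L1_cont.
- have [_ cphi _ _] := tphi.
  rewrite (@eq_Int _ _ _ _ (fun x => u x * phi^`()%classic x - V x * phi^`()%classic x)); last first.
    by move=> x _; rewrite mulrBl.
  rewrite IntB; [|apply: L1_mul_cont => //; exact: ltW|
    apply: L1_mul_cont => //; [exact: ltW|exact: L1_cont]].
  rewrite (weak_derivativeE (L1_meas Lu) (L1_meas Lv) uv)//.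
  rewrite (weak_derivativeE (measurable_cont cV) (L1_meas Lv) Vw)//.
  by rewrite subrr.
exists c; apply: ae_in_imp wc => x /andP[? ?] <-.
by rewrite /V clamp_id ?subrK// !ltW.
Qed.

Lemma ae_eq_continuous s t f g : s < t -> continuous f -> continuous g ->
  ae_in s t (fun x => f x = g x) -> forall x, s <= x <= t -> f x = g x.
Proof.
move=> st cf cg fg x /andP[sx xt]; apply/eqP; rewrite -subr_eq0 -normr_le0.
apply/ler_addgt0Pr => e e0; rewrite add0r.
have ch : continuous (fun y => f y - g y) by move=> y; apply: cvgB; [exact: cf|exact: cg].
have [d /= d0 hd] : nbhs_ball x [set y | `|f x - g x - (f y - g y)| < e].
  by apply/nbhs_ballP; have /cvgrPdist_lt := ch x; exact.
have [||y /andP[y1 y2] fgy] := @ae_in_exists _ (Num.max s (x - d)) (Num.min t (x + d)) (fun x => f x = g x).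
- by rewrite gt_max !lt_min; apply/andP; split; apply/andP; split; lra.
- by apply: ae_in_sub fg; rewrite ?le_max ?ge_min lexx.
move: y1 y2; rewrite gt_max lt_min => /andP[sy xy] /andP[yt yx].
have /hd/= : ball x d y by rewrite /ball/= ltr_distlC; lra.
by rewrite fgy subrr subr0 => /ltW.
Qed.

Lemma W12_primitive s t u u1 : s < t -> W12 s t u u1 ->
  {within `[s, t], continuous u} ->
  forall x, s <= x <= t -> u x = u s + Int u1 s x.
Proof.
move=> st [/Lspace2P Lu /Lspace2P Lu1 uu1] cu.
have [c uc] := weak_derivative_ae st (L2_L1 Lu) (L2_L1 Lu1) uu1.
have E x : s <= x <= t -> u x = c + Int u1 s x.
  move=> xst.
  have cuc := continuous_clamp (ltW st) cu.
  have cI : continuous (fun x => c + Int u1 s (clamp s t x)).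
    move=> y; apply: cvgD; first exact: cvg_cst.
    by apply: continuous_Int_clamp => //; [exact: ltW|exact: L2_L1].
  have := @ae_eq_continuous s t _ _ st cuc cI.
  move=> /(_ _ x xst); rewrite /= clamp_id//; apply.
  by apply: ae_in_imp uc => y /andP[? ?] yE; rewrite clamp_id// !ltW.
have sst : s <= s <= t by rewrite lexx ltW.
by move=> x xst; rewrite (E _ xst) (E _ sst) (Int_nil _ (lexx s)) addr0.
Qed.

Lemma Int_norm_le_L2 s t f : s <= t -> L2 s t f ->
  Int (fun x => `|f x|) s t <= Num.sqrt (t - s) * Num.sqrt (Int (fun x => f x ^+ 2) s t).
Proof.
move=> st Lf; have L_1 : L2 s t (fun=> 1) by apply: L2_cont => x; exact: cvg_cst.
have := cauchy_schwarz L_1 Lf.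
under eq_Int do rewrite mul1r.
move=> /le_trans; apply; rewrite (@eq_Int _ s t (fun=> 1 ^+ 2) (fun=> 1)); last first.
  by move=> x _; rewrite expr1n.
by rewrite Int_cst// mul1r.
Qed.

Lemma Lnorm2_lt s t f e : L2 s t f -> 0 <= e -> (Lnorm_itv 2%:E s t f < e%:E)%E ->
  Num.sqrt (Int (fun x => f x ^+ 2) s t) < e.
Proof. by move=> Lf e0; rewrite Lnorm2E// lte_fin. Qed.

(** A test function [phi] vanishes at both ends, so [u - phi] stays within the L^1 norm of
    [u1 - phi'] of its value [u s] at [s]. As [u - phi] is also small in mean, [u s] is small;
    evaluating at [t] then controls [u t]. *)
Lemma W12_0_boundary s t u : s < t -> W12_0 s t u ->
  {within `[s, t], continuous u} -> u s = 0 /\ u t = 0.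
Proof.
move=> st [u1 W h] cu.
have uE := W12_primitive st W cu.
have [/Lspace2P Lu /Lspace2P Lu1 _] := W.
have T0 : 0 < t - s by rewrite subr_gt0.
have sT0 : 0 < Num.sqrt (t - s) by rewrite sqrtr_gt0.
have key e : 0 < e -> `|u s| <= e /\ `|u t - u s| <= e.
  (* With T = t - s, the mean of [u - phi] contributes sqrt(T) e' and its oscillation T sqrt(T) e';
     [e'] is chosen so that they sum to e T. *)
  move=> e0; pose e' := e * (t - s) / (Num.sqrt (t - s) * (1 + (t - s))).
  have D0 : 0 < Num.sqrt (t - s) * (1 + (t - s)) by rewrite mulr_gt0// addr_gt0.
  have e'0 : 0 < e' by rewrite divr_gt0// mulr_gt0.
  have e'E : Num.sqrt (t - s) * e' + (t - s) * (Num.sqrt (t - s) * e') = e * (t - s).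
    by rewrite /e'; field; rewrite !gt_eqF//= addr_gt0.
  have [phi [tphi n1 n2]] := h e' e'0.
  have cphi := test_continuous tphi; have [_ cphi1 _ _] := tphi.
  set psi := phi^`()%classic in n2 cphi1.
  have Lphi : L2 s t (fun x => u x - phi x).
    by apply: L2B => //; exact: L2_cont.
  have Lpsi : L2 s t (fun x => u1 x - psi x).
    by apply: L2B => //; exact: L2_cont.
  have {}n1 := Lnorm2_lt Lphi (ltW e'0) n1.
  have {}n2 := Lnorm2_lt Lpsi (ltW e'0) n2.
  have I1 : Int (fun x => `|u x - phi x|) s t <= Num.sqrt (t - s) * e'.
    apply: (le_trans (Int_norm_le_L2 (ltW st) Lphi)).
    by rewrite ler_wpM2l ?ltW.
  have I2 : Int (fun x => `|u1 x - psi x|) s t <= Num.sqrt (t - s) * e'.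
    apply: (le_trans (Int_norm_le_L2 (ltW st) Lpsi)).
    by rewrite ler_wpM2l ?ltW.
  have uphi x : s <= x <= t -> `|u x - phi x - u s| <= Num.sqrt (t - s) * e'.
    move=> xst; have /andP[sx xt] := xst.
    rewrite uE// -(test_Int sx tphi) -/psi.
    rewrite (_ : _ - _ = Int u1 s x - Int psi s x); last by ring.
    have L s' t' : s <= s' -> t' <= t -> L1 s' t' (fun x => u1 x - psi x).
      by move=> ? ?; apply: L1_sub (L2_L1 Lpsi).
    rewrite -IntB; [|exact: L1_sub (L2_L1 Lu1)|exact: L1_cont].
    apply: (le_trans (ler_norm_Int (L _ _ _ _))) => //.
    apply: le_trans I2; apply: Int_sub_le => //; first by apply/L1_norm/L.
    by apply: ae_in_all => y _.
  split.
    rewrite -(ler_pM2r T0) -e'E -(Int_cst _ (ltW st)).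
    have Lc : L1 s t (fun x => `|u x - phi x - u s|).
      apply/L1_norm/L1B; first exact: L2_L1.
      by apply: L1_cont => x; exact: cvg_cst.
    apply: (@le_trans _ _ (Int (fun x => `|u x - phi x| + `|u x - phi x - u s|) s t)).
      apply: le_Int_ae.
      - by apply: L1_cont => x; exact: cvg_cst.
      - by apply: L1D => //; exact/L1_norm/L2_L1.
      - apply: ae_in_all => x _.
        rewrite -{1}[u s](subKr (u x - phi x)).
        exact: ler_normB.
    rewrite IntD//; last exact/L1_norm/L2_L1.
    rewrite lerD// mulrC -(Int_cst _ (ltW st)).
    apply: le_Int_ae => //; first by apply: L1_cont => x; exact: cvg_cst.
    by apply: ae_in_all => x /andP[? ?]; apply: uphi; rewrite !ltW.
  have := uphi t; rewrite (test_outside tphi) ?ltxx ?andbF// subr0 => /(_ _)/le_trans; apply.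
    by rewrite lexx ltW.
  rewrite -(ler_pM2r T0) -e'E [leLHS]mulrC lerDr.
  by rewrite mulr_ge0// ltW.
have us : u s = 0.
  by apply/eqP; rewrite -normr_le0; apply/ler_addgt0Pr => e /key[]; rewrite add0r.
split=> //; apply/eqP; rewrite -normr_le0.
by apply/ler_addgt0Pr => e /key[_]; rewrite us subr0 add0r.
Qed.

(** A piecewise linear cut-off: 0 outside [s + d, t - d] and 1 on [s + 2d, t - 2d]. *)
Definition plateau s t d x : R :=
  Num.min 1 (Num.max 0 (Num.min (x - s - d) (t - d - x) / d)).

Lemma plateau_continuous s t d : continuous (plateau s t d).
Proof.
move=> x; apply: (@continuous_min _ _ (fun=> 1)
  (fun x => Num.max 0 (Num.min (x - s - d) (t - d - x) / d)) x); first exact: cvg_cst.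
apply: (@continuous_max _ _ (fun=> 0)
  (fun x => Num.min (x - s - d) (t - d - x) / d) x); first exact: cvg_cst.
apply: cvgMl.
apply: (@continuous_min _ _ (fun x => x - s - d) (fun x => t - d - x) x).
  by apply: cvgB; [apply: cvgB; [exact: cvg_id|exact: cvg_cst]|exact: cvg_cst].
by apply: cvgB; [exact: cvg_cst|exact: cvg_id].
Qed.

Lemma plateau_bounds s t d x : 0 <= plateau s t d x <= 1.
Proof. by rewrite /plateau le_min ler01 le_max lexx /= ge_min lexx. Qed.

Lemma plateau_out s t d x : 0 < d -> ~~ (s + d <= x <= t - d) -> plateau s t d x = 0.
Proof.
move=> d0 h; rewrite /plateau (max_idPl _) ?(min_idPr ler01)//.
rewrite pmulr_lle0 ?invr_gt0// ge_min; apply/orP.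
by move: h; rewrite negb_and -!ltNge => /orP[h|h]; [left|right]; lra.
Qed.

Lemma plateau1 s t d x : 0 < d -> s + 2 * d <= x <= t - 2 * d -> plateau s t d x = 1.
Proof.
move=> d0 /andP[h1 h2]; apply/min_idPl; rewrite le_max; apply/orP; right.
by rewrite ler_pdivlMr// mul1r le_min; lra.
Qed.

Lemma Int_plateau s t d : 0 < d -> 4 * d <= t - s ->
  t - s - 4 * d <= Int (plateau s t d) s t.
Proof.
move=> d0 dst.
have -> : t - s - 4 * d = Int (plateau s t d) (s + 2 * d) (t - 2 * d).
  rewrite (@eq_Int _ _ _ _ (fun=> 1)) ?Int_cst; [ring|lra|].
  by move=> x h; rewrite plateau1.
apply: Int_sub_le; [lra|lra|lra| |].
- by apply: L1_cont; exact: plateau_continuous.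
- by apply: ae_in_all => x _; have /andP[] := plateau_bounds s t d x.
Qed.

(** Cutting off [f] destroys its zero mean, so the cut-off function is corrected by a small multiple
    of the plateau itself before it is integrated to a test function. *)
Lemma test_approximation s t f C d : s < t -> continuous f ->
  (forall x, s <= x <= t -> `|f x| <= C) -> Int f s t = 0 ->
  0 < d -> 8 * d <= t - s -> exists phi, test_function s t phi /\
    Int (fun x => (f x - phi^`()%classic x) ^+ 2) s t <= 24 * C ^+ 2 * d.
Proof.
move=> st cf fC f0 d0 dst.
have C0 : 0 <= C by apply: (le_trans _ (fC s _)) => //; rewrite lexx ltW.
pose chi := plateau s t d.
have cchi : continuous chi by exact: plateau_continuous.
have c01 x : 0 <= chi x <= 1 by exact: plateau_bounds.
have Ichi : t - s - 4 * d <= Int chi s t by apply: Int_plateau => //; lra.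
have Ichi0 : 0 < Int chi s t by apply: lt_le_trans Ichi; lra.
have L_chi : L1 s t chi by exact: L1_cont.
have L_cst (k : R) : L1 s t (fun=> k) by apply: L1_cont => x; exact: cvg_cst.
have L1chi : L1 s t (fun x => 1 - chi x) by exact: L1B.
have I1chi : Int (fun x => 1 - chi x) s t <= 4 * d.
  by rewrite IntB// (Int_cst _ (ltW st)); lra.
have ccf : continuous (fun x => chi x * f x).
  by move=> x; apply: cvgM; [exact: cchi|exact: cf].
(* The mean of [f] for the weight [chi], so that [chi * (f - k)] has integral 0. As [f] has integral
   0, that of [chi * f] is minus that of [(1 - chi) * f], and [k] is of order [d]. *)
pose k := Int (fun x => chi x * f x) s t / Int chi s t.
pose g x := chi x * (f x - k).
have cg : continuous g.
  move=> x; apply: cvgM; first exact: cchi.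
  by apply: cvgB; [exact: cf|exact: cvg_cst].
have Ig : Int g s t = 0.
  rewrite (@eq_Int _ _ _ _ (fun x => chi x * f x - k * chi x)); last first.
    by move=> x _; rewrite /g; ring.
  by rewrite IntB ?IntZ//; [rewrite /k divfK ?subrr// gt_eqF|exact: L1_cont|exact: L1Z].
have [||||| tg gE] := @Int_test R s t (s + d) (t - d) g.
- by lra.
- by lra.
- exact: cg.
- by move=> x h; rewrite /g /chi plateau_out// mul0r.
- exact: Ig.
exists (Int g s); split => //; rewrite gE.
have kb : `|k| * (t - s) <= 8 * C * d.
  have h1 : `|Int (fun x => chi x * f x) s t| <= C * (4 * d).
    have -> : Int (fun x => chi x * f x) s t = - Int (fun x => (1 - chi x) * f x) s t.
      rewrite (@eq_Int _ _ _ (fun x => (1 - chi x) * f x) (fun x => f x - chi x * f x)); last first.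
        by move=> x _; ring.
      by rewrite IntB; [rewrite f0 sub0r opprK|exact: L1_cont|exact: L1_cont].
    rewrite normrN; have L1f : L1 s t (fun x => (1 - chi x) * f x).
      by apply: L1_mul_cont => //; exact: ltW.
    apply: (le_trans (ler_norm_Int L1f)).
    apply: (@le_trans _ _ (C * Int (fun x => 1 - chi x) s t)); last by rewrite ler_wpM2l.
    rewrite -IntZ//; apply: le_Int_ae; [exact: L1_norm|exact: L1Z|].
    apply: ae_in_all => x /andP[? ?]; have /andP[? ?] := c01 x.
    rewrite normrM mulrC (ger0_norm (x := 1 - chi x)) ?subr_ge0// ler_wpM2r ?subr_ge0//.
    by apply: fC; rewrite !ltW.
  rewrite /k normrM normfV (gtr0_norm Ichi0) mulrAC ler_pdivrMr//.
  have : t - s <= 2 * Int chi s t by lra.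
  move=> h2; apply: (@le_trans _ _ (C * (4 * d) * (2 * Int chi s t))); last by lra.
  by apply: ler_pM => //; lra.
(* From (x + y)^2 <= 2 x^2 + 2 y^2; the two terms integrate to at most 8 C^2 d and 16 C^2 d, whence
   the constant 24. *)
have pt x : s <= x <= t -> (f x - g x) ^+ 2 <= 2 * (C ^+ 2 * (1 - chi x)) + 2 * k ^+ 2.
  move=> xst; have /andP[ch0 ch1] := c01 x.
  have fx : f x ^+ 2 <= C ^+ 2.
    by rewrite -real_normK ?num_real// ler_pXn2r ?nnegrE// fC.
  rewrite (_ : f x - g x = (1 - chi x) * f x + chi x * k); last by rewrite /g; ring.
  apply: (@le_trans _ _ (2 * ((1 - chi x) * f x) ^+ 2 + 2 * (chi x * k) ^+ 2)).
    rewrite -subr_ge0.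
    have := sqr_ge0 ((1 - chi x) * f x - chi x * k).
    by rewrite (_ : (_ - _) ^+ 2 = 2 * ((1 - chi x) * f x) ^+ 2 + 2 * (chi x * k) ^+ 2 - ((1 - chi x) * f x + chi x * k) ^+ 2)//; ring.
  rewrite lerD// ler_pM2l// exprMn.
    rewrite [leRHS]mulrC; apply: ler_pM => //; rewrite ?sqr_ge0//.
    by rewrite expr2; have : 0 <= (1 - chi x) * chi x by [rewrite mulr_ge0 ?subr_ge0]; lra.
  rewrite -[leRHS]mul1r ler_wpM2r ?sqr_ge0// expr_le1//.
have c2 : continuous (fun x => (f x - g x) ^+ 2).
  move=> x; have h : f y - g y @[y --> x] --> f x - g x by apply: cvgB; [exact: cf|exact: cg].
  exact: (cvgM h h).
apply: (@le_trans _ _ (Int (fun x => 2 * (C ^+ 2 * (1 - chi x)) + 2 * k ^+ 2) s t)).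
  apply: le_Int_ae; first exact: L1_cont.
    by apply: L1D => //; do 2 apply: L1Z.
  by apply: ae_in_all => x /andP[? ?]; apply: pt; rewrite !ltW.
rewrite IntD//; last by do 2 apply: L1Z.
rewrite (Int_cst _ (ltW st)) IntZ; last exact: L1Z.
rewrite IntZ//.
have h1 : C ^+ 2 * Int (fun x => 1 - chi x) s t <= C ^+ 2 * (4 * d).
  by rewrite ler_wpM2l ?sqr_ge0.
have h2 : k ^+ 2 * (t - s) <= 8 * C ^+ 2 * d.
  have kC : `|k| <= C.
    have ts0 : 0 < t - s by lra.
    rewrite -(ler_pM2r ts0) (le_trans kb)//.
    by rewrite mulrAC [leRHS]mulrC ler_wpM2r.
  rewrite -real_normK ?num_real// expr2 -[leLHS]mulrA.
  rewrite (_ : 8 * C ^+ 2 * d = C * (8 * C * d)); last by ring.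
  by apply: ler_pM => //; rewrite mulr_ge0// subr_ge0 ltW.
lra.
Qed.

(** Since [u t = 0], the derivative [f] has mean zero and is approximated in L^2 by derivatives of
    test functions; [u - phi] vanishes at [s], so it is controlled by its derivative as in the
    Poincare inequality. *)
Lemma W12_0_primitive s t f u : s < t -> continuous f ->
  (forall x, s <= x <= t -> u x = Int f s x) -> u t = 0 -> W12_0 s t u.
Proof.
move=> st cf uE ut.
have T0 : 0 < t - s by rewrite subr_gt0.
have cu : continuous (Int f s) by exact: continuous_Int.
have Lf : L2 s t f by exact: L2_cont.
have Lu : L2 s t u.
  have [m1 m2] : L2 s t (Int f s) by exact: L2_cont.
  split; last by apply: L1_eq m2 => x xst; rewrite uE.
  apply: eq_measurable_fun m1 => x; rewrite inE/= in_itv/= => xst.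
  by rewrite uE.
exists f.
  split; [exact/Lspace2P|exact/Lspace2P|].
  apply: (@primitive_weak_derivative _ _ _ _ _ 0) => //; first exact: L2_L1.
  by move=> x xst; rewrite add0r uE.
move=> e e0.
have [C C0 fC] := continuous_bounded (ltW st) cf.
pose e' := e / (1 + (t - s)).
have D0 : 0 < 1 + (t - s) by lra.
have e'0 : 0 < e' by rewrite divr_gt0.
(* The first bound leaves room for the plateau; the second makes 24 C^2 d strictly less than e'^2,
   the [+ 1] avoiding a division by 0. *)
pose d := Num.min ((t - s) / 8) (e' ^+ 2 / (24 * C ^+ 2 + 1)).
have CC : 0 < 24 * C ^+ 2 + 1 by rewrite ltr_wpDl// mulr_ge0// sqr_ge0.
have d0 : 0 < d by rewrite lt_min !divr_gt0// exprn_gt0.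
have dst : 8 * d <= t - s.
  have : d <= (t - s) / 8 by rewrite ge_min lexx.
  lra.
have ft : Int f s t = 0 by rewrite -uE ?ut// lexx ltW.
have [phi [tphi h]] := test_approximation st cf fC ft d0 dst.
exists phi.
have cphi := test_continuous tphi; have [_ cphi1 _ _] := tphi.
move: h cphi1; set psi := phi^`()%classic => h cphi1.
have Lpsi : L2 s t (fun x => f x - psi x).
  by apply: L2B => //; exact: L2_cont.
have Lphi : L2 s t (fun x => u x - phi x).
  by apply: L2B => //; exact: L2_cont.
set E := Int _ s t in h.
have E0 : 0 <= E.
  by apply: Int_ge0; [exact: Lpsi.2|apply: ae_in_all => x _; exact: sqr_ge0].
have Ee : E < e' ^+ 2.
  apply: (le_lt_trans h).
  have : d <= e' ^+ 2 / (24 * C ^+ 2 + 1) by rewrite ge_min lexx orbT.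
  rewrite ler_pdivlMr// => h1.
  by apply: lt_le_trans h1; rewrite mulrDr mulr1 mulrC ltrDl.
have sE : Num.sqrt E < e'.
  by rewrite -(ger0_norm (ltW e'0)) -sqrtr_sqr ltr_sqrt// exprn_gt0.
have e'e : (t - s) * e' <= e.
  rewrite /e' mulrCA ler_piMr ?(ltW e0)// ler_pdivrMr//; lra.
have e'e2 : e' <= e by rewrite /e' ler_pdivrMr// ler_peMr ?(ltW e0)//; lra.
split => //; last by rewrite Lnorm2E// lte_fin (lt_le_trans sE).
rewrite Lnorm2E// lte_fin; apply: (@le_lt_trans _ _ ((t - s) * Num.sqrt E)); last first.
  by apply: lt_le_trans e'e; rewrite ltr_pM2l.
rewrite -[leRHS]ger0_norm ?mulr_ge0 ?sqrtr_ge0 ?(ltW T0)// -sqrtr_sqr.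
rewrite ler_wsqrtr// (_ : (_ * _) ^+ 2 = ((t - s) * E) * (t - s)); last first.
  by rewrite exprMn sqr_sqrtr// expr2 mulrAC.
rewrite -(Int_cst _ (ltW st)); apply: le_Int_ae; [exact: Lphi.2|by apply: L1_cont => x; exact: cvg_cst|].
apply: ae_in_all => x /andP[/ltW sx /ltW xt].
have -> : (t - s) * E = (Num.sqrt (t - s) * Num.sqrt E) ^+ 2.
  by rewrite exprMn !sqr_sqrtr// ltW.
rewrite -[leLHS]real_normK ?num_real// ler_pXn2r ?nnegrE ?mulr_ge0 ?sqrtr_ge0//.
rewrite /= uE ?sx// -(test_Int sx tphi) -/psi -IntB; [|exact: L1_cont|exact: L1_cont].
have L p q : s <= p -> q <= t -> L1 p q (fun x => f x - psi x).
  by move=> ? ?; apply: L1_sub (L2_L1 Lpsi).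
apply: (le_trans (ler_norm_Int (L _ _ _ _))) => //.
apply: le_trans (Int_norm_le_L2 (ltW st) Lpsi); apply: Int_sub_le => //.
  by apply/L1_norm/L.
by apply: ae_in_all => y _.
Qed.

End sobolev.

(** * Comparison and barriers *)

Section comparison.
Context {R : realType}.
Variables (a b : R) (A : R -> R).
Hypotheses (ab : a < b) (cA : continuous A) (A0 : forall x, 0 < A x).
Implicit Types (f g k u v : R -> R) (s t x y : R).

Lemma flux_diff s g x y : L1 a b g -> a <= x -> x <= y -> y <= b ->
  flux a b s g x - flux a b s g y = Int g x y.
Proof.
move=> Lg ax xy yb; rewrite /flux /prim !clamp_id ?ax ?(le_trans ax)// ?yb ?(le_trans xy)//.
by rewrite (@Int_cat _ a y x)//; [ring|exact: L1_sub Lg].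
Qed.

Lemma dirichlet_quasi g s x : L1 a b g -> a <= s -> s <= x ->
  dirichlet a b A g x =
  dirichlet a b A g s + Int (fun y => A y * flux a b (slope a b A g) g y) s x.
Proof.
move=> Lg as_ sx; rewrite /dirichlet /ivp -Int_cat//.
by apply: L1_cont; exact: ivp_integrand_continuous.
Qed.

(** Where [v] exceeds the solution, the difference of the fluxes increases, so [quasi_convex_le0]
    applies to [v - u]. The inequality between [k] and [g] is demanded only on that set, and this is
    what lets a truncated right-hand side satisfy it. *)
Lemma dirichlet_ge g s t v V k : a <= s -> t <= b -> L1 a b g -> continuous V ->
  (forall x, s <= x <= t -> v x = v s + Int (fun y => A y * V y) s x) ->
  v s <= dirichlet a b A g s -> v t <= dirichlet a b A g t ->
  L1 s t k ->
  (forall x y, s <= x -> x <= y -> y <= t -> V x - V y <= Int k x y) ->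
  ae_in s t (fun x => dirichlet a b A g x < v x -> k x <= g x) ->
  forall x, s <= x <= t -> v x <= dirichlet a b A g x.
Proof.
move=> as_ tb Lg cV vE vs vt Lk Vk kg x xst.
set u := dirichlet a b A g in vs vt kg *.
pose U := flux a b (slope a b A g) g.
have cU : continuous U by exact: flux_continuous.
have c_mul f : continuous f -> continuous (fun y => A y * f y).
  by move=> cf y; apply: cvgM; [exact: cA|exact: cf].
rewrite -subr_le0.
apply: (@quasi_convex_le0 R s t A (fun y => V y - U y) (fun y => v y - u y)) => //.
- by move=> y; apply: cvgB; [exact: cV|exact: cU].
- move=> y yst; rewrite vE// /u (dirichlet_quasi (s := s))//; last by case/andP: yst.
  rewrite (@eq_Int _ s y (fun z => A z * (V z - U z)) (fun z => A z * V z - A z * U z)); last first.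
    by move=> z _; rewrite mulrBr.
  rewrite IntB; [by rewrite /U; ring|exact/L1_cont/c_mul|exact/L1_cont/c_mul].
- by rewrite subr_le0.
- by rewrite subr_le0.
move=> y z sy yz zt pos.
have : V y - V z <= U y - U z.
  rewrite /U flux_diff//; [|exact: le_trans sy|exact: le_trans tb].
  apply: (le_trans (Vk y z sy yz zt)); apply: le_Int_ae.
  - exact: L1_sub Lk.
  - by apply: L1_sub Lg; [exact: le_trans sy|exact: le_trans tb].
  - apply: ae_in_imp (ae_in_sub sy zt kg) => r /andP[yr rz]; apply.
    by rewrite -subr_gt0; apply: pos; rewrite !ltW.
lra.
Qed.

Lemma dirichlet_le g1 g2 x : L1 a b g1 -> L1 a b g2 ->
  ae_in a b (fun x => g1 x <= g2 x) -> a <= x <= b ->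
  dirichlet a b A g1 x <= dirichlet a b A g2 x.
Proof.
move=> L1g L2g g12 xab.
have dir_a g : dirichlet a b A g a = 0 by rewrite /dirichlet /ivp Int_nil.
have L1A f : L1 a b f -> continuous (fun y => A y * f y) -> True by [].
apply: (@dirichlet_ge g2 a b (dirichlet a b A g1) (flux a b (slope a b A g1) g1) g1) => //.
- exact: flux_continuous.
- by move=> y /andP[ay yb]; apply: dirichlet_quasi.
- by rewrite !dir_a.
- by rewrite !dirichlet_end.
- by move=> y z ay yz zb; rewrite flux_diff.
- by apply: ae_in_imp g12 => z _ h _.
Qed.

Lemma eq_dirichlet g k : (forall y, a <= y <= b -> g y = k y) ->
  dirichlet a b A g = dirichlet a b A k.
Proof.
move=> gk; have e : prim a b g = prim a b k.
  apply/funext => y; have /andP[y1 y2] := clamp_in y (ltW ab).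
  by apply: eq_Int => z /andP[az zy]; rewrite gk// az (le_trans zy).
by rewrite /dirichlet /ivp /slope /flux e.
Qed.

Lemma dirichletZ r g x : L1 a b g ->
  dirichlet a b A (fun y => r * g y) x = r * dirichlet a b A g x.
Proof.
move=> Lg; have e : prim a b (fun y => r * g y) = fun y => r * prim a b g y.
  apply/funext => y; have /andP[y1 y2] := clamp_in y (ltW ab).
  by rewrite /prim IntZ//; exact: L1_sub Lg.
have cp := prim_continuous ab Lg.
have es : slope a b A (fun y => r * g y) = r * slope a b A g.
  rewrite /slope e (@eq_Int _ _ _ _ (fun y => r * (A y * prim a b g y))); last first.
    by move=> y _; rewrite mulrCA.
  by rewrite IntZ ?mulrA//; apply: L1_cont => y; apply: cvgM; [exact: cA|exact: cp].
rewrite /dirichlet /ivp es -IntZ; last by apply: L1_cont; exact: ivp_integrand_continuous.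
by apply: eq_Int => y _; rewrite /flux e; ring.
Qed.

End comparison.

(** * Powers of solutions of linear problems *)

Section powers.
Context {R : realType}.
Implicit Types (p q x y : R).

(** Cutting the base at 0 gives a function continuous on the whole line that agrees with the power
    on the nonnegative numbers. *)
Lemma powR_max0_continuous p : 0 < p -> continuous (fun x : R => Num.max x 0 `^ p).
Proof.
move=> p0 x; have [x0|x0|->] := ltgtP x 0.
- have e : \forall y \near x, (fun=> 0) y = Num.max y 0 `^ p.
    near=> y; rewrite (max_idPr _) ?powR0 ?gt_eqF// ltW//.
    by near: y; exact: lt_nbhsl.
  rewrite /continuous_at (max_idPr (ltW x0)) powR0 ?gt_eqF//.
  by apply: (cvg_trans (near_eq_cvg e)); exact: cvg_cst.
- have e : \forall y \near x, y `^ p = Num.max y 0 `^ p.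
    near=> y; rewrite (max_idPl _)// ltW//.
    by near: y; exact: lt_nbhsr.
  rewrite /continuous_at (max_idPl (ltW x0)).
  apply: (cvg_trans (near_eq_cvg e)).
  have d : derivable (@powR R ^~ p) x 1.
    by apply: derivable_powR; rewrite in_itv/= x0.
  have := @derivable1_diffP _ _ (@powR R ^~ p) x.
  by case=> /(_ d)/differentiable_continuous.
- rewrite /continuous_at maxxx powR0 ?gt_eqF//.
  apply/cvgrPdist_lt => e e0.
  have h := powR_cvg0 p0.
  have /cvgrPdist_lt/(_ e e0) := h.
  rewrite near_withinE => H.
  near=> y.
  have [y0|y0] := ltP 0 y; last first.
    by rewrite powR0 ?gt_eqF// subrr normr0.
  move: y0; near: y.
  exact: H.
Unshelve. all: by end_near. Qed.

End powers.

Section power_subsolution.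
Context {R : realType}.
Variables (p : R) (A : R -> R).
Hypotheses (p01 : 0 < p < 1) (cA : continuous A) (A0 : forall x, 0 < A x).
Implicit Types (n z Z : R -> R) (s t x y : R).

Let q := (1 - p)^-1.

Let p0 : 0 < p. Proof. by case/andP: p01. Qed.
Let p1 : 0 < 1 - p. Proof. by rewrite subr_gt0; case/andP: p01. Qed.
Let q0 : 0 < q. Proof. by rewrite invr_gt0. Qed.
(** So z^(q-1) is (z^q)^p: differentiating the barrier z^q produces exactly the power of the
    nonlinearity. *)
Let q1 : q - 1 = q * p.
Proof. by rewrite /q; field; rewrite gt_eqF. Qed.
Let q10 : 0 < q - 1. Proof. by rewrite q1 mulr_gt0. Qed.

(* With z = v^(1-p), the term in z'^2 of (1-p) (L v) v^(-p) has the favourable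
   sign, so that only the linear equation for z matters. *)
Lemma power_subsolution s t n z Z : s <= t -> continuous z -> continuous Z ->
  L1 s t n -> ae_in s t (fun x => 0 <= n x) ->
  (forall x, s <= x <= t -> z x = z s + Int (fun y => A y * Z y) s x) ->
  (forall x, s <= x <= t -> 0 <= z x) -> (forall x, s < x < t -> 0 < z x) ->
  (forall x y, s <= x -> x <= y -> y <= t -> Z y - Z x = (1 - p) * Int n x y) ->
  (forall x, s <= x <= t -> 0 <= Z x) \/ (forall x, s <= x <= t -> Z x <= 0) ->
  let V x := q * Num.max (z x) 0 `^ (q - 1) * Z x in
  [/\ continuous V,
      forall x, s <= x <= t -> z x `^ q = z s `^ q + Int (fun y => A y * V y) s x &
      forall x y, s <= x -> x <= y -> y <= t ->
        V x - V y <= Int (fun x => - (n x * (z x `^ q) `^ p)) x y].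
Proof.
move=> st cz cZ Ln n0 zE z0 zp Zn Zs V.
have cP : continuous (fun x => Num.max (z x) 0 `^ (q - 1)).
  by move=> x; exact: (continuous_comp (cz x) (@powR_max0_continuous _ _ q10 _)).
have cQ : continuous (fun x => Num.max (z x) 0 `^ q).
  by move=> x; exact: (continuous_comp (cz x) (@powR_max0_continuous _ _ q0 _)).
have cAZ : continuous (fun y => A y * Z y).
  by move=> y; apply: cvgM; [exact: cA|exact: cZ].
have cV : continuous V.
  move=> x; apply: cvgM; last exact: cZ.
  by apply: cvgMr; exact: cP.
split => //.
  move=> x /andP[sx xt].
  have cAV : continuous (fun y => A y * V y).
    by move=> y; apply: cvgM; [exact: cA|exact: cV].
  have -> : Int (fun y => A y * V y) s x = Num.max (z x) 0 `^ q - Num.max (z s) 0 `^ q.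
    apply: (@FTC2 _ _ (fun y => Num.max (z y) 0 `^ q)) => // y /andP[sy yx].
    have yst : s < y < t by rewrite sy (lt_le_trans yx).
    have zy := zp _ yst.
    have dz : is_derive y 1 z (A y * Z y).
      have dI := is_derive_Int cAZ sy.
      have e : \forall r \near y, z s + Int (fun y => A y * Z y) s r = z r.
        near=> r; rewrite [RHS]zE//; apply/andP; split; apply/ltW.
          by near: r; exact: lt_nbhsr.
        by near: r; apply: lt_nbhsl; case/andP: yst.
      apply: (near_eq_is_derive e).
      by rewrite -[A y * Z y]add0r; exact: is_deriveD.
    have dq : is_derive y 1 (fun r => z r `^ q) (A y * V y).
      have h1 := is_derive1_powR q zy.
      have := is_derive1_comp h1 dz.
      have -> : q * z y `^ (q - 1) * (A y * Z y) = A y * V y.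
        by rewrite /V (max_idPl (ltW zy)); ring.
      exact.
    apply: (near_eq_is_derive _ dq).
    near=> r; rewrite (max_idPl _)// ltW//.
    by near: r; have /cvgr_gt := cz y; exact.
  rewrite !(max_idPl _) ?z0 ?lexx ?sx//; ring.
move=> x y sx xy yt.
have xst : s <= x <= t by rewrite sx (le_trans xy).
have yst : s <= y <= t by rewrite yt (le_trans sx).
pose P r := Num.max (z r) 0 `^ (q - 1).
have Lxy : L1 x y n by exact: L1_sub Ln.
have n0xy : ae_in x y (fun r => 0 <= n r) by exact: ae_in_sub n0.
have LnP : L1 x y (fun r => n r * P r) by exact: L1_mul_cont.
have -> : Int (fun r => - (n r * (z r `^ q) `^ p)) x y = - Int (fun r => n r * P r) x y.
  rewrite -IntN//; apply: eq_Int => r /andP[xr ry].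
  rewrite /P -powRrM -q1 (max_idPl _)// z0// (le_trans sx)//=.
  exact: le_trans yt.
have zd r r' : x <= r -> r <= r' -> r' <= y -> z r' = z r + Int (fun y => A y * Z y) r r'.
  move=> xr rr' r'y; rewrite (zE r') ?(zE r).
  - by rewrite -addrA -Int_cat ?(le_trans sx)//; exact: L1_cont.
  - by rewrite (le_trans sx)// (le_trans rr')// (le_trans r'y).
  - by rewrite (le_trans sx (le_trans xr rr')) (le_trans r'y).
have Ple r r' : z r <= z r' -> P r <= P r'.
  have m0 w : Num.max w 0 \is @Num.nneg R by rewrite nnegrE le_max lexx orbT.
  move=> zz; apply: ge0_ler_powR => //; first exact: ltW.
  by rewrite ge_max; apply/andP; split; rewrite le_max ?zz ?lexx ?orbT.
have P0 r : 0 <= P r by exact: powR_ge0.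
have nP k : ae_in x y (fun r => P r <= k) -> Int (fun r => n r * P r) x y <= k * Int n x y.
  move=> Pk; rewrite -IntZ//; apply: le_Int_ae => //; first exact: L1Z.
  by apply: ae_in_imp (ae_in_and n0xy Pk) => r _ [nr Pr]; rewrite mulrC ler_wpM2r.
have Zxy := Zn x y sx xy yt.
have qZ : q * (Z y - Z x) = Int n x y.
  by rewrite Zxy mulrA /q mulVf ?mul1r// gt_eqF.
have VE r : V r = q * (P r * Z r) by rewrite /V mulrA.
have {}Zs : (forall r, x <= r <= y -> 0 <= Z r) \/ (forall r, x <= r <= y -> Z r <= 0).
  by case: Zs => h; [left|right] => r /andP[xr ry]; apply: h;
    rewrite (le_trans sx)// (le_trans ry).
have xxy : x <= x <= y by rewrite lexx.
have yxy : x <= y <= y by rewrite lexx xy.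
(* The sign of [Z] makes [z] monotone, so [P] is largest at one end of [x, y] and [n * P] is bounded
   by that value times [n]. What remains of [V y - V x] is [q * (P y - P x) * Z x], or
   [q * (P x - P y) * - Z y]: the z'^2 term in integrated form. *)
rewrite lerNr opprB; case: Zs => Zs.
- have zmono r : x <= r <= y -> z r <= z y.
    move=> /andP[xr ry]; rewrite (zd r y)// lerDl; apply: Int_ge0; first exact: L1_cont.
    apply: ae_in_all => w /andP[? ?]; rewrite mulr_ge0 ?(ltW (A0 _))// Zs//.
    by rewrite (le_trans xr) ?ltW.
  apply: (@le_trans _ _ (P y * Int n x y)).
    by apply: nP; apply: ae_in_all => r /andP[? ?]; apply/Ple/zmono; rewrite !ltW.
  rewrite -qZ !VE -subr_ge0.
  rewrite (_ : _ - _ = q * ((P y - P x) * Z x)); last by ring.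
  by rewrite mulr_ge0 ?(ltW q0)// mulr_ge0 ?Zs// subr_ge0 Ple// zmono.
- have zmono r : x <= r <= y -> z r <= z x.
    move=> /andP[xr ry]; rewrite (zd x r)// gerDl -oppr_ge0 -IntN; last exact: L1_cont.
    apply: Int_ge0; first by apply: L1N; exact: L1_cont.
    apply: ae_in_all => w /andP[? ?]; rewrite -mulrN mulr_ge0 ?(ltW (A0 _))// oppr_ge0 Zs//.
    by rewrite ltW//= (le_trans _ ry)// ltW.
  apply: (@le_trans _ _ (P x * Int n x y)).
    by apply: nP; apply: ae_in_all => r /andP[? ?]; apply/Ple/zmono; rewrite !ltW.
  rewrite -qZ !VE -subr_ge0.
  rewrite (_ : _ - _ = q * ((P x - P y) * - Z y)); last by ring.
  by rewrite mulr_ge0 ?(ltW q0)// mulr_ge0 ?oppr_ge0 ?Zs// subr_ge0 Ple// zmono.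
Unshelve. all: by end_near. Qed.

End power_subsolution.

(** * The integrating factor *)

Section weight.
Context {R : realType}.
Variables (al : R) (bt : R -> R).
Hypothesis cbt : continuous bt.
Implicit Types (f g u v w : R -> R) (s t x y : R).

Definition wup x : R := expR (Int bt al x).
Definition wlow x : R := expR (- Int bt al x).

Lemma wup_gt0 x : 0 < wup x. Proof. exact: expR_gt0. Qed.
Lemma wlow_gt0 x : 0 < wlow x. Proof. exact: expR_gt0. Qed.

Lemma wupK x : wup x * wlow x = 1.
Proof. by rewrite /wup /wlow expRN mulfV// gt_eqF// expR_gt0. Qed.

Lemma wup_continuous : continuous wup.
Proof.
move=> x; apply: (continuous_comp (continuous_Int (a := al) cbt (x := x))).
exact: continuous_expR.
Qed.

Lemma wlow_continuous : continuous wlow.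
Proof.
move=> x; have h : - Int bt al y @[y --> x] --> - Int bt al x.
  by apply: cvgN; exact: continuous_Int.
by apply: (continuous_comp h); exact: continuous_expR.
Qed.

Lemma is_derive_wup x : al < x -> is_derive x 1 wup (bt x * wup x).
Proof.
move=> ax; have dI := is_derive_Int cbt ax.
by have := is_derive1_comp (is_derive_expR (Int bt al x)) dI; rewrite mulrC.
Qed.

Lemma is_derive_wlow x : al < x -> is_derive x 1 wlow (- (bt x * wlow x)).
Proof.
move=> ax; have dI := is_derive_Int cbt ax.
have dN : is_derive x 1 (fun y => - Int bt al y) (- bt x) by exact: is_deriveN.
have := @is_derive1_comp R expR (fun y => - Int bt al y) x _ _
  (is_derive_expR (- Int bt al x)) dN.
by rewrite mulrN mulrC.
Qed.

(** The product rule for [U1 * wlow], where [U1] is only a primitive of an integrable function;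
    hence the appeal to integration by parts. *)
Lemma weighted_flux s t U1 u2 x y : al <= s -> L1 s t u2 ->
  (forall x y, s <= x -> x <= y -> y <= t -> U1 y = U1 x + Int u2 x y) ->
  s <= x -> x <= y -> y <= t ->
  U1 y * wlow y - U1 x * wlow x =
  Int (fun r => (u2 r - bt r * U1 r) * wlow r) x y.
Proof.
move=> als Lu UE sx xy yt.
have Lxy : L1 x y u2 by exact: L1_sub Lu.
have ch : continuous (fun r => - (bt r * wlow r)).
  by move=> r; apply: cvgN; apply: cvgM; [exact: cbt|exact: wlow_continuous].
have dw r : x < r < y -> is_derive r 1 wlow (- (bt r * wlow r)).
  move=> /andP[xr _]; apply: is_derive_wlow.
  by rewrite (le_lt_trans als)// (le_lt_trans sx).
have := primitive_integration_by_parts (U1 x) xy Lxy wlow_continuous ch dw.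
rewrite -(UE _ _ sx xy yt) => ->.
have cU : continuous (fun r => U1 x + Int u2 x (clamp x y r)).
  by move=> r; apply: cvgD; [exact: cvg_cst|exact: continuous_Int_clamp].
have E r : x <= r <= y -> U1 x + Int u2 x r = U1 r.
  by move=> /andP[xr ry]; rewrite -UE// (le_trans ry).
rewrite -IntD.
- by apply: eq_Int => r xry; rewrite E//; ring.
- apply: (@L1_eq _ _ _ (fun r => (U1 x + Int u2 x (clamp x y r)) * - (bt r * wlow r))).
    by move=> r xry; rewrite clamp_id.
  by apply: L1_cont => r; apply: cvgM; [exact: cU|exact: ch].
- by apply: L1_mul_cont => //; exact: wlow_continuous.
Qed.

End weight.

(** * The principal eigenfunction and the lower bound on the eigenvalue *)

Section principal_eigenfunction.
Context {R : realType}.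
Variables (al : R) (b bt : R -> R).
Hypothesis cbt : continuous bt.
Implicit Types (f g u v w phi : R -> R) (s t x y : R).
Let A := wup al bt.
Let Ai := wlow al bt.

Lemma Int_max_eq0 s t x g : continuous g -> s < x < t ->
  (forall y, s <= y <= t -> Int g s y <= Int g s x) -> g x = 0.
Proof.
move=> cg /andP[sx xt] xmax.
have dI y : s < y -> is_derive y 1 (Int g s) (g y) by exact: is_derive_Int.
have : is_derive x 1 (Int g s) 0.
  apply: (@derive1_at_max R (Int g s) s t x) => //.
  - by apply/ltW/(lt_trans sx).
  - by move=> y; rewrite in_itv/= => /andP[/dI[]].
  - by rewrite in_itv/= sx.
  - by move=> y; rewrite in_itv/= => /andP[? ?]; apply: xmax; rewrite !ltW.
by have [_ <-] := dI x sx; case.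
Qed.

(** Turns the a.e. equation into an integrated one for the quasi-derivative [phi' / A]. The weak
    derivative [phi1] is only an a.e. class, so its continuous representative [U1] is used
    instead. *)
Lemma eigen_flux s t lam w phi phi1 phi2 : al <= s -> s < t ->
  (forall x, s <= x <= t -> b x = bt x) -> L1 s t w ->
  positive_W22_0 s t phi phi1 phi2 ->
  ae_in s t (fun x => - phi2 x + b x * phi1 x = lam * w x * phi x) ->
  exists2 Phi, continuous Phi &
    (forall x, s <= x <= t -> phi x = Int (fun y => A y * Phi y) s x) /\
    (forall x y, s <= x -> x <= y -> y <= t ->
       Phi x - Phi y = lam * Int (fun r => w r * phi r * Ai r) x y).
Proof.
move=> als st bE Lw [[W1 W2] W0 cphi phi0] eqn.
have [phis _] := W12_0_boundary st W0 cphi.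
have phiE := W12_primitive st W1 cphi.
have [/Lspace2P L1' /Lspace2P L2' w12] := W2.
have [c phi1E] := weak_derivative_ae st (L2_L1 L1') (L2_L1 L2') w12.
pose U1 x := c + Int phi2 s (clamp s t x).
have cU : continuous U1.
  move=> x; apply: cvgD; first exact: cvg_cst.
  by apply: continuous_Int_clamp; [exact: ltW|exact: L2_L1].
have {}phi1E : ae_in s t (fun x => phi1 x = U1 x).
  by apply: ae_in_imp phi1E => x /andP[? ?] ->; rewrite /U1 clamp_id// !ltW.
have cA : continuous A by exact: wup_continuous.
have cAi : continuous Ai by exact: wlow_continuous.
have phiU x : s <= x <= t -> phi x = Int U1 s x.
  move=> xst; have /andP[sx xt] := xst; rewrite phiE// phis add0r.
  apply: eq_Int_ae; [exact: L1_sub (L2_L1 L1')|apply: L1_meas; exact: (@L1_cont _ s x)|].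
  exact: ae_in_sub phi1E.
exists (fun x => U1 x * Ai x).
  by move=> x; apply: cvgM; [exact: cU|exact: cAi].
split.
  move=> x xst; rewrite phiU//; apply: eq_Int => y _.
  by rewrite mulrCA wupK mulr1.
move=> x y sx xy yt.
have UE r r' : s <= r -> r <= r' -> r' <= t -> U1 r' = U1 r + Int phi2 r r'.
  move=> sr rr' r't; rewrite /U1 !clamp_id ?sr ?(le_trans rr')// ?r't ?(le_trans sr)//.
  by rewrite -addrA -Int_cat//; apply: L1_sub (L2_L1 L2').
have Lphi2 : L1 x y phi2 by exact: L1_sub (L2_L1 L2').
have Lphi : L1 x y phi.
  apply: (@L1_eq _ _ _ (Int U1 s)).
    by move=> r /andP[xr ry]; rewrite phiU// (le_trans sx)// (le_trans ry).
  by apply: L1_cont; exact: continuous_Int.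
have cphiA : continuous (fun r => Int U1 s r * Ai r).
  by move=> r; apply: cvgM; [exact: continuous_Int|exact: cAi].
have LwpA : L1 x y (fun r => w r * phi r * Ai r).
  apply: (@L1_eq _ _ _ (fun r => w r * (Int U1 s r * Ai r))).
    by move=> r /andP[xr ry]; rewrite phiU ?mulrA// (le_trans sx)// (le_trans ry).
  by apply: L1_mul_cont => //; exact: L1_sub Lw.
have := weighted_flux cbt als (L2_L1 L2') UE sx xy yt.
move=> /(congr1 -%R); rewrite opprB => ->.
rewrite -IntZ// -IntN; last first.
  apply: L1_mul_cont => //; apply: L1B => //; apply: L1_cont => r.
  by apply: cvgM; [exact: cbt|exact: cU].
apply: eq_Int_ae.
- apply: L1N; apply: L1_mul_cont => //; apply: L1B => //; apply: L1_cont => r.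
  by apply: cvgM; [exact: cbt|exact: cU].
- exact: L1_meas (L1Z _ LwpA).
- have := ae_in_and (ae_in_sub sx yt phi1E) (ae_in_sub sx yt eqn).
  apply: ae_in_imp => r /andP[xr ry] [<- e].
  rewrite -bE; last by rewrite (le_trans sx (ltW xr)) (le_trans (ltW ry)).
  by rewrite !mulrA -e /Ai; ring.
Qed.

Lemma eigen_max s t lam w phi phi1 phi2 : al <= s -> s < t ->
  (forall x, s <= x <= t -> b x = bt x) -> L1 s t w ->
  ae_in s t (fun x => 0 <= w x) -> 0 < lam ->
  positive_W22_0 s t phi phi1 phi2 ->
  ae_in s t (fun x => - phi2 x + b x * phi1 x = lam * w x * phi x) ->
  exists xs Phi, [/\ s < xs < t, continuous Phi,
    phi s = 0 /\ phi t = 0,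
    forall x, s <= x <= t -> 0 <= phi x <= phi xs &
    [/\ forall x, s <= x <= t -> phi x = Int (fun y => A y * Phi y) s x,
    Phi xs = 0 &
    forall x y, s <= x -> x <= y -> y <= t ->
       Phi x - Phi y = lam * Int (fun r => w r * phi r * Ai r) x y]].
Proof.
move=> als st bE Lw w0 lam0 hphi eqn.
have [Phi cPhi [phiE PhiE]] := eigen_flux als st bE Lw hphi eqn.
have [_ W0 cphi phi0] := hphi.
have [phis phit] := W12_0_boundary st W0 cphi.
have [xs + xsmax] := @EVT_max R phi s t (ltW st) cphi.
rewrite in_itv/= => /andP[sxs xst].
have phi_mid : 0 < phi ((s + t) / 2) by apply: phi0; rewrite in_itv/=; lra.
have phixs : 0 < phi xs.
  by apply: (lt_le_trans phi_mid); apply: xsmax; rewrite in_itv/=; lra.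
have {}sxs : s < xs.
  rewrite lt_neqAle sxs andbT; apply: contraTneq phixs => <-.
  by rewrite phis ltxx.
have {}xst : xs < t.
  rewrite lt_neqAle xst andbT; apply: contraTneq phixs => ->.
  by rewrite phit ltxx.
exists xs, Phi; split => //; first by rewrite sxs.
- move=> x /andP[sx xt]; apply/andP; split; last by apply: xsmax; rewrite in_itv/= sx.
  move: sx; rewrite le_eqVlt => /predU1P[<-|sx]; first by rewrite phis.
  move: xt; rewrite le_eqVlt => /predU1P[->|xt]; first by rewrite phit.
  by apply/ltW/phi0; rewrite in_itv/= sx.
split => //.
have cAP : continuous (fun y => A y * Phi y).
  by move=> y; apply: cvgM; [exact: wup_continuous|exact: cPhi].
have : A xs * Phi xs = 0.
  apply: (@Int_max_eq0 s t xs _ cAP); first by rewrite sxs.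
  have xsst : s <= xs <= t by rewrite !ltW.
  move=> y yst; rewrite -!phiE//.
  by apply: xsmax; rewrite in_itv.
by move/eqP; rewrite mulf_eq0 gt_eqF ?wup_gt0//= => /eqP.
Qed.

(* Integrating the equation twice from the maximum of phi. *)
Lemma eigenvalue_ge1 s t lam w phi phi1 phi2 k : al <= s -> s < t ->
  (forall x, s <= x <= t -> b x = bt x) -> L1 s t w ->
  ae_in s t (fun x => 0 <= w x) -> 0 < lam ->
  positive_W22_0 s t phi phi1 phi2 ->
  ae_in s t (fun x => - phi2 x + b x * phi1 x = lam * w x * phi x) ->
  (forall x y, s <= x -> x <= y -> y <= t -> Int (fun r => w r * Ai r) x y <= k y) ->
  L1 s t (fun x => A x * k x) ->
  (forall x, s <= x <= t -> Int (fun x => A x * k x) x t <= 1) -> 1 <= lam.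
Proof.
move=> als st bE Lw w0 lam0 hphi eqn wk Lk Ik.
have [xs [Phi [/andP[sxs xst] cPhi [phis phit] phimax [phiE Phi0 PhiE]]]] :=
  eigen_max als st bE Lw w0 lam0 hphi eqn.
have [_ _ _ phi0] := hphi.
have px : 0 < phi xs by apply: phi0; rewrite in_itv/= sxs.
have cA : continuous A by exact: wup_continuous.
have cAi : continuous Ai by exact: wlow_continuous.
have cAP : continuous (fun y => A y * Phi y).
  by move=> y; apply: cvgM; [exact: cA|exact: cPhi].
have cI := continuous_Int (a := s) cAP.
have LwA x y : s <= x -> x <= y -> y <= t -> L1 x y (fun r => w r * Ai r).
  by move=> sx xy yt; apply: L1_mul_cont => //; exact: L1_sub Lw.
have LwpA x y : s <= x -> x <= y -> y <= t -> L1 x y (fun r => w r * phi r * Ai r).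
  move=> sx xy yt.
  apply: (@L1_eq _ _ _ (fun r => (w r * Ai r) * Int (fun y => A y * Phi y) s r)).
    move=> r /andP[xr ry]; have rst : s <= r <= t.
      by rewrite (le_trans sx)// (le_trans ry).
    by rewrite -(phiE r rst) mulrAC.
  by apply: L1_mul_cont => //; exact: LwA.
have Phib x : xs <= x <= t -> - Phi x <= lam * phi xs * k x.
  move=> /andP[xx xt]; have := PhiE xs x (ltW sxs) xx xt; rewrite Phi0 sub0r => ->.
  rewrite -mulrA ler_wpM2l ?(ltW lam0)//.
  apply: (@le_trans _ _ (phi xs * Int (fun r => w r * Ai r) xs x)); last first.
    by rewrite ler_wpM2l ?(ltW px)// wk// ltW.
  have sxs' := ltW sxs.
  rewrite -IntZ; last exact: LwA.
  apply: le_Int_ae; [exact: LwpA|by apply: L1Z; exact: LwA|].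
  apply: ae_in_imp (ae_in_sub sxs' xt w0) => r /andP[xr rx] wr.
  rewrite mulrAC mulrC ler_wpM2r ?mulr_ge0 ?(ltW (wlow_gt0 _ _ _))//.
  have rst : s <= r <= t by rewrite (le_trans sxs' (ltW xr)) (le_trans (ltW rx)).
  by have /andP[] := phimax r rst.
have : phi xs <= lam * phi xs.
  (* Since [phi t = 0], the maximum is the total drop between [xs] and [t]; [Phib] bounds the rate
     of this drop by [lam * phi xs * A * k]. *)
  have e : phi xs = Int (fun y => - (A y * Phi y)) xs t.
    rewrite IntN; last exact: L1_cont.
    have tst : s <= t <= t by rewrite lexx ltW.
    have xsst : s <= xs <= t by rewrite !ltW.
    have := phiE t tst.
    rewrite phit (Int_cat (ltW sxs) (ltW xst)); last exact: L1_cont.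
    by rewrite -(phiE xs xsst) => /esym/eqP; rewrite addr_eq0 => /eqP.
  rewrite {1}e -[leRHS]mulr1.
  apply: (@le_trans _ _ (lam * phi xs * Int (fun x => A x * k x) xs t)); last first.
    apply: ler_wpM2l; first by rewrite mulr_ge0// ltW.
    by apply: Ik; rewrite !ltW.
  have Lk' : L1 xs t (fun x => A x * k x) by apply: L1_sub Lk => //; exact: ltW.
  rewrite -IntZ//; apply: le_Int_ae; [by apply: L1N; exact: L1_cont|exact: L1Z|].
  apply: ae_in_all => x /andP[xx xt]; rewrite -mulrN [leRHS]mulrCA ler_wpM2l ?(ltW (wup_gt0 _ _ _))//.
  by apply: Phib; rewrite !ltW.
by rewrite -{1}(mul1r (phi xs)) ler_pM2r.
Qed.

End principal_eigenfunction.

(** * Linear barriers starting from the two endpoints *)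

Section barriers.
Context {R : realType}.
Variables (al be p : R) (A n : R -> R).
Hypotheses (albe : al < be) (p01 : 0 < p < 1).
Hypotheses (cA : continuous A) (A0 : forall x, 0 < A x).
Hypotheses (Ln : L1 al be n) (n0 : forall x, 0 <= n x).
Implicit Types (x y d l : R) (f Z : R -> R).

Let p1 : 0 < 1 - p. Proof. by rewrite subr_gt0; case/andP: p01. Qed.

Let cmul f : continuous f -> continuous (fun y => A y * f y).
Proof. by move=> cf y; apply: cvgM; [exact: cA|exact: cf]. Qed.

Let P := prim al be n.

Let cP : continuous P. Proof. exact: prim_continuous. Qed.

Let PE x : al <= x <= be -> P x = Int n al x.
Proof. by move=> h; rewrite /P /prim clamp_id. Qed.

Let Pd x y : al <= x -> x <= y -> y <= be -> P y - P x = Int n x y.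
Proof.
move=> ax xy yb; rewrite !PE ?ax ?(le_trans ax xy) ?(le_trans xy yb)//.
rewrite (@Int_cat _ al y x)//; last exact: L1_sub Ln.
by rewrite addrC addKr.
Qed.

Let P0 x : 0 <= P x.
Proof.
have /andP[h1 h2] := clamp_in x (ltW albe).
by apply: Int_ge0; [exact: L1_sub Ln|exact: ae_in_all].
Qed.

Let Pbe x : P x <= P be.
Proof.
have /andP[h1 h2] := clamp_in x (ltW albe).
rewrite /P /prim (@clamp_id _ _ _ be) ?lexx ?(ltW albe)//.
by apply: Int_sub_le => //; exact: ae_in_all.
Qed.

Let Int_pos f x y : continuous f -> (forall r, 0 < f r) -> x < y ->
  0 < Int (fun r => A r * f r) x y.
Proof.
move=> cf f0 xy; apply: (@IntA_gt0 _ x y (fun r => A r * f r)) => //.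
  exact: cmul.
by move=> r; rewrite mulr_gt0.
Qed.

(** Half of the gap in the strict hypothesis is spent on a constant [d > 0] in the flux. Without it
    a barrier would vanish wherever [n] does near the endpoint, and positivity of the solution would
    be lost. *)
Let gap_lemma (I S l : R) : 0 < S -> (1 - p) * I < l ->
  exists2 d, 0 < d & (1 - p) * (I + d * S) < l.
Proof.
move=> S0 hl; exists ((l - (1 - p) * I) / (2 * S)).
  by rewrite divr_gt0 ?mulr_gt0// subr_gt0.
have -> : (l - (1 - p) * I) / (2 * S) * S = (l - (1 - p) * I) / 2.
  by field; rewrite gt_eqF.
have : 0 < l - (1 - p) * I by rewrite subr_gt0.
set g := l - _ => g0.
have : (1 - p) * (g / 2) <= 1 * (g / 2).
  by rewrite ler_wpM2r ?divr_ge0 ?(ltW g0)//; case/andP: p01; lra.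
have : l = g + (1 - p) * I by rewrite /g; ring.
by rewrite mulrDr => ->; lra.
Qed.

(** The solution of [z' = A Z], [Z' = (1 - p) n] with [z al = 0] and [Z al = (1 - p) d]. Its size is
    controlled at [x1], the far end, because the position of the maximum point [xs] is not known in
    advance; monotonicity carries the bound back to [xs]. *)
Lemma left_barrier x1 l : al < x1 -> x1 <= be ->
  (1 - p) * Int (fun x => A x * Int n al x) al x1 < l ->
  exists z Z, [/\ continuous z, continuous Z, z al = 0,
    (forall x, al <= x -> z x = z al + Int (fun y => A y * Z y) al x) &
    [/\ forall x y, al <= x -> x < y -> z x < z y, z x1 < l,
    forall x, 0 <= Z x &
    forall x y, al <= x -> x <= y -> y <= be -> Z y - Z x = (1 - p) * Int n x y]].
Proof.
move=> alx1 x1be hl.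
have S0 := IntA_gt0 alx1 cA A0.
have [d d0 hd] := gap_lemma S0 hl.
pose Z x := (1 - p) * (P x + d).
have cZ : continuous Z.
  by move=> x; apply: cvgMr; apply: cvgD; [exact: cP|exact: cvg_cst].
have Z0 x : 0 < Z x by rewrite mulr_gt0// ltr_wpDl.
pose z := Int (fun y => A y * Z y) al.
have zal : z al = 0 by rewrite /z Int_nil.
have cAZ := cmul cZ.
exists z, Z; split => //.
- exact: continuous_Int.
- by move=> x _; rewrite zal add0r.
split => //.
- move=> x y ax xy; rewrite /z (@Int_cat _ al y x)//; [|exact: ltW|exact: L1_cont].
  by rewrite ltrDl; exact: Int_pos.
- rewrite (_ : z x1 = (1 - p) * (Int (fun x => A x * Int n al x) al x1 + d * Int A al x1))//.
  have LP : L1 al x1 (fun x => A x * Int n al x).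
    apply: (@L1_eq _ _ _ (fun y => A y * P y)); last exact/L1_cont/cmul.
    by move=> y /andP[ay yx]; rewrite PE// ay (le_trans yx).
  have LA : L1 al x1 (fun x => d * A x) by apply: L1Z; exact: L1_cont.
  rewrite -IntZ; last exact: L1_cont.
  rewrite -IntD// -IntZ; last exact: L1D.
  by apply: eq_Int => y /andP[ay yx]; rewrite /Z PE ?ay ?(le_trans yx)//; ring.
- by move=> x; exact: ltW.
- by move=> x y ax xy yb; rewrite /Z -mulrBr opprD addrACA subrr addr0 Pd.
Qed.

(** The mirror image, started at [be] and bounded at [x0]. The flux is now negative but still
    increases at rate [(1 - p) n], so both barriers fit [power_subsolution]. *)
Lemma right_barrier x0 l : al <= x0 -> x0 < be ->
  (1 - p) * Int (fun x => A x * Int n x be) x0 be < l ->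
  exists z Z, [/\ continuous z, continuous Z, z be = 0,
    (forall x, x0 <= x -> z x = z x0 + Int (fun y => A y * Z y) x0 x) &
    [/\ forall x y, x0 <= x -> x < y -> z y < z x, z x0 < l,
    forall x, Z x <= 0 &
    forall x y, al <= x -> x <= y -> y <= be -> Z y - Z x = (1 - p) * Int n x y]].
Proof.
move=> alx0 x0be hl.
have S0 := IntA_gt0 x0be cA A0.
have [d d0 hd] := gap_lemma S0 hl.
pose Y x := (1 - p) * (P be - P x + d).
have cY : continuous Y.
  move=> x; apply: cvgMr; apply: cvgD; last exact: cvg_cst.
  by apply: cvgB; [exact: cvg_cst|exact: cP].
have Y0 x : 0 < Y x by rewrite mulr_gt0// ltr_wpDl// subr_ge0 Pbe.
have cAY := cmul cY.
pose z x := Int (fun y => A y * Y y) x0 be - Int (fun y => A y * Y y) x0 x.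
have IN x y : Int (fun y => A y * - Y y) x y = - Int (fun y => A y * Y y) x y.
  by rewrite -IntN; [apply: eq_Int => r _; rewrite mulrN|exact: L1_cont].
have zx0 : z x0 = Int (fun y => A y * Y y) x0 be by rewrite /z (Int_nil _ (lexx x0)) subr0.
exists z, (fun x => - Y x); split => //.
- by move=> x; apply: cvgB; [exact: cvg_cst|exact: continuous_Int].
- by move=> x; apply: cvgN; exact: cY.
- by rewrite /z subrr.
- by move=> x _; rewrite IN zx0.
split => //.
- move=> x y ax xy; rewrite /z (@Int_cat _ x0 y x)//; [|exact: ltW|exact: L1_cont].
  by rewrite opprD addrA ltrBlDr ltrDl; exact: Int_pos.
- rewrite zx0 (_ : Int _ x0 be = (1 - p) * (Int (fun x => A x * Int n x be) x0 be + d * Int A x0 be))//.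
  have LP : L1 x0 be (fun x => A x * Int n x be).
    apply: (@L1_eq _ _ _ (fun y => A y * (P be - P y))).
      by move=> y /andP[xy yb]; rewrite Pd// (le_trans alx0).
    apply/L1_cont/cmul => y.
    by apply: cvgB; [exact: cvg_cst|exact: cP].
  have LA : L1 x0 be (fun x => d * A x) by apply: L1Z; exact: L1_cont.
  rewrite -IntZ; last exact: L1_cont.
  rewrite -IntD// -IntZ; last exact: L1D.
  by apply: eq_Int => y /andP[ay yb]; rewrite /Y Pd ?(le_trans alx0)//; ring.
- by move=> x; rewrite oppr_le0 ltW.
- move=> x y ax xy yb; rewrite /Y -Pd//; ring.
Qed.

End barriers.

(** * The sublinear problem *)

Section sublinear_problem.
Context {R : realType}.
Variables (al be p C : R) (A Ai m c : R -> R).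
Hypotheses (albe : al < be) (p01 : 0 < p < 1).
Hypotheses (cA : continuous A) (A0 : forall x, 0 < A x).
Hypotheses (cAi : continuous Ai) (Ai0 : forall x, 0 < Ai x).
Hypotheses (L2m : L2 al be m) (mc : measurable_fun `[al, be] c).
Hypotheses (cC : ae_in al be (fun x => `|c x| <= C)).
Hypothesis c0 : ae_in al be (fun x => 0 <= c x).
Implicit Types (x y r : R) (u v : R -> R).

Let p0 : 0 < p. Proof. by case/andP: p01. Qed.
Let p1 : 0 < 1 - p. Proof. by rewrite subr_gt0; case/andP: p01. Qed.
Let albe' : al <= be. Proof. exact: ltW. Qed.

(** The nonlinearity carries the factor [Ai], later [1 / A], because [dirichlet] inverts
    [u -> - (u' / A)'] rather than the original operator. *)
Definition reaction x r : R := (m x * r `^ p - c x * r) * Ai x.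

(** Raises [r] to the barrier [v] and cuts it at [N], so that the reaction stays under one
    integrable bound for every real [r]. *)
Definition truncation (N v r : R) : R := Num.min N (Num.max r v).

(* Taking the maximum over the lower barriers v1, v2, v3 makes the right-hand
   side dominate the one of each barrier on the set where it is not respected. *)
Definition truncated_reaction N (v1 v2 v3 : R -> R) x r : R :=
  Num.max (reaction x (truncation N (v1 x) r))
    (Num.max (reaction x (truncation N (v2 x) r)) (reaction x (truncation N (v3 x) r))).

Lemma truncation_bounds (N v r : R) : 0 <= N -> 0 <= v -> 0 <= truncation N v r <= N.
Proof.
move=> N0 v0; rewrite /truncation ge_min lexx andbT le_min N0 /=.
by rewrite le_max v0 orbT.
Qed.

Lemma reaction_le N x r : 0 <= r <= N ->
  `|reaction x r| <= (`|m x| * N `^ p + `|c x| * N) * Ai x.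
Proof.
move=> /andP[r0 rN]; have N0 := le_trans r0 rN.
rewrite /reaction normrM (gtr0_norm (Ai0 x)) ler_wpM2r ?(ltW (Ai0 x))//.
rewrite (le_trans (ler_normB _ _))// !normrM (ger0_norm (powR_ge0 _ _)) (ger0_norm r0).
rewrite lerD// ler_wpM2l//.
by apply: ge0_ler_powR; rewrite ?nnegrE ?(ltW p0).
Qed.

Lemma reaction_le_abs N x r : 0 <= c x -> 0 <= r <= N ->
  reaction x r <= N `^ p * (`|m x| * Ai x).
Proof.
move=> cx /andP[r0 rN]; have N0 := le_trans r0 rN.
rewrite /reaction mulrA ler_wpM2r ?(ltW (Ai0 x))//.
apply: (@le_trans _ _ (m x * r `^ p)).
  by rewrite gerDl oppr_le0 mulr_ge0.
apply: (@le_trans _ _ (`|m x| * r `^ p)).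
  by rewrite ler_wpM2r ?powR_ge0// ler_norm.
rewrite mulrC ler_wpM2r//.
by apply: ge0_ler_powR; rewrite ?nnegrE ?(ltW p0).
Qed.

(* This is why the lower barriers must stay below 1: then c r <= c r^p. *)
Lemma reaction_ge x r : 0 <= c x -> 0 <= r <= 1 ->
  (m x - c x) * r `^ p * Ai x <= reaction x r.
Proof.
move=> cx /andP[r0 r1]; rewrite /reaction ler_wpM2r ?(ltW (Ai0 x))//.
rewrite mulrBl lerB// ler_wpM2l//.
move: r0; rewrite le_eqVlt => /predU1P[<-|r0]; first by rewrite powR_ge0.
by apply: ger1_powR; [rewrite r0|case/andP: p01 => _ /ltW].
Qed.

Lemma Lc : L1 al be c.
Proof.
apply: (L1_le mc _ cC); by apply: L1_cont => x; exact: cvg_cst.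
Qed.

(** The upper cut at [N] is never active, by sublinearity: the right-hand side is at most
    [N ^ p * |m| * Ai], so the solution is at most [N ^ p * K], and this stays below [N] when [N] is
    large because [p < 1]. *)
Lemma truncated_solution v1 v2 v3 :
  (forall v, v \in [:: v1; v2; v3] -> measurable_fun `[al, be] v /\ forall x, 0 <= v x) ->
  exists N u, [/\ 1 <= N, continuous u,
    L1 al be (fun y => truncated_reaction N v1 v2 v3 y (u y)),
    forall x, al <= x <= be -> u x =
      dirichlet al be A (fun y => truncated_reaction N v1 v2 v3 y (u y)) x &
    forall x, al <= x <= be -> u x <= N].
Proof.
move=> vP.
have [m1 v10] : measurable_fun `[al, be] v1 /\ forall x, 0 <= v1 x by apply: vP; rewrite !inE eqxx.
have [m2 v20] : measurable_fun `[al, be] v2 /\ forall x, 0 <= v2 x by apply: vP; rewrite !inE eqxx orbT.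
have [m3 v30] : measurable_fun `[al, be] v3 /\ forall x, 0 <= v3 x by apply: vP; rewrite !inE eqxx !orbT.
have LmA : L1 al be (fun x => `|m x| * Ai x).
  by apply: L1_mul_cont => //; apply: L1_norm; exact: L2_L1.
pose D := dirichlet al be A (fun x => `|m x| * Ai x).
have cD : continuous D by exact: ivp_continuous.
have [K K0 DK] := continuous_bounded albe' cD.
(* Solves N^(1-p) = max(1, K), so that N^p K <= N; the maximum with 1 ensures that the cut lies
   above barriers with values in [0, 1]. *)
pose N := Num.max 1 K `^ (1 - p)^-1.
have M1 : 1 <= Num.max 1 K by rewrite le_max lexx.
have N1 : 1 <= N.
  rewrite /N -[leLHS](powRr0 (Num.max 1 K)); apply: ler_powR => //.
  by rewrite invr_ge0 ltW.
have N0 : 0 <= N by exact: le_trans N1.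
have NK : N `^ p * K <= N.
  rewrite -[leRHS](powRr1 N0) -(subrK p 1) powRD; last first.
    by rewrite (gt_eqF (lt_le_trans ltr01 N1)) implybT.
  rewrite mulrC ler_wpM2r ?powR_ge0// /N -powRrM mulVf ?gt_eqF// powRr1.
    by rewrite le_max lexx orbT.
  exact: le_trans M1.
pose F := truncated_reaction N v1 v2 v3.
have tb (v r : R) : 0 <= v -> 0 <= truncation N v r <= N by exact: truncation_bounds.
have max_ind (P : R -> Prop) a1 a2 a3 : P a1 -> P a2 -> P a3 ->
    P (Num.max a1 (Num.max a2 a3)).
  by move=> ? ? ?; case: (leP a2 a3) => _; case: leP.
have mF w : measurable_fun `[al, be] w -> measurable_fun `[al, be] (fun y => F y (w y)).
  move=> mw.
  have mt v : measurable_fun `[al, be] v ->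
      measurable_fun `[al, be] (fun y => truncation N (v y) (w y)).
    by move=> mv; apply: measurable_minr => //; exact: measurable_maxr.
  have mr v : measurable_fun `[al, be] v ->
      measurable_fun `[al, be] (fun y => reaction y (truncation N (v y) (w y))).
    move=> mv; apply: measurable_funM; last exact: measurable_cont.
    apply: measurable_funB; apply: measurable_funM => //.
    - by case: L2m.
    - by apply: (measurableT_comp (measurable_powR p)); exact: mt.
    - exact: mt.
  by do 2 (apply: measurable_maxr; first exact: mr); exact: mr.
pose k x := (`|m x| * N `^ p + `|c x| * N) * Ai x.
have Fk y r : `|F y r| <= k y.
  by apply: (max_ind (fun z => `|z| <= _)); apply: reaction_le; exact: tb.
have Lk : L1 al be k.
  apply: L1_mul_cont => //; apply: L1D.
    by under eq_fun do rewrite mulrC; apply/L1Z/L1_norm/L2_L1.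
  by under eq_fun do rewrite mulrC; apply/L1Z/L1_norm/Lc.
have [u cu uE] : exists2 u : R -> R, continuous u &
    forall x, al <= x <= be -> u x = dirichlet al be A (fun y => F y (u y)) x.
  apply: (@dirichlet_fixpoint R al be A F k) => //.
  move=> y _.
  have ct (v : R) : 0 <= v -> continuous (fun r => reaction y (truncation N v r)).
    move=> v0 r.
    have cmin : continuous (truncation N v).
      move=> z; apply: (@continuous_min _ _ (fun=> N) (fun r => Num.max r v) z).
        exact: cvg_cst.
      apply: (@continuous_max _ _ (fun r => r) (fun=> v) z); first exact: cvg_id.
      exact: cvg_cst.
    have cpow : continuous (fun r => truncation N v r `^ p).
      have -> : (fun r => truncation N v r `^ p) =
          (fun r => Num.max (truncation N v r) 0 `^ p).
        by apply/funext => z; rewrite (max_idPl _)//; case/andP: (tb v z v0).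
      move=> z.
      exact: (continuous_comp (cmin z) (@powR_max0_continuous _ _ p0 _)).
    apply: cvgMl; apply: cvgB; apply: cvgMr; [exact: cpow|exact: cmin].
  move=> r; apply: (@continuous_max _ _ (fun r => reaction y (truncation N (v1 y) r))
    (fun r => Num.max (reaction y (truncation N (v2 y) r))
      (reaction y (truncation N (v3 y) r))) r); first exact: ct.
  by apply: (@continuous_max _ _ (fun r => reaction y (truncation N (v2 y) r))
      (fun r => reaction y (truncation N (v3 y) r)) r); exact: ct.
have LF : L1 al be (fun y => F y (u y)).
  apply: (L1_le _ Lk); first by apply: mF; exact: measurable_cont.
  by apply: ae_in_all => y _.
exists N, u; split => // x xab.
rewrite uE//; apply: le_trans NK.
apply: (@le_trans _ _ (N `^ p * D x)).
  rewrite -dirichletZ//; apply: dirichlet_le => //; first exact: L1Z.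
  apply: ae_in_imp c0 => y _ cy.
  by apply: (max_ind (fun z => z <= _)); apply: reaction_le_abs => //; exact: tb.
by rewrite ler_wpM2l ?powR_ge0// (le_trans (ler_norm _))// DK.
Qed.

(** At a point where [u < v], truncating at the barrier equal to [v] there returns [v] itself, as
    [v <= 1 <= N]. The maximum in the right-hand side then dominates [reaction z (v z)], hence
    [k z]. Membership among the three barriers is pointwise, so [v] may follow different ones at
    different points. *)
Lemma truncated_barrier N v1 v2 v3 u s t v V k : 1 <= N ->
  L1 al be (fun y => truncated_reaction N v1 v2 v3 y (u y)) ->
  (forall x, al <= x <= be ->
    u x = dirichlet al be A (fun y => truncated_reaction N v1 v2 v3 y (u y)) x) ->
  al <= s -> s <= t -> t <= be ->
  (forall z, s < z < t -> v z \in [:: v1 z; v2 z; v3 z] /\ 0 <= v z <= 1) ->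
  continuous V ->
  (forall x, s <= x <= t -> v x = v s + Int (fun y => A y * V y) s x) ->
  v s <= u s -> v t <= u t -> L1 s t k ->
  (forall x y, s <= x -> x <= y -> y <= t -> V x - V y <= Int k x y) ->
  (forall z, s < z < t -> k z <= (m z - c z) * v z `^ p * Ai z) ->
  forall x, s <= x <= t -> v x <= u x.
Proof.
move=> N1 LF uE als st tbe vP cV vE vs vt Lk Vk kle x xst.
have sal : al <= s <= be by rewrite als (le_trans st).
have tal : al <= t <= be by rewrite tbe andbT (le_trans als).
have xal : al <= x <= be.
  by case/andP: xst => sx xt; rewrite (le_trans als sx) (le_trans xt tbe).
rewrite uE//.
apply: (@dirichlet_ge R al be A albe cA A0 _ s t v V k) => //; rewrite -?uE//.
apply: ae_in_imp (ae_in_sub als tbe c0) => z szt cz; rewrite -uE; last first.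
  by case/andP: szt => /ltW sz /ltW zt; rewrite (le_trans als sz) (le_trans zt tbe).
move=> uv; have [vin vb] := vP z szt.
apply: (le_trans (kle z szt)).
apply: (@le_trans _ _ (reaction z (v z))); first exact: reaction_ge.
have tv : truncation N (v z) (u z) = v z.
  rewrite /truncation (max_idPr (ltW uv)); apply/min_idPr.
  by case/andP: vb => _ /le_trans; apply.
rewrite /truncated_reaction; move: vin; rewrite !inE => /or3P[] /eqP e;
  by rewrite -e tv !le_max lexx ?orbT.
Qed.

(** The order of the comparisons matters: first with 0, which gives the boundary inequalities for
    [th] at [x0] and [x1]; then with [th], which raises [u xs] to [l ^ (1 / (1 - p))]; and last with
    the outer barriers, whose values at [xs] lie below that. *)
Lemma sublinear_solution (x0 x1 xs l : R) (th Th : R -> R) (n : R -> R) :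
  al <= x0 -> x0 < xs -> xs < x1 -> x1 <= be -> 0 < l <= 1 ->
  continuous Th ->
  (forall x, x0 <= x <= x1 -> th x = Int (fun y => A y * Th y) x0 x) ->
  th x0 = 0 -> th x1 = 0 -> th xs = l `^ (1 - p)^-1 ->
  (forall x, x0 <= x <= x1 -> 0 <= th x <= th xs) ->
  L1 x0 x1 (fun r => (m r - c r) * th r `^ p * Ai r) ->
  (forall x y, x0 <= x -> x <= y -> y <= x1 ->
    Th x - Th y <= Int (fun r => (m r - c r) * th r `^ p * Ai r) x y) ->
  (forall x, n x = Num.max (- (m x - c x)) 0 * Ai x) -> L1 al be n ->
  (1 - p) * Int (fun x => A x * Int n al x) al x1 < l ->
  (1 - p) * Int (fun x => A x * Int n x be) x0 be < l ->
  exists N u, [/\ continuous u, L1 al be (fun y => reaction y (u y)),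
    forall x, al <= x <= be -> u x = dirichlet al be A (fun y => reaction y (u y)) x,
    forall x, al <= x <= be -> 0 <= u x <= N &
    forall x, al < x < be -> 0 < u x].
Proof.
move=> alx0 x0xs xsx1 x1be /andP[l0 l1] cTh thE thx0 thx1 thxs thb Lth Thle nE Ln hl hr.
set q := (1 - p)^-1 in thxs.
have q0 : 0 < q by rewrite invr_gt0.
have alxs : al < xs by exact: le_lt_trans x0xs.
have xsbe : xs < be by exact: lt_le_trans x1be.
have n0 x : 0 <= n x by rewrite nE mulr_ge0 ?(ltW (Ai0 x))// le_max lexx orbT.
have n0ae s t : ae_in s t (fun x => 0 <= n x) by apply: ae_in_all.
have [zl [Zl [czl cZl zlal zlE [zlinc zlx1 Zl0 Zln]]]] :=
  left_barrier albe p01 cA A0 Ln n0 (lt_trans alxs xsx1) x1be hl.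
have [zr [Zr [czr cZr zrbe zrE [zrdec zrx0 Zr0 Zrn]]]] :=
  right_barrier albe p01 cA A0 Ln n0 alx0 (lt_trans x0xs xsbe) hr.
have zlxs : zl xs < l by apply: lt_trans zlx1; apply: zlinc => //; exact: ltW.
have zrxs : zr xs < l by apply: lt_trans zrx0; exact: zrdec.
have zlp x : al < x -> 0 < zl x by move=> ax; rewrite -zlal zlinc.
have zrp x : xs <= x -> x < be -> 0 < zr x.
  by move=> xsx xb; rewrite -zrbe zrdec// (le_trans (ltW x0xs)).
have zlb x : al <= x <= xs -> 0 <= zl x <= l.
  move=> /andP[ax xxs]; apply/andP; split.
    by move: ax; rewrite le_eqVlt => /predU1P[<-|/zlp/ltW//]; rewrite zlal.
  move: xxs; rewrite le_eqVlt => /predU1P[->|xxs]; first exact: ltW.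
  by rewrite ltW// (lt_trans _ zlxs)// zlinc.
have zrb x : xs <= x <= be -> 0 <= zr x <= l.
  move=> /andP[xsx xbe]; apply/andP; split.
    by move: xbe; rewrite le_eqVlt => /predU1P[->|/(zrp _ xsx)/ltW//]; rewrite zrbe.
  move: xsx; rewrite le_eqVlt => /predU1P[<-|xsx]; first exact: ltW.
  by rewrite ltW// (lt_trans _ zrxs)// zrdec// ltW.
have lq1 : l `^ q <= 1.
  have e : (1 : R) `^ q = 1 by rewrite powR1.
  rewrite -[leRHS]e; apply: ge0_ler_powR => //; rewrite ?nnegrE//; exact: ltW.
have powl z : 0 <= z <= l -> z `^ q <= l `^ q.
  move=> /andP[z0 zl_l]; apply: ge0_ler_powR => //; rewrite ?nnegrE//; exact: ltW.
have pow1 z : 0 <= z <= l -> 0 <= z `^ q <= 1.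
  by move=> h; rewrite powR_ge0/=; apply: le_trans lq1; exact: powl.
(* [v1] leaves out [xs], so at each point at least one of [v1] and [v3] is 0; hence the zero
   function follows these barriers and is one itself. *)
pose v1 := (fun x => zl x `^ q) \_ `[al, xs[.
pose v2 := th \_ `[x0, x1].
pose v3 := (fun x => zr x `^ q) \_ `[xs, be].
have v1E x : al <= x -> x < xs -> v1 x = zl x `^ q.
  by move=> ax xxs; rewrite /v1 /patch ifT// inE/= in_itv/= ax.
have v1E0 x : xs <= x -> v1 x = 0.
  by move=> xsx; rewrite /v1 /patch ifF//; apply/negbTE; rewrite notin_setE/= in_itv/= ltNge xsx andbF.
have v2E x : x0 <= x <= x1 -> v2 x = th x.
  by move=> h; rewrite /v2 /patch ifT// inE/= in_itv.
have v3E x : xs <= x <= be -> v3 x = zr x `^ q.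
  by move=> h; rewrite /v3 /patch ifT// inE/= in_itv.
have v3E0 x : x < xs -> v3 x = 0.
  move=> xxs; rewrite /v3 /patch ifF//; apply/negbTE; rewrite notin_setE/= in_itv/=.
  by rewrite leNgt xxs.
have v1b x : 0 <= v1 x <= 1.
  rewrite /v1 /patch; case: ifPn => [|_]; last by rewrite lexx ler01.
  by rewrite inE/= in_itv/= => /andP[h1 h2]; apply/pow1/zlb; rewrite h1 ltW.
have v2b x : 0 <= v2 x <= 1.
  rewrite /v2 /patch; case: ifPn => [|_]; last by rewrite lexx ler01.
  rewrite inE/= in_itv/= => /thb /andP[-> h]/=.
  by apply: le_trans lq1; rewrite -thxs.
have v3b x : 0 <= v3 x <= 1.
  rewrite /v3 /patch; case: ifPn => [|_]; last by rewrite lexx ler01.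
  by rewrite inE/= in_itv/= => h; apply: pow1; exact: zrb.
have mpow (z : R -> R) : continuous z -> measurable_fun setT (fun x : R => z x `^ q).
  move=> cz; apply: (measurableT_comp (measurable_powR q)).
  exact: continuous_measurable_fun.
have mpatch (f : R -> R) (D : set R) : measurable D -> measurable_fun D f ->
    measurable_fun `[al, be] (f \_ D).
  move=> mD mf; apply: (@measurable_funS _ _ _ _ setT) => //.
  by apply/(measurable_restrictT _ mD); exact: mf.
have mv2 : measurable_fun `[al, be] v2.
  apply: mpatch => //.
  apply: (eq_measurable_fun (Int (fun y => A y * Th y) x0)).
    by move=> x; rewrite inE/= in_itv/= => /thE ->.
  apply: measurable_cont; apply: continuous_Int => x.
  by apply: cvgM; [exact: cA|exact: cTh].
have [N [u [N1 cu LF uE uN]]] : exists N u, [/\ 1 <= N, continuous u,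
    L1 al be (fun y => truncated_reaction N v1 v2 v3 y (u y)),
    forall x, al <= x <= be -> u x =
      dirichlet al be A (fun y => truncated_reaction N v1 v2 v3 y (u y)) x &
    forall x, al <= x <= be -> u x <= N].
  apply: truncated_solution => v; rewrite !inE => /or3P[] /eqP ->.
  - split; last by move=> x; case/andP: (v1b x).
    by apply: mpatch => //; exact: measurable_funS (mpow _ czl).
  - by split => // x; case/andP: (v2b x).
  - split; last by move=> x; case/andP: (v3b x).
    by apply: mpatch => //; exact: measurable_funS (mpow _ czr).
have u_al : u al = 0.
  by rewrite uE ?lexx//; rewrite /dirichlet /ivp Int_nil.
have u_be : u be = 0.
  by rewrite uE ?lexx ?albe'// dirichlet_end.
have barrier := truncated_barrier N1 LF uE.
have u0 x : al <= x <= be -> 0 <= u x.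
  have c0' : continuous (fun _ : R => 0 : R) by move=> y; exact: cvg_cst.
  apply: (@barrier al be (fun=> 0) (fun=> 0) (fun=> 0)) => //.
  - move=> z _; rewrite lexx ler01; split => //; rewrite !inE.
    by have [/v1E0->|/v3E0->] := leP xs z; rewrite eqxx ?orbT.
  - move=> y /andP[ay _]; rewrite add0r (@eq_Int _ _ _ _ (fun=> 0)).
      by rewrite Int_cst ?mul0r.
    by move=> z _; rewrite mulr0.
  - by rewrite u_al.
  - by rewrite u_be.
  - exact: L1_cont.
  - by move=> y z _ yz _; rewrite subrr Int_cst// mul0r.
  - by move=> z _; rewrite powR0 ?mulr0 ?mul0r// gt_eqF.
have uth x : x0 <= x <= x1 -> th x <= u x.
  have x01 : x0 <= x1 by rewrite ltW// (lt_trans x0xs).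
  have thE' y : x0 <= y <= x1 -> th y = th x0 + Int (fun y => A y * Th y) x0 y.
    by move=> h; rewrite thx0 add0r thE.
  apply: (@barrier x0 x1 th Th _ alx0 x01 x1be _ cTh thE' _ _ Lth Thle) => //.
  - move=> z /andP[/ltW xz /ltW zx]; have h : x0 <= z <= x1 by rewrite xz.
    by rewrite -(v2E z h) v2b !inE eqxx orbT.
  - by rewrite thx0 u0// alx0 (le_trans x01).
  - by rewrite thx1 u0// x1be (le_trans alx0).
have uxs : l `^ q <= u xs by rewrite -thxs uth// !ltW.
have Lnv (z : R -> R) s t : continuous z -> al <= s -> s <= t -> t <= be ->
    (forall x, s <= x <= t -> 0 <= z x) ->
    L1 s t (fun x => - (n x * (z x `^ q) `^ p)).
  move=> cz als st tbe z0; apply: L1N.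
  have qp0 : 0 < q * p by rewrite mulr_gt0.
  have cz' : continuous (fun x => Num.max (z x) 0 `^ (q * p)).
    by move=> x; exact: (continuous_comp (cz x) (@powR_max0_continuous _ _ qp0 _)).
  have := L1_mul_cont st (L1_sub als tbe Ln) cz'; apply: L1_eq => x xst.
  by rewrite (max_idPl (z0 x xst)) powRrM.
(* The outer barriers only see the worst case: [n] is the negative part of the weight, times
   [Ai]. *)
have nv z (r : R) : - (n z * r `^ p) <= (m z - c z) * r `^ p * Ai z.
  rewrite nE mulrAC -mulNr -mulNr ler_wpM2r ?(ltW (Ai0 z))//.
  by rewrite ler_wpM2r ?powR_ge0// lerNl le_max lexx.
have ul x : al <= x <= xs -> zl x `^ q <= u x.
  have [|||||cV vE Vk] := @power_subsolution R p A p01 cA A0 al xs n zl Zl (ltW alxs) czl cZl (L1_sub (lexx al) (ltW xsbe) Ln) (n0ae _ _).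
  - by move=> y /andP[ay _]; exact: zlE.
  - by move=> y /zlb/andP[].
  - by move=> y /andP[/zlp].
  - by move=> y z ay yz zx; apply: Zln => //; rewrite (le_trans zx)// ltW.
  - by left => y _.
  apply: (@barrier al xs (fun x => zl x `^ q) _ _ (lexx al) (ltW alxs) (ltW xsbe) _ cV vE _ _ _ Vk).
  - by move=> z /andP[/ltW az zx]; rewrite -v1E// v1b !inE eqxx.
  - by rewrite zlal u_al powR0// gt_eqF.
  - by apply: le_trans uxs; apply: powl; apply: zlb; rewrite lexx ltW.
  - apply: Lnv => //; [exact: ltW|exact: ltW|].
    by move=> y /zlb/andP[].
  - by move=> z _; exact: nv.
have ur x : xs <= x <= be -> zr x `^ q <= u x.
  have [|||||cV vE Vk] := @power_subsolution R p A p01 cA A0 xs be n zr Zr (ltW xsbe) czr cZr (L1_sub (ltW alxs) (lexx be) Ln) (n0ae _ _).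
  - move=> y /andP[ay _]; have x0y := le_trans (ltW x0xs) ay.
    rewrite (zrE y)// (zrE xs) ?(ltW x0xs)// -addrA -Int_cat ?(ltW x0xs)//.
    by apply: L1_cont => r; apply: cvgM; [exact: cA|exact: cZr].
  - by move=> y /zrb/andP[].
  - by move=> y /andP[/ltW/zrp h /h].
  - by move=> y z ay yz zx; apply: Zrn => //; rewrite (le_trans (ltW alxs)).
  - by right => y _.
  apply: (@barrier xs be (fun x => zr x `^ q) _ _ (ltW alxs) (ltW xsbe) (lexx be) _ cV vE _ _ _ Vk).
  - move=> z /andP[/ltW xz /ltW zb]; have h : xs <= z <= be by rewrite xz.
    by rewrite -(v3E z h) v3b !inE eqxx !orbT.
  - by apply: le_trans uxs; apply: powl; apply: zrb; rewrite lexx ltW.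
  - by rewrite zrbe u_be powR0// gt_eqF.
  - by apply: Lnv => //; [exact: ltW|exact: ltW|move=> y /zrb/andP[]].
  - by move=> z _; exact: nv.
(* Once [u] lies above all barriers and below [N], the three truncations all return [u], and their
   maximum is the original reaction. *)
have vu (v : R -> R) x : v x <= u x -> al <= x <= be -> truncation N (v x) (u x) = u x.
  by move=> vx xab; rewrite /truncation (max_idPl vx); apply/min_idPr/uN.
have FE x : al <= x <= be -> truncated_reaction N v1 v2 v3 x (u x) = reaction x (u x).
  move=> xab; have /andP[ax xb] := xab; rewrite /truncated_reaction !vu ?maxxx//.
  - have [xsx|xxs] := leP xs x; last by rewrite v3E0 ?u0.
    by rewrite v3E ?xsx// ur// xsx.
  - rewrite /v2 /patch; case: ifPn => [|_]; last exact: u0.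
    by rewrite inE/= in_itv/=; exact: uth.
  - have [xsx|xxs] := leP xs x; first by rewrite v1E0 ?u0.
    by rewrite v1E// ul// ax ltW.
exists N, u; split => //.
- by apply: L1_eq LF => x; exact: FE.
- by move=> x xab; rewrite uE// (eq_dirichlet A albe FE).
- by move=> x xab; rewrite u0// uN.
move=> x /andP[ax xb]; have [xxs|xsx] := leP x xs.
  apply: lt_le_trans (ul x _); last by rewrite xxs ltW.
  by rewrite powR_gt0// zlp.
apply: lt_le_trans (ur x _); last by rewrite !ltW.
by rewrite powR_gt0// zrp// ltW.
Qed.

End sublinear_problem.

(** * From the integral equation back to Sobolev spaces *)

Section regularity.
Context {R : realType}.
Implicit Types (f g h u : R -> R) (s t : R).

Lemma L2_eq s t f g : (forall x, s <= x <= t -> f x = g x) -> L2 s t f -> L2 s t g.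
Proof.
move=> fg [mf Lf]; split.
  apply: eq_measurable_fun mf => x; rewrite inE/= in_itv/=; exact: fg.
by apply: L1_eq Lf => x /fg ->.
Qed.

Lemma L2_mul_cont s t f h : s <= t -> L2 s t f -> continuous h ->
  L2 s t (fun x => f x * h x).
Proof.
move=> st Lf ch; have [C C0 hC] := continuous_bounded st ch.
apply: (@L2_bounded _ _ _ _ f C) => //.
  by apply: measurable_funM; [exact: Lf.1|exact: measurable_cont].
apply: ae_in_all => x /andP[sx xt]; rewrite normrM mulrC ler_wpM2r//.
by apply: hC; rewrite !ltW.
Qed.

Lemma eq_Lnorm_itv (q : \bar R) s t f g : (forall x, s < x < t -> f x = g x) ->
  Lnorm_itv q s t f = Lnorm_itv q s t g.
Proof.
move=> fg; rewrite /Lnorm_itv (_ : f \_ `]s, t[ = g \_ `]s, t[)//.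
by apply/funext => x; rewrite /patch; case: ifPn => //; rewrite inE/= in_itv/=; exact: fg.
Qed.

(** The first derivative is [A] times the flux, and the product rule makes [b * u1 - g * A] its
    derivative; this is square integrable because [g] is, which is where L^2 rather than L^1 data
    enters. *)
Lemma dirichlet_positive_W22_0 s t (b g u : R -> R) : s < t -> continuous b ->
  L2 s t g -> continuous u ->
  (forall x, s <= x <= t -> u x = dirichlet s t (wup s b) g x) ->
  (forall x, s < x < t -> 0 < u x) ->
  exists u1 u2, positive_W22_0 s t u u1 u2 /\
    forall x, s < x < t -> - u2 x + b x * u1 x = wup s b x * g x.
Proof.
move=> st cb L2g cu uE u0.
have cA : continuous (wup s b) by exact: wup_continuous.
have A0 x : 0 < wup s b x by exact: wup_gt0.
have Lg := L2_L1 L2g.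
have st' := ltW st.
pose u1 x := wup s b x * flux s t (slope s t (wup s b) g) g x.
pose u2 x := b x * u1 x - g x * wup s b x.
have cu1 : continuous u1 by exact: ivp_integrand_continuous.
have cbu1 : continuous (fun x => b x * u1 x).
  by move=> x; apply: cvgM; [exact: cb|exact: cu1].
have L2u2 : L2 s t u2.
  apply: L2B; first exact: L2_cont.
  exact: L2_mul_cont.
have u1E x : s <= x <= t -> u1 x = u1 s + Int u2 s x.
  move=> /andP[sx xt].
  have Lgx : L1 s x g by exact: L1_sub Lg.
  have cbA : continuous (fun r => b r * wup s b r).
    by move=> r; apply: cvgM; [exact: cb|exact: cA].
  have dA r : s < r < x -> is_derive r 1 (wup s b) (b r * wup s b r).
    by move=> /andP[sr _]; exact: is_derive_wup.
  have fE r : s <= r <= x ->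
      slope s t (wup s b) g + Int (fun y => - g y) s r = flux s t (slope s t (wup s b) g) g r.
    move=> /andP[sr rx]; rewrite /flux /prim clamp_id ?sr ?(le_trans rx)// IntN//.
    by apply: L1_sub Lg; rewrite ?lexx ?(le_trans rx).
  have := primitive_integration_by_parts (slope s t (wup s b) g) sx (L1N Lgx) cA cbA dA.
  have fs : flux s t (slope s t (wup s b) g) g s = slope s t (wup s b) g.
    by rewrite -fE ?lexx// Int_nil// addr0.
  rewrite fE ?sx ?lexx// -IntD.
  - rewrite /u1 fs [in X in _ -> X]mulrC [_ * slope _ _ _ _]mulrC => e.
    apply/eqP; rewrite -subr_eq0 opprD addrA subr_eq0; apply/eqP; rewrite e.
    by apply: eq_Int => r srx; rewrite fE// /u2 /u1; ring.
  - apply: (@L1_eq _ _ _ (fun r => b r * u1 r)); last exact: L1_cont.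
    by move=> r srx; rewrite fE// /u1; ring.
  - by apply: L1_mul_cont => //; exact: L1N.
exists u1, u2; split; last by move=> x _; rewrite /u2; ring.
have uI x : s <= x <= t -> u x = Int u1 s x by move=> /uE.
split => //; last exact: continuous_subspaceT.
- split; split; try by apply/Lspace2P => //; exact: L2_cont.
  + apply: (@primitive_weak_derivative _ _ _ _ _ 0) => //; first exact: L1_cont.
    by move=> x /uI ->; rewrite add0r.
  + by apply: (@primitive_weak_derivative _ _ _ _ _ (u1 s)) => //; exact: L2_L1.
- apply: W12_0_primitive uI _ => //.
  by rewrite uE ?st' ?lexx// dirichlet_end.
Qed.

Lemma reaction_L2 s t p N C (Ai m c u : R -> R) : s <= t -> 0 < p ->
  continuous Ai -> L2 s t m -> measurable_fun `[s, t] c ->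
  ae_in s t (fun x => `|c x| <= C) -> continuous u ->
  (forall x, s <= x <= t -> 0 <= u x <= N) ->
  L2 s t (fun x => reaction p Ai m c x (u x)).
Proof.
move=> st p0 cAi Lm mc cC cu uN.
have Lc : L2 s t c.
  have L21 : L2 s t (fun=> 1) by apply: L2_cont => x; exact: cvg_cst.
  by apply: (L2_bounded mc L21 (C := C)); apply: ae_in_imp cC => x _; rewrite normr1 mulr1.
apply: L2_mul_cont => //; apply: L2B; last exact: L2_mul_cont.
have cp : continuous (fun x => Num.max (u x) 0 `^ p).
  by move=> x; exact: (continuous_comp (cu x) (@powR_max0_continuous _ _ p0 _)).
apply: L2_eq (L2_mul_cont st Lm cp) => x /uN/andP[ux _].
by rewrite (max_idPl ux).
Qed.

End regularity.

Section eigen_subsolution.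
Context {R : realType}.
Variables (al p : R) (b bt : R -> R).
Hypotheses (cbt : continuous bt) (p01 : 0 < p < 1).
Let A := wup al bt.
Let Ai := wlow al bt.

(** A multiple [th] of the eigenfunction with maximum [lam ^ (- 1 / (1 - p))] satisfies [lam * th =
    lam * th ^ (1 - p) * th ^ p <= th ^ p]; since [w >= 0] on the interval, the linear eigenvalue
    equation becomes a sublinear inequality. *)
Lemma eigen_subsolution (s t lam : R) (w phi phi1 phi2 : R -> R) : al <= s -> s < t ->
  (forall x, s <= x <= t -> b x = bt x) -> L1 s t w ->
  ae_in s t (fun x => 0 <= w x) -> 0 < lam ->
  positive_W22_0 s t phi phi1 phi2 ->
  ae_in s t (fun x => - phi2 x + b x * phi1 x = lam * w x * phi x) ->
  exists xs th Th, [/\ s < xs < t, continuous Th,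
    th xs = lam^-1 `^ (1 - p)^-1,
    [/\ forall x, s <= x <= t -> th x = Int (fun y => A y * Th y) s x,
        th s = 0, th t = 0 & forall x, s <= x <= t -> 0 <= th x <= th xs] &
    L1 s t (fun r => w r * th r `^ p * Ai r) /\
    forall x y, s <= x -> x <= y -> y <= t ->
      Th x - Th y <= Int (fun r => w r * th r `^ p * Ai r) x y].
Proof.
move=> als st bE Lw w0 lam0 hphi eqn.
have [p0 p1] : 0 < p /\ 0 < 1 - p by move: p01 => /andP[? ?]; rewrite subr_gt0.
have [xs [Phi [/andP[sxs xst] cPhi [phis phit] phimax [phiE _ PhiE]]]] :=
  eigen_max cbt als st bE Lw w0 lam0 hphi eqn.
have [_ _ _ phi0] := hphi.
have px : 0 < phi xs by apply: phi0; rewrite in_itv/= sxs.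
pose k := lam^-1 `^ (1 - p)^-1 / phi xs.
have k0 : 0 < k by rewrite divr_gt0// powR_gt0// invr_gt0.
have cA : continuous A by exact: wup_continuous.
have cAi : continuous Ai by exact: wlow_continuous.
have cAP : continuous (fun y => A y * Phi y).
  by move=> y; apply: cvgM; [exact: cA|exact: cPhi].
have cI := continuous_Int (a := s) cAP.
have thb x : s <= x <= t -> 0 <= k * phi x <= k * phi xs.
  by move=> /phimax/andP[h1 h2]; rewrite mulr_ge0 ?(ltW k0)//= ler_pM2l.
have kxs : k * phi xs = lam^-1 `^ (1 - p)^-1 by rewrite /k divfK// gt_eqF.
have Lth : L1 s t (fun r => w r * (k * phi r) `^ p * Ai r).
  have ct : continuous (fun x => Num.max (k * Int (fun y => A y * Phi y) s x) 0 `^ p * Ai x).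
    move=> x; apply: cvgM; last exact: cAi.
    have ck : {for x, continuous (fun x => k * Int (fun y => A y * Phi y) s x)}.
      by apply: cvgM; [exact: cvg_cst|exact: cI].
    exact: (continuous_comp ck (@powR_max0_continuous _ _ p0 _)).
  apply: L1_eq (L1_mul_cont (ltW st) Lw ct) => x xst'.
  by rewrite -phiE// (max_idPl _) ?mulrA//; have /andP[] := thb x xst'.
have Lphi : L1 s t (fun r => w r * phi r * Ai r).
  have ct : continuous (fun x => Int (fun y => A y * Phi y) s x * Ai x).
    by move=> x; apply: cvgM; [exact: cI|exact: cAi].
  apply: L1_eq (L1_mul_cont (ltW st) Lw ct) => x xst'.
  by rewrite -phiE// mulrA.
exists xs, (fun x => k * phi x), (fun x => k * Phi x); split => //.
- by rewrite sxs.
- by move=> x; apply: cvgM; [exact: cvg_cst|exact: cPhi].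
- split; rewrite ?phis ?phit ?mulr0// => x xst'.
  rewrite phiE// -IntZ; last exact: L1_cont.
  by apply: eq_Int => y _; rewrite mulrCA.
split => // x y sx xy yt.
have Lxy : L1 x y (fun r => w r * phi r * Ai r) by exact: L1_sub Lphi.
rewrite -mulrBr PhiE// mulrA -IntZ//.
apply: le_Int_ae; [exact: L1Z|exact: L1_sub Lth|].
apply: ae_in_imp (ae_in_sub sx yt w0) => r /andP[/ltW xr /ltW ry] wr.
have rst : s <= r <= t by rewrite (le_trans sx)// (le_trans ry).
have /andP[t0 txs] := thb r rst.
rewrite !mulrA ler_wpM2r ?(ltW (wlow_gt0 _ _ _))//.
rewrite -mulrA [_ * (w r * _)]mulrCA ler_wpM2l//.
rewrite -mulrA mulrCA.
have [->|tn0] := eqVneq (k * phi r) 0; first by rewrite mulr0 powR_ge0.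
have te : k * phi r = (k * phi r) `^ p * (k * phi r) `^ (1 - p).
  by rewrite -powRD ?tn0 ?implybT// addrC subrK powRr1.
rewrite {1}te mulrCA -[leRHS]mulr1 ler_wpM2l ?powR_ge0//.
rewrite -[leRHS](mulfV (lt0r_neq0 lam0)) ler_wpM2l ?(ltW lam0)//.
apply: (@le_trans _ _ ((k * phi xs) `^ (1 - p))).
  by apply: ge0_ler_powR; rewrite ?nnegrE ?(ltW p1)// (le_trans t0).
by rewrite kxs -powRrM mulVf ?powRr1 ?invr_ge0 ?(ltW lam0)// gt_eqF.
Qed.

End eigen_subsolution.

(** * The normalised weight and the role of its scale *)

Section normalized_weight.
Context {R : realType}.
Variables (al be : R) (b c m : R -> R).
Hypothesis albe : al < be.
Hypothesis cb : {within `[al, be], continuous b}.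
Implicit Types (s t x y : R).

Let bt := b \o clamp al be.
Let cbt : continuous bt. Proof. by apply: continuous_clamp => //; exact: ltW. Qed.
Let A := wup al bt.
Let Ai := wlow al bt.
Let cA : continuous A. Proof. exact: wup_continuous. Qed.
Let cAi : continuous Ai. Proof. exact: wlow_continuous. Qed.
Let Ai0 x : 0 < Ai x. Proof. exact: wlow_gt0. Qed.
Let A0 x : 0 < A x. Proof. exact: wup_gt0. Qed.

Let btE x : al <= x <= be -> b x = bt x.
Proof. by move=> xab; rewrite /bt/= clamp_id. Qed.

Let IntbE x : x <= be -> Int b al x = Int bt al x.
Proof.
by move=> xb; apply: eq_Int => y /andP[ay yx]; rewrite btE// ay (le_trans yx).
Qed.

Lemma BupE x : x <= be -> Bup al b x = A x.
Proof. by move=> xb; rewrite /Bup -/(Int b al x) IntbE. Qed.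

Lemma BlowE x : x <= be -> Blow al b x = Ai x.
Proof. by move=> xb; rewrite /Blow -/(Int b al x) IntbE. Qed.

(** The L^2 norm of [Blow] on (al, x), so that [Kb] is the integral of [A * k]. *)
Let k x := Num.sqrt (Int (fun y => Ai y ^+ 2) al x).

Let ck : continuous k.
Proof.
have cAi2 : continuous (fun y => Ai y ^+ 2).
  by under eq_fun do rewrite expr2; move=> y; apply: cvgM; exact: cAi.
move=> x; have cI := continuous_Int (a := al) cAi2 (x := x).
exact: (continuous_comp cI (@sqrt_continuous R _)).
Qed.

Lemma KbE : Kb al be b = Int (fun x => A x * k x) al be.
Proof.
apply: eq_Int => x /andP[ax xb]; rewrite BupE//; congr (_ * _).
rewrite (@eq_Lnorm_itv _ _ _ _ _ Ai); first by rewrite Lnorm2E//; exact: L2_cont.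
by move=> y /andP[_ yx]; rewrite BlowE// (le_trans (ltW yx)).
Qed.

Let mt := mtilde al be b c m.

Lemma Lnorm_mtilde_neg s t : al <= s -> t <= be -> L1 al be mt ->
  fine (Lnorm_itv 1%:E s t (mt^\- \* Blow al b)) =
  Int (fun x => Num.max (- mt x) 0 * Ai x) s t.
Proof.
move=> als tbe Lm; have [st|ts] := leP s t; last first.
  rewrite Int_nil ?(ltW ts)// (@eq_Lnorm_itv _ _ _ _ _ (cst 0)).
    rewrite Lnorm1E; last by apply: L1_cont => x; exact: cvg_cst.
    by rewrite Int_nil// ltW.
  by move=> x /andP[sx xt]; move: (lt_trans sx xt); rewrite ltNge (ltW ts).
rewrite (@eq_Lnorm_itv _ _ _ _ _ (fun x => Num.max (- mt x) 0 * Ai x)); last first.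
  by move=> y /andP[_ yx]; rewrite /= /funrneg BlowE// (le_trans (ltW yx)).
rewrite Lnorm1E /=; last first.
  apply: L1_mul_cont => //.
  have Lmst : L1 s t mt by exact: L1_sub Lm.
  apply: (L1_le _ (L1_norm Lmst)).
    exact: measurable_funrneg (L1_meas Lmst).
  apply: ae_in_all => x _; rewrite ger0_norm ?le_max ?lexx ?orbT//.
  by rewrite ge_max normr_ge0 andbT -normrN ler_norm.
by apply: eq_Int => x _; rewrite ger0_norm// mulr_ge0 ?(ltW (Ai0 x))// le_max lexx orbT.
Qed.

Hypotheses (mc : measurable_fun `[al, be] c) (L2m : L2 al be m).
Hypothesis c0 : ae_in al be (fun x => 0 <= c x).

Let S := fine (Lnorm_itv 2%:E al be m^\+).

Let L2mp : L2 al be m^\+.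
Proof.
apply: (L2_bounded (g := m) (C := 1)) => //.
  exact: measurable_funrpos L2m.1.
apply: ae_in_all => x _; rewrite mul1r /funrpos ger0_norm ?le_max ?lexx ?orbT//.
by rewrite ge_max normr_ge0 andbT ler_norm.
Qed.

Let SE : S = Num.sqrt (Int (fun x => m^\+ x ^+ 2) al be).
Proof. by rewrite /S Lnorm2E. Qed.

(** If the scale were 0, the convention for division by 0 would reduce [mt] to [- c <= 0]; being
    nonnegative on the interval it would vanish there almost everywhere. *)
Lemma mtilde_scale_gt0 s t : al <= s -> t <= be ->
  ae_in s t (fun x => 0 <= mt x) -> ~ ae_in s t (fun x => mt x = 0) ->
  0 < Kb al be b * S.
Proof.
move=> als tbe mt0 mtN; rewrite lt_def mulr_ge0 ?andbT; last 2 first.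
- rewrite KbE; apply: Rintegral_ge0 => x _.
  by rewrite mulr_ge0 ?sqrtr_ge0// ltW.
- by rewrite SE sqrtr_ge0.
apply/negP => /eqP M0; apply: mtN.
apply: ae_in_imp (ae_in_and mt0 (ae_in_sub als tbe c0)) => x _ [].
rewrite /mt /mtilde -/S M0 invr0 mulr0 sub0r => h1 h2; apply/eqP.
by rewrite eq_le h1 oppr_le0 h2.
Qed.

(** As [c >= 0], [mt] is at most [m^+ / M]. Cauchy-Schwarz bounds the integral of [mt * Ai] up to
    [y] by [k y / Kb], the factor [||m^+||_2] cancelling, and the integral of [A * k / Kb] is 1 by
    the definition of [Kb]. *)
Lemma mtilde_eigenvalue_ge1 s t lam phi phi1 phi2 : al <= s -> s < t -> t <= be ->
  L1 al be mt -> ae_in s t (fun x => 0 <= mt x) -> ~ ae_in s t (fun x => mt x = 0) ->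
  0 < lam -> positive_W22_0 s t phi phi1 phi2 ->
  ae_in s t (fun x => - phi2 x + b x * phi1 x = lam * mt x * phi x) -> 1 <= lam.
Proof.
move=> als st tbe Lm mt0 mtN lam0 hphi eqn.
have M0 := mtilde_scale_gt0 als tbe mt0 mtN.
set M := Kb al be b * S in M0.
have K0 : 0 < Kb al be b.
  rewrite lt_def; apply/andP; split.
    by apply: contraTneq M0 => e; rewrite /M e mul0r ltxx.
  rewrite KbE; apply: Rintegral_ge0 => x _.
  by rewrite mulr_ge0 ?sqrtr_ge0// ltW.
have bE x : s <= x <= t -> b x = bt x.
  by move=> /andP[sx xt]; rewrite btE// (le_trans als sx) (le_trans xt).
have cAk : continuous (fun x => A x * k x).
  by move=> x; apply: cvgM; [exact: cA|exact: ck].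
apply: (eigenvalue_ge1 cbt als st bE (L1_sub als tbe Lm) mt0 lam0 hphi eqn
  (k := fun x => (Kb al be b)^-1 * k x)).
- move=> x y sx xy yt.
  have [alx ybe] := (le_trans als sx, le_trans yt tbe).
  have L2Ai : L2 x y Ai by exact: L2_cont.
  have [mmp Lmp2] := L2mp.
  have L2mxy : L2 x y m^\+.
    split; last exact: L1_sub Lmp2.
    by apply: measurable_funS mmp => //; apply: subset_itvScc; rewrite bnd_simp.
  apply: (@le_trans _ _ (M^-1 * Int (fun r => `|m^\+ r * Ai r|) x y)).
    rewrite -IntZ; last exact/L1_norm/L2_mul.
    apply: le_Int_ae.
    + by apply: L1_mul_cont => //; exact: L1_sub Lm.
    + exact/L1Z/L1_norm/L2_mul.
    apply: ae_in_imp (ae_in_sub alx ybe c0) => r _ cr.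
    rewrite ger0_norm ?mulr_ge0 ?funrpos_ge0 ?(ltW (Ai0 r))// mulrA.
    rewrite ler_wpM2r ?(ltW (Ai0 r))// /mt /mtilde -/S -/M lerBlDr mulrC.
    apply: (@le_trans _ _ (M^-1 * m^\+ r)); last by rewrite lerDl.
    by rewrite ler_pM2l ?invr_gt0// /funrpos le_max lexx.
  have -> : (Kb al be b)^-1 * k y = M^-1 * (S * k y).
    rewrite /M invfM mulrA -[_ * S^-1 * S]mulrA mulVf ?mulr1//.
    by apply: contraTneq M0 => e; rewrite /M e mulr0 ltxx.
  rewrite ler_pM2l ?invr_gt0//; apply: (le_trans (cauchy_schwarz L2mxy L2Ai)).
  rewrite SE ler_pM ?sqrtr_ge0// ler_wsqrtr// Int_sub_le//.
  + by apply: ae_in_all => r _; exact: sqr_ge0.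
  + exact: (L2_cont _ _ cAi).2.
  + by apply: ae_in_all => r _; exact: sqr_ge0.
- apply: L1_cont => x; apply: cvgM; first exact: cA.
  by apply: cvgM; [exact: cvg_cst|exact: ck].
- move=> x /andP[sx xt].
  rewrite (@eq_Int _ _ _ _ (fun x => (Kb al be b)^-1 * (A x * k x))); last first.
    by move=> r _; rewrite mulrCA.
  rewrite IntZ; last exact: L1_cont.
  rewrite -(mulVf (lt0r_neq0 K0)) ler_pM2l ?invr_gt0// KbE Int_sub_le//.
  + exact: le_trans sx.
  + exact: L1_cont.
  + by apply: ae_in_all => r _; rewrite mulr_ge0 ?sqrtr_ge0// ltW.
Qed.

End normalized_weight.

(** * Assembly: normalisation, barriers, rescaling *)

Theorem corollary3p8 (R : realType) (alpha beta p : R) (b c m : R -> R)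
    (hab : alpha < beta) (hp : 0 < p < 1)
    (hb : {within `[alpha, beta], continuous b})
    (hc : Lspace_itv +oo%E alpha beta c)
    (hc0 : ae_in alpha beta (fun x => 0 <= c x))
    (hm : Lspace_itv 2%:E alpha beta m)
    (hms : changes_sign alpha beta m)
    (x0 x1 : R) (hx0 : alpha <= x0) (hx01 : x0 < x1) (hx1 : x1 <= beta) :
  let mu := @lebesgue_measure R in
  let mt := mtilde alpha beta b c m in
  ae_in x0 x1 (fun x => 0 <= mt x) ->
  ~ ae_in x0 x1 (fun x => mt x = 0) ->
  (1 - p) *
    Num.max
      (\int[mu]_(x in `[x0, beta])
        (Bup alpha b x * fine (Lnorm_itv 1%:E x beta (mt^\- \* Blow alpha b))))
      (\int[mu]_(x in `[alpha, x1])
        (Bup alpha b x * fine (Lnorm_itv 1%:E alpha x (mt^\- \* Blow alpha b))))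
    < (lambda1 b mt x0 x1)^-1 ->
  exists u : R -> R,
    [/\ is_solution alpha beta p b c m u,
        forall x, x \in `]alpha, beta[ -> 0 < u x &
        u alpha = 0 /\ u beta = 0].
Proof.
move=> mu mt mt0 mtN.
have hab' := ltW hab.
have /Lspace2P L2m := hm.
have [mc [C [_ cC]]] := LspaceyP hc.
have [p0 p1] : 0 < p /\ 0 < 1 - p by move: hp => /andP[? ?]; rewrite subr_gt0.
pose bt := b \o clamp alpha beta.
have cbt : continuous bt by exact: continuous_clamp.
have bE x : alpha <= x <= beta -> b x = bt x by move=> xab; rewrite /bt/= clamp_id.
pose A := wup alpha bt; pose Ai := wlow alpha bt.
have cA : continuous A by exact: wup_continuous.
have cAi : continuous Ai by exact: wlow_continuous.
have A0 x : 0 < A x by exact: wup_gt0.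
have Ai0 x : 0 < Ai x by exact: wlow_gt0.
have M0 := mtilde_scale_gt0 hab hb L2m hc0 hx0 hx1 mt0 mtN.
pose M := Kb alpha beta b * fine (Lnorm_itv 2%:E alpha beta m^\+).
rewrite -/M in M0.
(* Chosen so that [m' x - c x] is [mt x] by computation. *)
pose m' x := m x / M.
have L2m' : L2 alpha beta m'.
  by have := L2Z M^-1 L2m; apply: L2_eq => x _; rewrite mulrC.
have Lmt : L1 alpha beta mt by apply: L1B; [exact: L2_L1|exact: (Lc mc cC)].
pose n x := Num.max (- mt x) 0 * Ai x.
have n0 x : 0 <= n x by rewrite mulr_ge0 ?(ltW (Ai0 x))// le_max lexx orbT.
have Ln : L1 alpha beta n.
  apply: L1_mul_cont => //; apply: (L1_le _ (L1_norm Lmt)).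
    exact: measurable_funrneg (L1_meas Lmt).
  apply: ae_in_all => x _; rewrite ger0_norm ?le_max ?lexx ?orbT//.
  by rewrite ge_max normr_ge0 andbT -normrN ler_norm.
pose Il := Int (fun x => A x * Int n alpha x) alpha x1.
pose Ir := Int (fun x => A x * Int n x beta) x0 beta.
set J0 := (X in Num.max X _); set J1 := (X in Num.max _ X).
have -> : J0 = Ir.
  apply: eq_Int => x /andP[xx xb]; rewrite (BupE _ _ xb).
  by rewrite Lnorm_mtilde_neg// (le_trans hx0).
have -> : J1 = Il.
  apply: eq_Int => x /andP[xx xb]; rewrite (@BupE _ _ beta) ?(le_trans xb)//.
  by rewrite Lnorm_mtilde_neg// (le_trans xb).
have max_lt (x y z : R) : (1 - p) * Num.max x y < z -> (1 - p) * x < z /\ (1 - p) * y < z.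
  by move=> h; split; apply: le_lt_trans h; rewrite ler_pM2l// le_max lexx ?orbT.
(* Without an eigenvalue, [lambda1] takes its default 0, whose inverse is 0; the hypothesis then
   says that a nonnegative quantity is negative. *)
rewrite /lambda1; case: xgetP => [lam _ [lam0 [phi [phi1 [phi2 [hphi eqn]]]]]|_]; last first.
  rewrite invr0 => /max_lt[_]; rewrite pmulr_rlt0// ltNge => /negP[].
  apply: Rintegral_ge0 => x _; apply: mulr_ge0; first exact: (ltW (A0 x)).
  by apply: Rintegral_ge0 => y _; exact: n0.
move=> hI.
have lam1 := mtilde_eigenvalue_ge1 hab hb L2m hc0 hx0 hx01 hx1 Lmt mt0 mtN lam0 hphi eqn.
have bE01 x : x0 <= x <= x1 -> b x = bt x.
  by move=> /andP[xx xx1]; rewrite bE// (le_trans hx0 xx) (le_trans xx1).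
have [xs [th [Th [/andP[x0xs xsx1] cTh thxs [thE th0 th1 thb] [Lth Thle]]]]] :=
  eigen_subsolution cbt hp hx0 hx01 bE01 (L1_sub hx0 hx1 Lmt) mt0 lam0 hphi eqn.
have [hr hl] := max_lt _ _ _ hI.
have l01 : 0 < lam^-1 <= 1 by rewrite invr_gt0 lam0 invf_le1.
have [N [u [cu Lr uE uN u0]]] :=
  sublinear_solution hab hp cA A0 cAi Ai0 L2m' mc cC hc0 hx0 x0xs xsx1 hx1 l01 cTh thE
    th0 th1 thxs thb Lth Thle (fun=> erefl) Ln hl hr.
(* The rescaling factor satisfies k^(1-p) = M, that is k = k^p M, so k m' u^p = m (k u)^p, while the
   linear part is just multiplied by [k]. *)
pose k := M `^ (1 - p)^-1.
have k0 : 0 < k by rewrite powR_gt0.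
have kM : k = k `^ p * M.
  rewrite -[in X in _ * X](powRr1 (ltW M0)) -(mulVf (lt0r_neq0 p1)) powRrM -/k.
  by rewrite -powRD ?(lt0r_neq0 k0) ?implybT// addrC subrK powRr1// ltW.
have L2r := reaction_L2 hab' p0 cAi L2m' mc cC cu uN.
have ckU : continuous (fun x => k * u x).
  by move=> x; apply: cvgM; [exact: cvg_cst|exact: cu].
have [|x xab|u1 [u2 [hU Ueq]]] := dirichlet_positive_W22_0 hab cbt (L2Z k L2r) ckU.
- by move=> x xab; rewrite dirichletZ// uE.
- by rewrite mulr_gt0// u0.
exists (fun x => k * u x); split.
- exists u1, u2; split => //; apply: ae_in_all => x xab.
  have xab' : alpha <= x <= beta by case/andP: xab => ? ?; rewrite !ltW.
  rewrite /Lop bE// Ueq// /reaction.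
  have /andP[ux _] := uN x xab'.
  rewrite powRM ?(ltW k0)//.
  have -> : wup alpha bt x * (k * ((m' x * u x `^ p - c x * u x) * Ai x)) =
            k * (m' x * u x `^ p - c x * u x) * (A x * Ai x) by rewrite /A; ring.
  rewrite wupK mulr1 mulrBr [c x * (k * _)]mulrCA subrK mulrA {1}kM /m'.
  by rewrite (mulrC (k `^ p)) mulrACA (mulrC M) divfK ?lt0r_neq0// mulrA.
- by move=> x xab; rewrite mulr_gt0// u0// -in_itv.
split; rewrite uE ?lexx ?hab'//.
- by rewrite /dirichlet /ivp Int_nil ?mulr0.
- by rewrite dirichlet_end ?mulr0.
Qed.
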